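(* Let $n$ be a positive integer, let $w \in S_n$ and let $r$ be an integer with $1 \leq r < n$. In the (small) quantum cohomology ring $QH^* F\ell(E)$ of the variety of full flags in $E = \mathbb{C}^n$ one has $$\sigma_{s_r} \cdot \sigma_w = \sum \sigma_{w\, t_{kl}} + \sum q_{ij}\, \sigma_{w\, t_{ij}},$$ where the first sum is over all transpositions $t_{kl}$ such that $k \leq r < l$ and $\ell(w\, t_{kl}) = \ell(w) + 1$, and the second sum is over all transpositions $t_{ij}$ such that $i \leq r < j$ and $\ell(w\, t_{ij}) = \ell(w) - \ell(t_{ij}) = \ell(w) - 2(j-i) + 1$.
   Context: Let $E = \mathbb{C}^n$ and let $F\ell(E) = \{ V_1 \subset V_2 \subset \dots \subset V_{n-1} \subset E \mid \dim V_i = i\}$ be the variety of full flags in $E$. Permutations. $\ell(w)$ denotes the length (number of inversions) of $w \in S_n$, $s_r = (r,r+1)$ is the simple reflection, and for $1 \leq i < j \leq n$, $t_{ij} = (i,j) \in S_n$ is the transposition interchanging $i$ and $j$. Products are compositions of functions, so $(w\,t_{ij})(p) = w(t_{ij}(p))$. $w_0$ denotes the longest element of $S_n$, and $w^\vee = w_0 w$. Schubert varieties. Given a fixed full flag $F_\bullet = (F_1 \subset \dots \subset F_{n-1} \subset E)$ with $\dim F_q = q$ and $w \in S_n$, set $$\Omega_w(F_\bullet) = \{ V_\bullet \in F\ell(E) \mid \dim(V_p \cap F_q) \geq p - r_w(p,n-q)\ \text{ for all } p,q \},$$ where $r_w(p,q) = \#\{ i \leq p \mid w(i) \leq q\}$.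 It has codimension $\ell(w)$. Let $\Omega_w \in H^*(F\ell(E);\mathbb{Z})$ denote its class; the classes $\Omega_w$, $w\in S_n$, form a $\mathbb{Z}$-basis of $H^* F\ell(E) = H^*(F\ell(E);\mathbb{Z})$. Rational curves. A rational curve in $F\ell(E)$ is the image $C$ of a regular map $\mathbb{P}^1 \to F\ell(E)$ (a point is allowed). For each $1 \leq i \leq n-1$ let $C_i \subset \mathrm{Gr}(i,E)$ be the image of $C$ under the projection $V_\bullet \mapsto V_i$, and let $d_i$ be the degree of $C_i$ in the Plücker embedding $\mathrm{Gr}(i,E) \subset \mathbb{P}(\bigwedge^i E)$ (the number of points of intersection with a general hyperplane; so $d_i=0$ if $C_i$ is a point). The multidegree of $C$ is $d = (d_1,\dots,d_{n-1})$; in general a multidegree is a sequence $d=(d_1,\dots,d_{n-1})$ of nonnegative integers, and $|d| = \sum d_i$. Gromov-Witten invariants. For $u,v,w \in S_n$ with $\ell(u)+\ell(v)+\ell(w) = \binom{n}{2} + 2|d|$, the invariant $\langle \Omega_u,\Omega_v,\Omega_w\rangle_d$ is the number of rational curves of multidegree $d$ in $F\ell(E)$ which meet each of $\Omega_u(F_\bullet)$, $\Omega_v(G_\bullet)$, $\Omega_w(H_\bullet)$ for general fixed full flags $F_\bullet, G_\bullet, H_\bullet$ in $E$. If $\ell(u)+\ell(v)+\ell(w) \neq \binom{n}{2} + 2|d|$, then $\langle \Omega_u,\Omega_v,\Omega_w\rangle_d = 0$. Quantum ring. Let $q_1,\dots,q_{n-1}$ be independent variables and $\mathbb{Z}[q]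 = \mathbb{Z}[q_1,\dots,q_{n-1}]$. $QH^* F\ell(E)$ is the $\mathbb{Z}[q]$-algebra which as a $\mathbb{Z}[q]$-module is $H^* F\ell(E) \otimes \mathbb{Z}[q]$, with basis $\sigma_w = \Omega_w \otimes 1$ ($w \in S_n$) and $\mathbb{Z}[q]$-bilinear multiplication given by $$\sigma_u \cdot \sigma_v = \sum_{w,d} \langle \Omega_u, \Omega_v, \Omega_{w^\vee}\rangle_d\, q^d\, \sigma_w,$$ the sum over all $w \in S_n$ and all multidegrees $d$, where $q^d = \prod_i q_i^{d_i}$. For $1 \leq i<j\leq n$ set $q_{ij} = q_i q_{i+1} \cdots q_{j-1}$. *)

(* Defs.v *)
(* MathComp, with the classical sets of MathComp-Analysis. *)
From HB Require Import structures.
From mathcomp Require Import all_boot all_order all_algebra all_fingroup.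
From mathcomp Require Import boolp classical_sets functions cardinality fsbigop.
From mathcomp Require Import reals complex mpoly zify.

Set Implicit Arguments.
Unset Strict Implicit.
Unset Printing Implicit Defensive.

Import GRing.Theory.

Local Open Scope ring_scope.

(* Index conventions.  Positions 1, ..., n are represented by 'I_n and
   1, ..., n-1 by 'I_n.-1, the ordinal i standing for the number i + 1. *)

Section Permutations.
Variable n : nat.
Implicit Types (w t : 'S_n).

Definition inversions w : {set 'I_n * 'I_n} :=
  [set p : 'I_n * 'I_n | (p.1 < p.2)%N && (w p.2 < w p.1)%N].

Definition len w : nat := #|inversions w|.

(* MathComp's product of permutations applies its left factor first. *)
Definition permo w t : 'S_n := (t * w)%g.

Lemma permoE w t p : permo w t p = w (t p).
Proof. by rewrite /permo permM. Qed.

Lemma card_ord_interval (a c : nat) :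
  (c <= n)%N -> #|[set b : 'I_n | (a <= b < c)%N]| = (c - a)%N.
Proof.
move=> cn.
rewrite -sum1dep_card -(big_mkord (fun k => (a <= k < c)%N) (fun=> 1%N)).
rewrite -[RHS]muln1 -sum_nat_const_nat.
rewrite (big_nat_widenl a 0) // (big_nat_widen _ _ _ _ _ cn).
by apply: eq_bigl => k.
Qed.

Lemma len_tperm (i j : 'I_n) : (i < j)%N -> len (tperm i j) = (2 * (j - i) - 1)%N.
Proof.
move=> ij.
have -> : len (tperm i j) =
    #|[set (i, b) | b in [set b : 'I_n | (i.+1 <= b < j.+1)%N]] :|:
      [set (a, j) | a in [set a : 'I_n | (i.+1 <= a < j)%N]]|.
  rewrite /len; congr #|pred_of_set _|; apply/setP => -[a b]; rewrite !inE /=.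
  apply/idP/orP.
    case: tpermP => [->|->|/eqP bi /eqP bj]; case: tpermP => [->|->|/eqP ai /eqP aj] h.
    all: try (by move: h; rewrite -?val_eqE /=; lia).
    - by left; apply/imsetP; exists j; rewrite ?inE //; lia.
    - by right; apply/imsetP; exists a; rewrite ?inE //; lia.
    - by left; apply/imsetP; exists b; rewrite ?inE //; lia.
  case=> /imsetP[c]; rewrite inE => h [-> ->]; rewrite ?tpermL ?tpermR;
    case: tpermP => [ec|ec|/eqP c1 /eqP c2]; move: h; rewrite ?ec -?val_eqE /=; try lia;
    by move: c1 c2; rewrite -!val_eqE /=; lia.
rewrite cardsU !card_imset ?card_ord_interval //; try by move=> ? ? [].
  rewrite (_ : _ :&: _ = finset.set0) ?cards0; first by lia.
  apply/setP => -[a b]; rewrite !inE; apply/andP => -[].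
  move=> /imsetP[c _ [-> ->]] /imsetP[e]; rewrite inE => h [ee _].
  by move: h; rewrite -ee; lia.
by have := ltn_ord j; lia.
Qed.

Definition w0 : 'S_n := perm (@rev_ord_inj n).

Lemma len_w0_max w : (len w <= len w0)%N.
Proof.
apply/subset_leq_card/fintype.subsetP => -[a b]; rewrite !inE /= => /andP[ab _].
rewrite ab !permE /=; have := ltn_ord b; lia.
Qed.

Lemma w0_unique w : len w = len w0 -> w = w0.
Proof.
move=> ww0.
have sub : inversions w \subset inversions w0.
  apply/fintype.subsetP => -[a b]; rewrite !inE /= => /andP[ab _].
  rewrite ab !permE /=; have := ltn_ord b; lia.
have eqi : inversions w = inversions w0.
  by apply/eqP; rewrite eqEcard sub /= -/(len w) -/(len w0) ww0.
have dec (a b : 'I_n) : (a < b)%N -> (w b < w a)%N.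
  move=> ab; have : (a, b) \in inversions w0.
    by rewrite !inE ab !permE /=; have := ltn_ord b; lia.
  by rewrite -eqi !inE ab.
have lo k : forall a : 'I_n, (n - a.+1 = k)%N -> (k <= w a)%N.
  elim: k => // k IH a ak.
  have an : (a.+1 < n)%N by lia.
  have h : (k <= w (Ordinal an))%N by apply: IH => /=; lia.
  by apply: leq_ltn_trans h (dec _ _ _).
have hi k : forall a : 'I_n, nat_of_ord a = k -> (w a + k < n)%N.
  elim: k => [|k IH] a ak; first by have := ltn_ord (w a); lia.
  have an : (k < n)%N by have := ltn_ord a; lia.
  have h := IH (Ordinal an) erefl.
  have := @dec (Ordinal an) a; rewrite ak => /(_ (ltnSn _)); lia.
apply/permP => a; apply/val_inj; rewrite permE /=.
have := lo _ a erefl; have := hi _ a erefl; lia.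
Qed.

Definition wdual w : 'S_n := permo w0 w.

Lemma fst_pos_subproof (r : 'I_n.-1) : (r < n)%N.
Proof. by have := ltn_ord r; lia. Qed.

Lemma snd_pos_subproof (r : 'I_n.-1) : (r.+1 < n)%N.
Proof. by have := ltn_ord r; lia. Qed.

Definition simple_refl (r : 'I_n.-1) : 'S_n :=
  tperm (Ordinal (fst_pos_subproof r)) (Ordinal (snd_pos_subproof r)).

Definition rank_fun w (p q : nat) : nat :=
  #|[set i : 'I_n | (i < p)%N && (w i < q)%N]|.

End Permutations.

Local Open Scope classical_set_scope.
Local Open Scope card_scope.

Section Geometry.
Variables (R : realType) (n : nat).
Local Notation C := R[i].
Local Notation E := 'rV[C]_n.

(* Property [P] holds for a general point of the affine space C^T: it holds on
   a nonempty Zariski-open subset. *)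
Definition generally (T : finType) (P : (T -> C) -> Prop) : Prop :=
  exists Q : {mpoly C[#|T|]}, Q != 0 /\
    forall x : T -> C, Q.@[fun k => x (enum_val k)] != 0 -> P x.

Definition flagseq : Type := 'I_n.-1 -> {vspace E}.

Definition Fl : set flagseq :=
  [set V | (forall p : 'I_n.-1, \dim (V p) = p.+1) /\
           (forall p q : 'I_n.-1, (p <= q)%N -> (V p <= V q)%VS)].

Definition Omega (w : 'S_n) (F : flagseq) : set flagseq :=
  [set V | Fl V /\ forall p q : 'I_n.-1,
     (p.+1 - rank_fun w p.+1 (n - q.+1) <= \dim (V p :&: F q))%N].

(* Strictly increasing i-tuples of indices: the standard basis of the i-th
   exterior power of C^n. *)
Definition pindex (i : nat) : finType :=
  {g : {ffun 'I_i -> 'I_n} | [forall a : 'I_i, forall b : 'I_i, (a < b)%N ==> (g a < g b)%N]}.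

(* Homogeneous Pluecker coordinates of a subspace [V] of dimension i: the
   maximal minors of the matrix whose rows are the basis [vbasis V]. *)
Definition pluecker (i : nat) (V : {vspace E}) (g : pindex i) : C :=
  \det (\matrix_(a < i, b < i) (vbasis V)`_a 0 (val g b)).

Definition eval2 (P : {mpoly C[2]}) (v : 'rV[C]_2) : C := P.@[fun k => v 0 k].

(* [f] is only considered on P^1, the set of lines <[v]> with v <> 0.  Regularity
   is that of a map to the product of the projective spaces of the exterior
   powers of E: near each point v0 (where the form [D] does not vanish), each
   component is given by forms of the same degree. *)
Definition regular_map (f : {vspace 'rV[C]_2} -> flagseq) : Prop :=
  (forall v, v != 0 -> Fl (f <[v]>%VS)) /\
  forall (p : 'I_n.-1) (v0 : 'rV[C]_2), v0 != 0 ->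
    exists (e m : nat) (D : {mpoly C[2]}) (P : pindex p.+1 -> {mpoly C[2]}),
      [/\ D \is m.-homog, eval2 D v0 != 0, forall g, P g \is e.-homog &
          forall v, v != 0 -> eval2 D v != 0 ->
            exists c : C, c != 0 /\
              forall g, eval2 (P g) v = c * pluecker (f <[v]>%VS p) g].

Definition rational_curve (X : set flagseq) : Prop :=
  exists f, regular_map f /\ X = [set f <[v]>%VS | v in [set v | v != 0]].

Definition pluecker_degree (i : nat) (X : set {vspace E}) (d : nat) : Prop :=
  generally (fun h : pindex i -> C =>
    [set V | X V /\ \sum_g h g * pluecker V g = 0] #= `I_d).

Definition has_multidegree (X : set flagseq) (d : 'X_{1..n.-1}) : Prop :=
  forall p : 'I_n.-1, pluecker_degree p.+1 [set V p | V in X] (d p).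

(* [F] is the flag spanned by the initial rows of the matrix [A]. *)
Definition row_flag (A : 'I_n -> 'I_n -> C) (F : flagseq) : Prop :=
  Fl F /\ forall q : 'I_n.-1,
    F q = <<[seq \row_j A k j | k : 'I_n <- enum 'I_n & (k <= q)%N]>>%VS.

(* Three general flags are the flags of three general matrices: GL_n -> Fl is
   open and surjective, so this is the same as a nonempty Zariski-open set of
   triples of flags. *)
Definition general_flags (P : flagseq -> flagseq -> flagseq -> Prop) : Prop :=
  generally (fun A : 'I_3 * 'I_n * 'I_n -> C => forall F G H : flagseq,
    row_flag (fun k j => A (inord 0, k, j)) F ->
    row_flag (fun k j => A (inord 1, k, j)) G ->
    row_flag (fun k j => A (inord 2, k, j)) H -> P F G H).

Definition curves_meeting (d : 'X_{1..n.-1}) (X Y Z : set flagseq) :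
    set (set flagseq) :=
  [set K | [/\ rational_curve K, has_multidegree K d,
               K `&` X !=set0, K `&` Y !=set0 & K `&` Z !=set0]].

Definition curve_count (u v w : 'S_n) (d : 'X_{1..n.-1}) (N : nat) : Prop :=
  general_flags (fun F G H =>
    curves_meeting d (Omega u F) (Omega v G) (Omega w H) #= `I_N).

(* [curve_count u v w d] determines its last argument, because two nonempty
   Zariski-open sets of triples of flags meet; [xget] selects that number. *)
Definition GW (u v w : 'S_n) (d : 'X_{1..n.-1}) : nat :=
  if (len u + len v + len w == 'C(n, 2) + 2 * mdeg d)%N
  then xget 0%N [set N | curve_count u v w d N] else 0%N.

Lemma GW_finite_support (u v w : 'S_n) : finite_set [set d | GW u v w d != 0%N].
Proof.
pose K := (len u + len v + len w).+1.
apply: (@sub_finite_set _ _ [set bmnm x | x in [set: 'X_{1..n.-1 < K}]]).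
  move=> d /=; rewrite /GW; case: ifP => [/eqP e _|_ /eqP]; last by [].
  have dK : (mdeg d < K)%N by rewrite /K e; lia.
  by exists (BMultinom dK).
exact/finite_image/finite_finset.
Qed.

End Geometry.

(* The cohomology group enters the quantum ring only as the free Z-module on
   the classes Omega_w, so QH^* Fl(E) is the free Z[q]-module on the
   permutations; ^o is the regular module. *)
Definition Zq (n : nat) := {mpoly int[n.-1]}.

Definition QH (n : nat) : lmodType (Zq n) := {ffun 'S_n -> (Zq n)^o}.

Definition sigma (n : nat) (w : 'S_n) : QH n :=
  [ffun u : 'S_n => ((u == w)%:R : (Zq n)^o)].

Definition qconst (R : realType) (n : nat) (u v w : 'S_n) : Zq n :=
  \sum_(d \in [set: 'X_{1..n.-1}]) ((GW R u v (wdual w) d)%:R * 'X_[d] : {mpoly int[n.-1]}).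

Definition qmul (R : realType) (n : nat) (x y : QH n) : QH n :=
  \sum_(u : 'S_n) \sum_(v : 'S_n)
    ((x : {ffun 'S_n -> _}) u * (y : {ffun 'S_n -> _}) v : Zq n) *:
      (\sum_(w : 'S_n) qconst R u v w *: sigma w).

Lemma qmul_sigma (R : realType) (n : nat) (u v : 'S_n) :
  qmul R (sigma u) (sigma v) = \sum_(w : 'S_n) qconst R u v w *: sigma w.
Proof.
rewrite /qmul (bigD1 u) //= [X in _ + X]big1 ?addr0 => [|u' /negPf uu'].
  rewrite (bigD1 v) //= [X in _ + X]big1 ?addr0 => [|v' /negPf vv'].
    by rewrite !ffunE !eqxx mul1r scale1r.
  by rewrite !ffunE vv' mulr0 scale0r.
by rewrite big1 // => v' _; rewrite !ffunE uu' mul0r scale0r.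
Qed.

Definition qint (n : nat) (i j : 'I_n) : Zq n :=
  \prod_(m < n.-1 | (i <= m < j)%N) 'X_m.

(* Main.v *)
Require Import Defs.
From HB Require Import structures.
From mathcomp Require Import all_boot all_order all_algebra all_fingroup separable.
From mathcomp Require Import boolp classical_sets functions cardinality fsbigop.
From mathcomp Require Import reals complex mpoly zify ring.

Set Implicit Arguments.
Unset Strict Implicit.
Unset Printing Implicit Defensive.

Import GRing.Theory Num.Theory.

Local Open Scope ring_scope.

(* Let G and H be opposite flags, let e be a basis with H_p = <e_1, ..., e_p> and
   G_p = <e_(n-p+1), ..., e_n>, and let K be a curve of multidegree d that meets
   Omega_w(G) in V and Omega_(u^vee)(H) in V'.  The subspaces of dimension p at two
   points of K meet in dimension at least p - d_p (the kernel of a curve of degree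
   d_p is large).  If y <> 1 is the relative position of V and V', then some i < j
   satisfy y(j) <= i < j <= y(i), and replacing y by y t_ij lowers the total defect
   sum_p (p - dim(V_p :&: V'_p)) by j - i and changes the length of the position of
   V' relative to H by at most 2(j - i) - 1.  By induction
   len w + 1 <= len u + 2 |d| whenever d <> 0, and the dimension condition on the
   Gromov-Witten invariant is equality.  Equality forces a single step: u = w t_kl, d_p = 1
   for k <= p < l and d_p = 0 otherwise, and V, V' are the coordinate flags of w
   and u.  Then every C_p is a point or a line, hence K is the curve of the flags
   obtained from that of w by turning e_w(k) into x e_w(k) + y e_w(l); it meets
   Omega_(s_r)(F) exactly when k <= r < l.  For d = 0 the curves are points, those
   of the one-dimensional Richardson varieties, which are curves of the same kind. *)

(** * The Bruhat order by ranks *)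

(** No moduli space and no transversality theorem enters: for flags in an explicit nonempty open set
    the curves are listed one by one. That set only requires G and H to be opposite and the flag of
    w in the basis e, in dimension r, to meet F_(n-r) trivially. The second condition excludes the
    pencils with r outside [k, l) and makes the point of incidence with the divisor unique. The
    number 2(j - i) - 1 counts the adjacent transpositions in a reduced word of t_ij: exchanging two
    adjacent basis vectors changes one subspace of a flag, hence the length of its position by at
    most one. The defect counts double, so each replacement gains at least one. The obstacle is that
    a curve is a set and its degree counts distinct points, whereas polynomials see the degree D of
    a parametrization, possibly a multiple cover. Hence the kernel bound works with a point that has
    many preimages. For the same reason it is not enough to place K inside the pencil: equality of
    sets needs that a nonconstant map from P^1 to P^1 is onto. *)

Section Bruhat.
Local Open Scope nat_scope.
Variable n : nat.
Implicit Types (a b c w u t : 'S_n) (i j k l x y : 'I_n).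

Lemma permo_tperm2 w i j : permo (permo w (tperm i j)) (tperm i j) = w.
Proof. by apply/permP => x; rewrite !permoE tpermK. Qed.

Lemma perm_neq w i j : i != j -> (w i : nat) != w j.
Proof. by apply: contra_neq => /val_inj /perm_inj. Qed.

(** Apart from (x, y), which becomes an inversion, the adjacent transposition keeps increasing pairs
    of positions increasing, so it carries the inversions of [w] bijectively onto the remaining
    ones. *)
Lemma len_adj_up w x y : y = x.+1 :> nat -> (w x < w y)%N ->
  len (permo w (tperm x y)) = (len w).+1.
Proof.
move=> xy wxy; set s := tperm x y.
have mem (a b : 'I_n) : (a < b)%N -> (a, b) != (x, y) -> (s a < s b)%N.
  rewrite xpair_eqE -!val_eqE /= /s.
  by case: tpermP => [->|->|/eqP + /eqP +]; case: tpermP => [->|->|/eqP + /eqP +];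
     rewrite -?val_eqE /=; lia.
have -> : len (permo w s) = #|(x, y) |: [set (s a.1, s a.2) | a in inversions w]|.
  rewrite /len; congr #|pred_of_set _|; apply/setP => -[a b].
  rewrite !inE /= !permoE; apply/andP/orP.
    move=> [ab wab]; case: (boolP ((a, b) == (x, y))) => [|ne]; [by left|right].
    apply/imsetP; exists (s a, s b); rewrite ?inE /= ?tpermK //.
    by rewrite wab mem.
  case=> [/eqP [-> ->]|/imsetP[[c d]]].
    by rewrite /s tpermL tpermR wxy xy ltnSn.
  rewrite inE /= => /andP[cd wcd] [-> ->]; rewrite /s !tpermK wcd mem //.
  by apply/negP => /eqP[cx dy]; move: wcd; rewrite cx dy; lia.
rewrite cardsU1 card_imset; last first.
  by move=> [a b] [c d] [/perm_inj -> /perm_inj ->].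
rewrite (_ : _ \notin _) ?add1n //; apply/imsetP => -[[c d]].
rewrite inE /= => /andP[cd _] [xc yd].
have cy : c = y by apply: (@perm_inj _ s); rewrite -xc /s tpermR.
have dx : d = x by apply: (@perm_inj _ s); rewrite -yd /s tpermL.
by move: cd; rewrite cy dx xy; lia.
Qed.

Lemma len_adj w x y : y = x.+1 :> nat ->
  len (permo w (tperm x y)) = if (w x < w y)%N then (len w).+1 else (len w).-1.
Proof.
move=> xy; case: ifP => wxy; first exact: len_adj_up.
have /(perm_neq w) ne : x != y by rewrite -val_eqE /= xy; lia.
rewrite -{2}(permo_tperm2 w x y) (@len_adj_up (permo w _)) // !permoE tpermL tpermR.
lia.
Qed.

Lemma len_adj_le w x y : y = x.+1 :> nat ->
  (len (permo w (tperm x y)) <= (len w).+1)%N /\ (len w <= (len (permo w (tperm x y))).+1)%N.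
Proof. by move=> xy; rewrite len_adj //; case: ifP; lia. Qed.

Lemma tperm_conj (x x' y : 'I_n) : x != x' -> x' != y -> x != y ->
  tperm x y = (tperm x x' * tperm x' y * tperm x x')%g.
Proof.
move=> h1 h2 h3; apply/permP => z; rewrite !permM.
case: (tpermP x x' z) => [->|->|/eqP zx /eqP zx'].
- by rewrite !tpermL tpermD // eq_sym.
- rewrite (@tpermD _ x' y x) ?tpermL ?tpermD //; by rewrite 1?eq_sym.
case: (tpermP x' y z) => [e|->|/eqP _ /eqP zy]; first by rewrite e eqxx in zx'.
  by rewrite !tpermR.
by rewrite !tpermD // eq_sym.
Qed.

Lemma permo_tperm_conj w (x x' y : 'I_n) : x != x' -> x' != y -> x != y ->
  permo w (tperm x y) =
  permo (permo (permo w (tperm x x')) (tperm x' y)) (tperm x x').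
Proof. by move=> ? ? ?; rewrite (@tperm_conj x x' y) // /permo !mulgA. Qed.

(** With x = i + 1, t_ij is t_ix t_xj t_ix. The middle factor raises the length by induction. Since
    w i < w j, at most one of the two outer adjacent steps goes down, so together they lose
    nothing. *)
Lemma len_tperm_up w i j : (i < j)%N -> (w i < w j)%N ->
  (len w < len (permo w (tperm i j)))%N.
Proof.
move: {2}(j - i)%N (leqnn (j - i)%N) => m; elim: m w i j => [|m IH] w i j; first lia.
move=> jim ij wij.
case: (eqVneq (j : nat) i.+1) => [ji|ne]; first by rewrite len_adj_up.
have i1n : (i.+1 < n)%N by have := ltn_ord j; lia.
pose x := Ordinal i1n.
rewrite (@permo_tperm_conj _ i x j) -?val_eqE /=; try lia.
have := IH (permo w (tperm i x)) x j; rewrite !permoE tpermR tpermD -?val_eqE /=; try lia.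
move=> /(_ ltac:(lia) ltac:(lia) wij).
have := @len_adj w i x erefl.
have := @len_adj (permo (permo w (tperm i x)) (tperm x j)) i x erefl.
rewrite !permoE (@tpermD _ x j i) ?tpermL ?tpermR ?(@tpermD _ i x j) -?val_eqE /=; try lia.
have := @perm_neq w i x; rewrite -val_eqE /= => /(_ ltac:(lia)).
by case: ifP; case: ifP; lia.
Qed.

Local Notation rk := (@rank_fun n).

Lemma rkE w p q : rk w p q = \sum_(i < n) ((i < p) && (w i < q))%N.
Proof. by rewrite /rank_fun -sum1dep_card big_mkcond; apply: eq_bigr => i _; case: ifP. Qed.

Lemma rkS w (x : 'I_n) q : rk w x.+1 q = (rk w x q + (w x < q))%N.
Proof.
rewrite !rkE (bigD1 x) // [in RHS](bigD1 x) //= ltnSn ltnn /=.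
rewrite add0n addnC; congr (_ + _)%N; apply: eq_bigr => i; rewrite -val_eqE /= => ix.
by rewrite ltnS leq_eqVlt (negPf ix).
Qed.

Lemma rk_inj a b : (forall p q, (p <= n)%N -> (q <= n)%N -> rk a p q = rk b p q) -> a = b.
Proof.
move=> ab; apply/permP => x; apply/val_inj => /=.
have h q : (q <= n)%N -> (a x < q)%N = (b x < q)%N.
  move=> qn; have := ab x.+1 q (ltn_ord x) qn; rewrite !rkS ab //; last exact: ltnW.
  by case: (a x < q)%N; case: (b x < q)%N; lia.
have := h (a x).+1 (ltn_ord _); have := h (b x).+1 (ltn_ord _); lia.
Qed.

Lemma rk_pn w p : (p <= n)%N -> rk w p n = p.
Proof.
move=> pn; rewrite -{2}(subn0 p) -(card_ord_interval 0 pn) /rank_fun.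
by congr #|pred_of_set _|; apply/setP => i; rewrite !inE ltn_ord andbT.
Qed.

Lemma rk_nq w q : (q <= n)%N -> rk w n q = q.
Proof.
move=> qn; rewrite -{2}(subn0 q) -(card_ord_interval 0 qn) /rank_fun.
rewrite -[RHS](card_preimset _ (@perm_inj _ w)).
by congr #|pred_of_set _|; apply/setP => i; rewrite !inE ltn_ord.
Qed.

Lemma rk_compl w p q : (p <= n)%N ->
  #|[set i : 'I_n | (i < p)%N && (q <= w i)%N]| = (p - rk w p q)%N.
Proof.
move=> pn; rewrite -{2}(rk_pn w pn) !rkE -sum1dep_card big_mkcond -sumnB => [|i _].
  by apply: eq_bigr => i _; rewrite ltn_ord; case: ifP; case: (i < p)%N; case: ltnP.
by rewrite ltn_ord; case: (i < p)%N; case: ltnP.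
Qed.

Lemma rk_rev w p q : (p <= n)%N -> (q <= n)%N ->
  rk (permo (w0 n) w) p q = (p - rk w p (n - q))%N.
Proof.
move=> pn qn; rewrite -rk_compl // /rank_fun; congr #|pred_of_set _|; apply/setP => i.
rewrite !inE permoE permE /=; have := ltn_ord (w i); case: (i < p)%N => //=; lia.
Qed.

Lemma rk_le w p q : (rk w p q <= p)%N.
Proof.
case: (leqP p n) => [pn|np].
  rewrite -{2}(rk_pn w pn); apply/subset_leq_card/fintype.subsetP => i.
  by rewrite !inE ltn_ord andbT => /andP[].
apply: leq_trans (ltnW np); rewrite -[X in (_ <= X)%N]card_ord; exact: max_card.
Qed.

(** The Bruhat order in its rank form. The inequality is reversed because a larger permutation has
    fewer small values in its first positions. *)
Definition ble a b := forall p q, (p <= n)%N -> (q <= n)%N -> (rk b p q <= rk a p q)%N.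

(** Only positions i and j change, and their contributions cancel outside a rectangle. *)
Lemma rk_tperm w i j p q : (i < j)%N -> (w i < w j)%N ->
  rk w p q = (rk (permo w (tperm i j)) p q + [&& (i < p), (p <= j), (w i < q) & (q <= w j)])%N.
Proof.
move=> ij wij; rewrite !rkE.
have ji : j != i by rewrite -val_eqE /=; lia.
rewrite (bigD1 i) // (bigD1 j) //= [in RHS](bigD1 i) // [in RHS](bigD1 j) //=.
rewrite [X in (_ + (_ + X))%N](eq_bigr
   (fun x => ((x < p) && (permo w (tperm i j) x < q))%N : nat)); last first.
  by move=> x /andP[xi xj]; rewrite permoE tpermD // eq_sym.
rewrite !permoE tpermL tpermR.
move: (\sum_(_ < _ | _) _) => S; lia.
Qed.

(* Bjorner-Brenti: at the first [i] where [a] and [b] differ, the smallest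
   [j > i] with [a i < a j <= b i] gives a transposition staying below [b]. *)
Lemma ble_step a b : ble a b -> a != b ->
  exists i j, [/\ (i < j)%N, (a i < a j)%N & ble (permo a (tperm i j)) b].
Proof.
move=> ab /eqP neq.
have [i0 hi0] : exists i, a i != b i.
  by apply/existsP; apply: contra_notT neq => /existsPn h; apply/permP => x; apply/eqP/negPn.
have [i hi imin] : exists2 i, a i != b i & forall x, a x != b x -> (i <= x)%N.
  by case: (@arg_minnP _ i0 (fun x => a x != b x) val hi0) => i; exists i.
have same x : (x < i)%N -> a x = b x.
  by move=> xi; apply/eqP; apply: contraTT xi => /imin; rewrite -leqNgt.
have rksame q : rk a i q = rk b i q.
  rewrite !rkE; apply: eq_bigr => x _; case xi : (x < i)%N => //=.
  by rewrite same.
have aib : (a i < b i)%N.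
  rewrite ltnNge leq_eqVlt negb_or val_eqE eq_sym hi /=; apply/negP => ba.
  have := ab i.+1 (b i).+1 (ltn_ord _) (ltn_ord _); rewrite !rkS rksame; lia.
pose P := fun j : 'I_n => (i < j)%N && (a i < a j <= b i)%N.
have [j1 Pj1] : exists j, P j.
  have /permP : (a * a^-1)%g = 1%g by rewrite mulgV.
  move=> aa; exists ((a^-1)%g (b i)); rewrite /P permKV leqnn aib.
  rewrite !andbT ltnNge; apply/negP => h.
  have := permKV a (b i); set x := _ (b i) in h *; move=> ax.
  move: h; rewrite leq_eqVlt => /orP[/eqP /val_inj xi|/same e'].
    by move: aib; rewrite -ax xi ltnn.
  by have := e'; rewrite ax => /perm_inj xi; move: hi; rewrite xi e' eqxx.
have [j /and3P[ij aij ajb] jmin] : exists2 j, P j & forall x, P x -> (j <= x)%N.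
  by case: (@arg_minnP _ j1 P val Pj1) => j; exists j.
exists i, j; split=> // p q pn qn.
have := rk_tperm p q ij aij; have := ab p q pn qn.
case: (boolP ([&& (i < p)%N, (p <= j)%N, (a i < q)%N & (q <= a j)%N])); last by lia.
move=> /and4P[ip pj aq qa] _ rkE1.
suff : (rk b p q < rk a p q)%N by lia.
have h1 := ab p (b i).+1 pn (ltn_ord _).
(* Positions before [p] with value in [q, b i]. By minimality of [j] those of [a] are among those of
   [b], and [i] occurs only for [b]. *)
pose M c := [set x : 'I_n | (x < p)%N && (q <= c x < (b i).+1)%N].
have split c : rk c p (b i).+1 = (rk c p q + #|M c|)%N.
  rewrite !rkE /M -sum1dep_card [X in (_ + X)%N]big_mkcond -big_split /=.
  by apply: eq_bigr => x _; case: (x < p)%N => //=; do 3?case: ifP; lia.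
move: h1; rewrite !split.
suff : (#|M a| < #|M b|)%N by lia.
apply: proper_card; apply/properP; split.
  apply/fintype.subsetP => x; rewrite !inE => /andP[xp qx]; rewrite xp /=.
  case: (ltnP x i) => [/same <- //|].
  rewrite leq_eqVlt => /orP[/eqP /val_inj xi|ix]; first by move: qx; rewrite -xi; lia.
  have : P x by rewrite /P ix; lia.
  by move/jmin; lia.
by exists i; rewrite !inE ip /=; lia.
Qed.

(** Iterating [ble_step] gives a chain up to [b]; it ends because lengths grow along it and are
    bounded by that of [w0]. Only its first link and the length comparison are recorded. *)
Lemma ble_len a b : ble a b -> a = b \/ exists i j,
  [/\ (i < j)%N, (a i < a j)%N, (len a < len (permo a (tperm i j)) <= len b)%N
    & ble (permo a (tperm i j)) b].
Proof.
move: {2}(len (w0 n) - len a)%N (leqnn (len (w0 n) - len a)%N) => m.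
elim: m a => [|m IH] a am ab.
  case: (eqVneq a b) => [|/(ble_step ab) [i [j [ij aij _]]]]; first by left.
  by have := len_tperm_up ij aij; have := len_w0_max (permo a (tperm i j)); lia.
case: (eqVneq a b) => [|/(ble_step ab) [i [j [ij aij le]]]]; first by left.
right; exists i, j; have up := len_tperm_up ij aij; split=> //; rewrite up /=.
case: (IH (permo a (tperm i j)) _ le) => [|->//|[k [l [_ _ h _]]]]; first lia.
lia.
Qed.

Lemma ble_len_le a b : ble a b -> (len a <= len b)%N.
Proof. by case/ble_len => [->//|[i [j [_ _ h _]]]]; lia. Qed.

Lemma ble_len_eq a b : ble a b -> (len b <= len a)%N -> a = b.
Proof. by case/ble_len => [->//|[i [j [_ _ h _]]]]; lia. Qed.

Lemma ble_cover a b : ble a b -> len b = (len a).+1 -> exists i j,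
  [/\ (i < j)%N, (a i < a j)%N & b = permo a (tperm i j)].
Proof.
case/ble_len => [->|[i [j [ij aij h le]]]]; first lia.
by move=> lb; exists i, j; split=> //; rewrite (ble_len_eq le) //; lia.
Qed.

(** A value in between would split t_ij into three transpositions that each raise the length, so the
    length would grow by at least three. *)
Lemma cover_gap a i j x : (i < j)%N -> (a i < a j)%N ->
  len (permo a (tperm i j)) = (len a).+1 -> (i < x < j)%N -> ~~ (a i < a x < a j)%N.
Proof.
move=> ij aij le /andP[ix xj]; apply/negP => /andP[h1 h2].
have e1 := len_tperm_up ix h1.
have ne1 : i != x by rewrite -val_eqE /=; lia.
have ne2 : x != j by rewrite -val_eqE /=; lia.
have ne3 : i != j by rewrite -val_eqE /=; lia.
have ne1' : x != i by rewrite eq_sym.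
have ne2' : j != x by rewrite eq_sym.
have ne3' : j != i by rewrite eq_sym.
set b := permo a (tperm i x) in e1.
have e2 : (len b < len (permo b (tperm x j)))%N.
  by apply: len_tperm_up => //; rewrite !permoE tpermR tpermD //.
set c := permo b (tperm x j) in e2.
have e3 : (len c < len (permo c (tperm i x)))%N.
  apply: len_tperm_up => //; rewrite !permoE tpermL (@tpermD _ x j i) // tpermL.
  by rewrite (@tpermD _ i x j).
by move: e3; rewrite {2}/c /b -permo_tperm_conj // le; lia.
Qed.

Lemma inversions_w0 w :
  inversions (permo (w0 n) w) = [set p : 'I_n * 'I_n | (p.1 < p.2)%N] :\: inversions w.
Proof.
apply/setP => -[x y]; rewrite !inE !permoE !permE /=.
have := ltn_ord (w x); have := ltn_ord (w y).
case xy: (x < y)%N => //=.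
have /perm_neq -/(_ w) : x != y by rewrite -val_eqE /=; lia.
lia.
Qed.

Lemma card_lt_pairs : #|[set p : 'I_n * 'I_n | (p.1 < p.2)%N]| = 'C(n, 2).
Proof.
rewrite -sum1dep_card -(pair_big_dep xpredT (fun x y : 'I_n => (x < y)%N) (fun _ _ => 1%N)) /=.
rewrite (exchange_big_dep xpredT) //= -bin2_sum big_mkord; apply: eq_bigr => y _.
rewrite sum1dep_card -{2}(subn0 y) -(card_ord_interval 0 (ltnW (ltn_ord y))).
by congr #|pred_of_set _|; apply/setP => x; rewrite !inE.
Qed.

Lemma len_w0 w : (len (permo (w0 n) w) + len w)%N = 'C(n, 2).
Proof.
rewrite -card_lt_pairs /len inversions_w0 cardsD.
have -> : [set p : 'I_n * 'I_n | (p.1 < p.2)%N] :&: inversions w = inversions w.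
  by apply/finset.setIidPr/fintype.subsetP => -[x y]; rewrite !inE => /andP[].
rewrite subnK //; apply/subset_leq_card/fintype.subsetP => -[x y].
by rewrite !inE => /andP[].
Qed.

End Bruhat.

(* [lia] with dimensions and cardinals generalized first, because its preprocessing
   would reduce them. *)
Ltac dlia :=
  repeat match goal with
  | H : context [@dimv _ _ _] |- _ => revert H
  | H : context [@card.body _ _] |- _ => revert H
  end;
  repeat match goal with
  | |- context [@dimv ?K ?V ?U] => let x := fresh "dd" in move: (@dimv K V U) => x
  | |- context [@card.body ?T ?A] => let x := fresh "cc" in move: (@card.body T A) => x
  end; lia.

(** * Relative position of flags *)

Section Flags.
Variables (K : fieldType) (n : nat).
Local Notation E := 'rV[K]_n.
Local Notation rk := (@rank_fun n).
Implicit Types (e f g : 'I_n -> E) (S T : {set 'I_n}) (a b c w u t z : 'S_n).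
Implicit Types (U W : {vspace E}).

Definition cs e S : {vspace E} := (\sum_(i in S) <[e i]>)%VS.
Definition is_basis e : Prop := cs e [set: 'I_n] = fullv.
Definition init (p : nat) : {set 'I_n} := [set i : 'I_n | (i < p)%N].
Definition flag e (p : nat) : {vspace E} := cs e (init p).

Lemma dim_E : \dim {: E} = n.
Proof. by rewrite dimvf dim_matrix mul1r. Qed.

Lemma dim_le_n U : (\dim U <= n)%N.
Proof. by rewrite -[X in (_ <= X)%N]dim_E; apply/dimvS/subvf. Qed.

Lemma card_setC_ord S : (#|S| + #|~: S|)%N = n.
Proof. by rewrite cardsC card_ord. Qed.

Lemma card_setUI_ord S T : (#|S :|: T| + #|S :&: T|)%N = (#|S| + #|T|)%N.
Proof. exact: cardsUI. Qed.

Lemma card_init p : (p <= n)%N -> #|init p| = p.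
Proof.
by move=> pn; rewrite -[RHS](subn0 p) -(card_ord_interval 0 pn).
Qed.

Lemma initT p : (n <= p)%N -> init p = [set: 'I_n].
Proof. by move=> np; apply/setP => i; rewrite !inE (leq_trans (ltn_ord i)). Qed.

Lemma initS (x : 'I_n) : init x.+1 = x |: init x.
Proof. by apply/setP => i; rewrite !inE -val_eqE /= ltnS leq_eqVlt. Qed.

Lemma cs_mem e S i : i \in S -> e i \in cs e S.
Proof. by move=> iS; apply: (subvP (sumv_sup i iS (subvv _))); exact: memv_line. Qed.

Lemma cs_subP e S U : reflect (forall i, i \in S -> e i \in U) (cs e S <= U)%VS.
Proof.
apply: (iffP subv_sumP) => h i iS; first by rewrite memvE h.
by rewrite -memvE h.
Qed.

Lemma csS e S T : S \subset T -> (cs e S <= cs e T)%VS.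
Proof. by move=> /fintype.subsetP ST; apply/cs_subP => i /ST; exact: cs_mem. Qed.

Lemma csU e S T : cs e (S :|: T) = (cs e S + cs e T)%VS.
Proof.
apply/eqP; rewrite eqEsubv subv_add !csS ?finset.subsetUl ?finset.subsetUr ?andbT //.
apply/cs_subP => i; rewrite inE => /orP[] iS.
  by rewrite (subvP (addvSl _ _)) // cs_mem.
by rewrite (subvP (addvSr _ _)) // cs_mem.
Qed.

Lemma cs0 e : cs e finset.set0 = 0%VS.
Proof. by rewrite /cs big_set0. Qed.

Lemma cs1 e i : cs e [set i] = <[e i]>%VS.
Proof. by rewrite /cs big_set1. Qed.

Lemma dim_cs_le e S : (\dim (cs e S) <= #|S|)%N.
Proof.
apply: leq_trans (dimv_leq_sum _ _ _) _; rewrite -sum1_card.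
by apply: leq_sum => i _; rewrite dim_vline; case: (_ != _).
Qed.

Lemma cs_comp e (z : 'S_n) S : cs (e \o z) S = cs e (z @: S).
Proof.
apply/eqP; rewrite eqEsubv; apply/andP; split; apply/cs_subP => i.
  by move=> iS; apply: (@cs_mem e (z @: S) (z i)); apply: imset_f.
by case/imsetP => j jS ->; exact: (@cs_mem (e \o z)).
Qed.

Lemma basis_comp e z : is_basis e -> is_basis (e \o z).
Proof.
rewrite /is_basis cs_comp => <-; congr cs; apply/setP => i; rewrite inE.
by apply/imsetP; exists ((z^-1)%g i); rewrite ?inE // permKV.
Qed.

Lemma init_basis_compl e S : is_basis e -> (cs e S + cs e (~: S))%VS = fullv.
Proof. by rewrite -csU finset.setUCr. Qed.

Lemma dim_cs e S : is_basis e -> \dim (cs e S) = #|S|.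
Proof.
move=> eb; apply/eqP; rewrite eqn_leq dim_cs_le /=.
have := dimv_sum_cap (cs e S) (cs e (~: S)); rewrite init_basis_compl // dim_E.
have := dim_cs_le e (~: S); have := card_setC_ord S; dlia.
Qed.

Lemma cs_cap e S T : is_basis e -> (cs e S :&: cs e T)%VS = cs e (S :&: T).
Proof.
move=> eb; apply/esym/eqP; rewrite eqEdim subv_cap !csS ?finset.subsetIl ?finset.subsetIr //=.
have := dimv_sum_cap (cs e S) (cs e T); rewrite -csU !dim_cs // => h.
have := card_setUI_ord S T; dlia.
Qed.

Lemma cs_subE e S T : is_basis e -> (cs e S <= cs e T)%VS = (S \subset T).
Proof.
move=> eb; apply/idP/idP; last exact: csS.
move=> /capv_idPl; rewrite cs_cap // => h; apply/finset.setIidPl/eqP.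
by rewrite eqEcard finset.subsetIl -!(dim_cs _ eb) h leqnn.
Qed.

Lemma cs_memE e S i : is_basis e -> (e i \in cs e S) = (i \in S).
Proof. by move=> eb; rewrite memvE -cs1 cs_subE // finset.sub1set. Qed.

Definition isflag (V : nat -> {vspace E}) : Prop :=
  (forall p, (p <= n)%N -> \dim (V p) = p) /\
  (forall p q, (p <= q)%N -> (q <= n)%N -> (V p <= V q)%VS).

Lemma flagP e : is_basis e -> isflag (flag e).
Proof.
move=> eb; split=> [p pn|p q pq qn]; first by rewrite dim_cs // card_init.
by apply: csS; apply/fintype.subsetP => i; rewrite !inE => /leq_trans; apply.
Qed.

Lemma flag0 V : isflag V -> V 0%N = 0%VS.
Proof. by case=> dV _; apply/eqP; rewrite -dimv_eq0 dV. Qed.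

Lemma flagn V : isflag V -> V n = fullv.
Proof. by case=> dV _; apply/eqP; rewrite eqEdim subvf dim_E dV /=. Qed.

Lemma dim_cap_succ U U' W : (U <= U')%VS -> (\dim U' <= (\dim U).+1)%N ->
  (\dim (U' :&: W) <= (\dim (U :&: W)).+1)%N.
Proof.
move=> UU' dU; have := dimv_sum_cap (U' :&: W)%VS U.
have -> : (U' :&: W :&: U = U :&: W)%VS.
  by rewrite (capvC U' W) -capvA (capvC U') (capv_idPl UU') capvC.
have : (\dim (U' :&: W + U) <= \dim U')%N by apply: dimvS; rewrite subv_add capvSl.
lia.
Qed.

(** The Bruhat decomposition, as a common basis of two flags. Let [c i] be the least index for which
    [G] meets V_(i+1) outside V_i, and choose e_i in that difference; a dimension count shows that
    [c] is a permutation. *)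
Lemma bruhat V G : isflag V -> isflag G -> exists e z, [/\ is_basis e,
  forall p, (p <= n)%N -> V p = flag e p &
  forall p, (p <= n)%N -> G p = cs e [set i | (z i < p)%N]].
Proof.
move=> fV fG; have [dV sV] := fV; have [dG sG] := fG.
pose P (i q : 'I_n) := ~~ (V i.+1 :&: G q.+1 <= V i)%VS.
have hP (i : 'I_n) : exists q, P i q && [forall q', P i q' ==> (q <= q')%N].
  have n0 : (n.-1 < n)%N by have := ltn_ord i; lia.
  have Pl : P i (Ordinal n0).
    rewrite /P /= prednK; last by have := ltn_ord i; lia.
    rewrite (flagn fG) capvf; apply: contraTN isT => /dimvS.
    by rewrite !dV // ?ltnn // ltnW.
  case: (@arg_minnP _ (Ordinal n0) (P i) val Pl) => q Pq qmin.
  by exists q; rewrite Pq; apply/forallP => q'; apply/implyP; exact: qmin.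
have /(_ _)/sigW ch := hP.
pose c i := sval (ch i).
have cP i : P i (c i) by have /andP[] := svalP (ch i).
have cmin i q : P i q -> (c i <= q)%N.
  by have /andP[_ /forallP/(_ q)/implyP] := svalP (ch i).
have /(_ _)/sigW ce : forall i : 'I_n, exists v : E,
    [&& v \in V i.+1, v \in G (c i).+1 & v \notin V i].
  move=> i; have /subvPn[v] := cP i; rewrite memv_cap => /andP[v1 v2] v3.
  by exists v; rewrite v1 v2.
pose e i := sval (ce i).
have e1 i : e i \in V i.+1 by have /and3P[] := svalP (ce i).
have e2 i : e i \in G (c i).+1 by have /and3P[] := svalP (ce i).
have e3 i : e i \notin V i by have /and3P[] := svalP (ce i).
have Ve p : (p <= n)%N -> (V p <= flag e p)%VS.
  elim: p => [|p IH] pn; first by rewrite (flag0 fV) sub0v.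
  have pE : nat_of_ord (Ordinal pn) = p by [].
  rewrite /flag -[p.+1]/(Ordinal pn).+1 initS csU cs1.
  have : (V p + <[e (Ordinal pn)]> == V p.+1)%VS.
    rewrite eqEdim subv_add sV //= -memvE (e1 (Ordinal pn)) /= dV // ltnNge.
    apply/negP => h; have : (V p == V p + <[e (Ordinal pn)]>)%VS.
      by rewrite eqEdim addvSl /= dV // ltnW.
    rewrite eqEsubv => /andP[_]; rewrite subv_add -memvE => /andP[_].
    by apply/negP; exact: (e3 (Ordinal pn)).
  by move=> /eqP <-; rewrite addvC addvS // IH // ltnW.
have eb : is_basis e.
  apply/eqP; rewrite eqEsubv subvf /= -(flagn fV) -(initT (leqnn n)); exact: Ve.
have Ve' p : (p <= n)%N -> V p = flag e p.
  by move=> pn; apply/eqP; rewrite eqEdim Ve //= dV // dim_cs // card_init.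
pose D q := [set i | (c i < q)%N].
have Gle q : (q <= n)%N -> (cs e (D q) <= G q)%VS.
  move=> qn; apply/cs_subP => i; rewrite inE => ciq.
  by apply: (subvP (sG _ _ ciq qn)); exact: e2.
(* From V_p to V_(p+1) the intersection with G_q grows only if c_p < q, and then by at most one. *)
have dle q p : (q <= n)%N -> (p <= n)%N -> (\dim (V p :&: G q) <= #|D q :&: init p|)%N.
  move=> qn; elim: p => [|p IH] pn; first by rewrite (flag0 fV) cap0v dimv0.
  rewrite -[p.+1]/(Ordinal pn).+1 initS.
  case: (ltnP (c (Ordinal pn)) q) => ciq.
    apply: leq_trans (dim_cap_succ _ (sV p p.+1 _ _) _) _ => //; first by rewrite !dV // ltnW.
    apply: (@leq_ltn_trans #|D q :&: init p|); first by apply: IH; exact: ltnW.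
    apply: proper_card; apply/fintype.properP; split.
      by apply: finset.setIS; exact: finset.subsetUr.
    by exists (Ordinal pn); rewrite !inE /= ?ciq ?eqxx //= ltnn.
  apply: (@leq_trans #|D q :&: init p|); last first.
    by apply/subset_leq_card/finset.setIS; exact: finset.subsetUr.
  apply: leq_trans (IH (ltnW pn)); apply: dimvS; rewrite subv_cap capvSr andbT.
  case: q qn ciq {IH} => [|q] qn ciq; first by rewrite (flag0 fG) capv0 sub0v.
  apply/negPn/negP => h; have := @cmin (Ordinal pn) (Ordinal qn) h.
  by rewrite leqNgt ciq.
have cardD q : (q <= n)%N -> #|D q| = q.
  move=> qn; apply/eqP; rewrite eqn_leq.
  have := dimvS (Gle q qn); rewrite dim_cs // dG // => -> /=.
  have := dle q n qn (leqnn n); rewrite (flagn fV) capfv dG // initT //.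
  by rewrite finset.setIT.
(* Exactly one index enters [D] at each step, so [c] takes no value twice. *)
have cinj : injective c.
  move=> i j cij; have := cardD (c i).+1 (ltn_ord _).
  have -> : D (c i).+1 = D (c i) :|: [set x | c x == c i].
    by apply/setP => x; rewrite !inE -val_eqE /= ltnS leq_eqVlt orbC.
  rewrite cardsU (_ : _ :&: _ = finset.set0); last first.
    by apply/setP => x; rewrite !inE -val_eqE /=; lia.
  rewrite cards0 cardD ?subn0; last exact: ltnW.
  rewrite -[X in _ = X]addn1 => /addnI/eqP/cards1P[x] hx.
  have : i \in [set x0 | c x0 == c i] by rewrite inE.
  have : j \in [set x0 | c x0 == c i] by rewrite inE cij.
  by rewrite hx !inE => /eqP -> /eqP ->.
exists e, (perm cinj); split=> // p pn.
have -> : [set i | (perm cinj i < p)%N] = D p by apply/setP => i; rewrite !inE permE.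
by apply/esym/eqP; rewrite eqEdim Gle //= dim_cs // dG // cardD.
Qed.

Definition relpos (V G : nat -> {vspace E}) c : Prop :=
  forall p q, (p <= n)%N -> (q <= n)%N -> \dim (V p :&: G q) = rk c p q.

Lemma relpos_exists V G : isflag V -> isflag G -> exists c, relpos V G c.
Proof.
move=> fV fG; have [e [z [eb hV hG]]] := bruhat fV fG.
exists z => p q pn qn; rewrite hV // hG // cs_cap // dim_cs //.
by congr #|pred_of_set _|; apply/setP => i; rewrite !inE.
Qed.

Lemma relpos_sym_flag f (y : 'S_n) p q : is_basis f ->
  \dim (flag f p :&: flag (f \o y) q) = rk y q p.
Proof.
move=> fb; rewrite /flag cs_comp cs_cap // dim_cs // /rank_fun.
rewrite -[RHS](card_imset _ (@perm_inj _ y)); congr #|pred_of_set _|.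
apply/setP => i; rewrite !inE; apply/andP/imsetP.
  by case=> ip /imsetP[j]; rewrite inE => jq ij; exists j; rewrite // inE jq -ij.
case=> j; rewrite inE => /andP[jq jp] ->; split=> //.
by apply: imset_f; rewrite inE.
Qed.

Definition adapted e (G H : nat -> {vspace E}) : Prop := [/\ is_basis e,
  forall p, (p <= n)%N -> H p = flag e p &
  forall p, (p <= n)%N -> G p = cs e [set i : 'I_n | (n - p <= i)%N]].

Lemma perm_le_id (z : 'S_n) : (forall i, (z i <= i)%N) -> z = 1%g.
Proof.
move=> h; apply/permP => i; rewrite perm1.
move: {2}(i : nat) (leqnn i) => m; elim: m i => [|m IH] i im.
  by apply/val_inj => /=; have := h i; lia.
have := h i; rewrite leq_eqVlt => /orP[/eqP/val_inj//|zi].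
have /perm_inj e : z (z i) = z i by apply: IH; lia.
by move: zi; rewrite e ltnn.
Qed.

(** In a common basis, transversality in dimension i + 1 forces z i >= n - 1 - i, so the product of
    [w0] and [z] moves no point up and is the identity. *)
Lemma adapted_exists G H : isflag G -> isflag H ->
  (forall q, (q <= n)%N -> (H q :&: G (n - q)%N = 0)%VS) -> exists e, adapted e G H.
Proof.
move=> fG fH tr; have [e [z [eb hH hG]]] := bruhat fH fG.
exists e; split=> //.
suff zE : permo (w0 n) z = 1%g.
  move=> p pn; rewrite hG //; congr cs; apply/setP => i; rewrite !inE.
  have /(congr1 (fun s : 'S_n => s i)) := zE; rewrite permoE permE perm1.
  move=> /(congr1 val) /=; have := ltn_ord (z i); have := ltn_ord i; lia.
apply: perm_le_id => i; rewrite permoE permE /=.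
have := tr i.+1 (ltn_ord i); rewrite hH // hG; last by lia.
rewrite cs_cap // => /(congr1 (fun U => \dim U)) /eqP; rewrite dimv0 dim_cs // cards_eq0.
move=> /eqP/setP/(_ i); rewrite !inE ltnSn /=; have := ltn_ord (z i); lia.
Qed.

End Flags.

(** * Position of a flag with respect to one flag and to two opposite flags *)

Section Position.
Variables (K : fieldType) (n : nat).
Local Notation E := 'rV[K]_n.
Local Notation rk := (@rank_fun n).
Implicit Types (e f g : 'I_n -> E) (S T : {set 'I_n}) (a b c w u t z : 'S_n).
Implicit Types (U W : {vspace E}) (V G H : nat -> {vspace E}).

Lemma relpos_eq V V' G c : (forall p, (p <= n)%N -> V p = V' p) ->
  relpos V G c -> relpos V' G c.
Proof. by move=> VV' h p q pn qn; rewrite -VV' // h. Qed.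

Lemma perm_off_two c c' (x y : 'I_n) :
  (forall z : 'I_n, z != x -> z != y -> c z = c' z) -> c' = c \/ c' = permo c (tperm x y).
Proof.
move=> h; have h2 (d : 'S_n) : (forall z : 'I_n, z != x -> z != y -> c z = d z) -> c x = d x -> d = c.
  move=> hd cx; apply/permP => z; case: (eqVneq z x) => [->//|zx].
  case: (eqVneq z y) => [->|zy]; last by rewrite hd.
  apply: contraTeq isT => ne.
  pose v := (c^-1)%g (d y); have cv : c v = d y by rewrite /v permKV.
  case: (eqVneq v x) => vx; first by move: cv ne; rewrite vx cx => /perm_inj <-; rewrite cx eqxx.
  case: (eqVneq v y) => vy; first by move: cv ne; rewrite vy => ->; rewrite eqxx.
  by move: cv; rewrite hd // => /perm_inj vy'; rewrite vy' eqxx in vy.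
case: (eqVneq (c x) (c' x)) => [cx|ne]; [left; exact: h2|right].
have {}h2 : c x = permo c' (tperm x y) x.
  rewrite permoE tpermL; pose v := (c'^-1)%g (c x); have cv : c' v = c x by rewrite /v permKV.
  case: (eqVneq v x) => vx; first by move: cv ne; rewrite vx => ->; rewrite eqxx.
  case: (eqVneq v y) => vy; first by move: cv; rewrite vy => ->.
  by move: cv; rewrite -h // => /perm_inj vx'; rewrite vx' eqxx in vx.
have <- : permo c' (tperm x y) = c.
  apply/permP => z; case: (eqVneq z x) => [->//|zx].
  case: (eqVneq z y) => [->|zy]; last by rewrite permoE tpermD 1?eq_sym // h.
  pose v := (c^-1)%g (permo c' (tperm x y) y).
  have cv : c v = permo c' (tperm x y) y by rewrite /v permKV.
  case: (eqVneq v x) => vx.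
    have xy : x = y by apply: (@perm_inj _ (permo c' (tperm x y))); rewrite -cv vx h2.
    by move: h2; rewrite -xy.
  case: (eqVneq v y) => vy; first by rewrite -cv vy.
  move: cv; rewrite h // permoE tpermR => /perm_inj vx'; by rewrite vx' eqxx in vx.
by rewrite permo_tperm2.
Qed.

(** The ranks agree in every dimension but [y], so the two permutations agree outside x and y and
    differ at most by an adjacent transposition. *)
Lemma relpos_adj V V' G c c' (x y : 'I_n) : y = x.+1 :> nat ->
  (forall p, (p <= n)%N -> p != y -> V p = V' p) ->
  relpos V G c -> relpos V' G c' -> (len c' <= (len c).+1)%N.
Proof.
move=> xy VV' hc hc'.
have rkE' p q : (p <= n)%N -> (q <= n)%N -> p != y -> rk c p q = rk c' p q.
  by move=> pn qn py; rewrite -hc // -hc' // VV'.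
have [->//|->] : c' = c \/ c' = permo c (tperm x y); last first.
  by have [] := len_adj_le c xy.
apply: perm_off_two => z zx zy; apply/val_inj => /=.
have h q : (q <= n)%N -> (c z < q)%N = (c' z < q)%N.
  move=> qn; have := rkE' z.+1 q (ltn_ord z) qn.
  rewrite xy eqSS val_eqE => /(_ zx); rewrite !rkS rkE' //; last exact: ltnW.
  by case: (c z < q)%N; case: (c' z < q)%N; lia.
have := h (c z).+1 (ltn_ord _); have := h (c' z).+1 (ltn_ord _); lia.
Qed.

Lemma flag_tperm e (i j : 'I_n) p : ~~ ((i < p <= j) || (j < p <= i))%N ->
  flag (e \o tperm i j) p = flag e p.
Proof.
move=> h; rewrite /flag cs_comp; congr cs; apply/setP => z; rewrite !inE.
apply/imsetP/idP => [[x]|zp].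
  by rewrite inE => xp ->; move: xp h; case: tpermP => [->|->|//]; lia.
exists (tperm i j z); rewrite ?tpermK // inE.
by move: zp h; case: tpermP => [->|->|//]; lia.
Qed.

(** Conjugation by the transposition of i and i + 1 reduces j - i by one and costs two adjacent
    steps, each altering a single subspace; this is the source of 2(j - i) - 1. *)
Lemma relpos_move e G (i j : 'I_n) c c' : (i < j)%N -> is_basis e -> isflag G ->
  relpos (flag e) G c -> relpos (flag (e \o tperm i j)) G c' ->
  (len c' <= len c + (2 * (j - i) - 1))%N.
Proof.
move: {2}(j - i)%N (leqnn (j - i)%N) => m; elim: m e i j c c' => [|m IH] e i j c c'; first lia.
move=> jim ij eb fG hc hc'.
case: (eqVneq (j : nat) i.+1) => [ji|ne].
  rewrite (_ : 2 * (j - i) - 1 = 1)%N ?addn1; last by rewrite ji; lia.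
  apply: relpos_adj (ji) _ hc hc' => p pn pj; rewrite flag_tperm //; lia.
have i1n : (i.+1 < n)%N by have := ltn_ord j; lia.
pose x := Ordinal i1n.
have fl1 : isflag (flag (e \o tperm i x)) by apply/flagP/basis_comp.
have fl2 : isflag (flag (e \o tperm i x \o tperm x j)) by apply/flagP/basis_comp/basis_comp.
have [c1 h1] := relpos_exists fl1 fG; have [c2 h2] := relpos_exists fl2 fG.
have l1 : (len c1 <= (len c).+1)%N.
  apply: (@relpos_adj _ _ _ _ _ i x erefl _ hc h1) => p pn /= px.
  by rewrite flag_tperm //=; lia.
have l2 : (len c2 <= len c1 + (2 * (j - x) - 1))%N.
  apply: IH h1 h2 => //=; [lia|lia|exact: basis_comp].
have l3 : (len c' <= (len c2).+1)%N.
  apply: (@relpos_adj _ _ _ _ _ i x erefl _ h2 hc') => p pn /= px.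
  rewrite -(@flag_tperm (e \o tperm i x \o tperm x j) i x) /=; last lia.
  congr (flag _ p); apply/funext => y /=; congr e.
  rewrite -[in RHS](_ : (tperm i x * tperm x j * tperm i x)%g = tperm i j) ?permM //.
  by rewrite -tperm_conj // -val_eqE /=; lia.
move: l2; rewrite /=; lia.
Qed.

Section Adapted.
Variables (e : 'I_n -> E) (G H : nat -> {vspace E}).
Hypothesis ad : adapted e G H.

Let eb : is_basis e. Proof. by case: ad. Qed.

Lemma adapted_flagH : isflag H.
Proof.
case: ad => _ hH _; split=> [p pn|p q pq qn]; first by rewrite hH // (flagP eb).1.
by rewrite !hH //; [exact: (flagP eb).2|exact: leq_trans qn].
Qed.

Lemma adapted_card p : (p <= n)%N -> #|[set i : 'I_n | (n - p <= i)%N]| = p.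
Proof.
move=> pn; have := card_setC_ord (init n (n - p)); rewrite card_init ?leq_subr //.
rewrite (_ : ~: _ = [set i : 'I_n | (n - p <= i)%N]); first by dlia.
by apply/setP => i; rewrite !inE -leqNgt.
Qed.

Lemma adapted_flagG : isflag G.
Proof.
case: ad => _ _ hG; split=> [p pn|p q pq qn].
  by rewrite hG // dim_cs // adapted_card.
rewrite !hG //; last exact: leq_trans qn.
by apply: csS; apply/fintype.subsetP => i; rewrite !inE; lia.
Qed.

Lemma adapted_capHG p q : (p <= n)%N -> (q <= n)%N ->
  (H p :&: G q)%VS = cs e [set i : 'I_n | (n - q <= i < p)%N].
Proof.
case: ad => _ hH hG pn qn; rewrite hH // hG // cs_cap //; congr cs.
by apply/setP => i; rewrite !inE andbC.
Qed.

(** H_q and G_(n-q) are complementary, so the two intersections are independent inside V_p. *)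
Lemma dim_cap_GH V p q : isflag V -> (p <= n)%N -> (q <= n)%N ->
  (\dim (V p :&: G (n - q)%N) + \dim (V p :&: H q) <= p)%N.
Proof.
move=> [dV sV] pn qn; rewrite -[X in (_ <= X)%N](dV p pn) -dimv_sum_cap.
have -> : (V p :&: G (n - q)%N :&: (V p :&: H q) = 0)%VS.
  apply/eqP; rewrite -subv0; apply: (@subv_trans _ _ (H q :&: G (n - q)%N)%VS).
    by rewrite subv_cap; apply/andP; split;
      [exact: subv_trans (capvSr _ _) (capvSr _ _)|exact: subv_trans (capvSl _ _) (capvSr _ _)].
  rewrite adapted_capHG ?leq_subr // (_ : [set i : 'I_n | _] = finset.set0) ?cs0 ?subvv //.
  by apply/setP => i; rewrite !inE; lia.
by rewrite dimv0 addn0; apply: dimvS; rewrite subv_add !capvSl.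
Qed.

(** By [dim_cap_GH] the two Schubert conditions give p - rk w + rk u <= p: a Richardson variety with
    a point needs w <= u. *)
Lemma ble_of_flag V w u : isflag V ->
  (forall p q, (p <= n)%N -> (q <= n)%N -> (p - rk w p q <= \dim (V p :&: G (n - q)%N))%N) ->
  (forall p q, (p <= n)%N -> (q <= n)%N -> (rk u p q <= \dim (V p :&: H q))%N) ->
  ble w u.
Proof.
move=> fV hw hu p q pn qn; have := hw p q pn qn; have := hu p q pn qn.
have := dim_cap_GH fV pn qn; have := rk_le w p q; dlia.
Qed.

(** G_(n-c) and H_(c+1) meet in the line of e_c, and the excess of dimension puts a nonzero vector
    of that line into V_p. *)
Lemma mem_cap_dims V p (c : 'I_n) : isflag V -> (p <= n)%N ->
  (p < \dim (V p :&: G (n - c)%N) + \dim (V p :&: H c.+1))%N -> e c \in V p.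
Proof.
move=> [dV _] pn; rewrite -dimv_sum_cap => h.
have : (\dim (V p :&: G (n - c)%N + V p :&: H c.+1) <= p)%N.
  by rewrite -[X in (_ <= X)%N](dV p pn); apply: dimvS; rewrite subv_add !capvSl.
have sub : (V p :&: G (n - c)%N :&: (V p :&: H c.+1) <= V p :&: <[e c]>)%VS.
  rewrite subv_cap; apply/andP; split; first exact: subv_trans (capvSl _ _) (capvSl _ _).
  apply: (@subv_trans _ _ (H c.+1 :&: G (n - c)%N)%VS).
    by rewrite subv_cap; apply/andP; split;
      [exact: subv_trans (capvSr _ _) (capvSr _ _)|exact: subv_trans (capvSl _ _) (capvSr _ _)].
  rewrite adapted_capHG ?leq_subr ?ltn_ord // -cs1; apply: csS.
  apply/fintype.subsetP => i; rewrite !inE -val_eqE /=; have := ltn_ord c; lia.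
move=> h1; have := dimvS sub => h2.
have : (0 < \dim (V p :&: <[e c]>))%N by dlia.
rewrite lt0n dimv_eq0 -vpick0 => v0.
have := memv_pick (V p :&: <[e c]>)%VS; rewrite memv_cap => /andP[vV /vlineP[k vk]].
move: v0 vV; rewrite vk => /negPf; rewrite scaler_eq0 => /negbT; rewrite negb_or => /andP[k0 _].
by move=> /(memvZ k^-1); rewrite scalerA mulVf // scale1r.
Qed.

(** Dual to [mem_cap_dims]: V_p is the sum of its parts in G_(n-c-1) and H_c, both spanned by basis
    vectors other than e_c. *)
Lemma sub_off_coord V p (c : 'I_n) : isflag V -> (p <= n)%N ->
  (p <= \dim (V p :&: G (n - c.+1)%N) + \dim (V p :&: H c))%N ->
  (V p <= cs e [set~ c])%VS.
Proof.
move=> fV pn h; have [dV _] := fV; case: (ad) => _ hH hG.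
have : (V p :&: G (n - c.+1)%N + V p :&: H c == V p)%VS.
  rewrite eqEdim subv_add !capvSl dV //=; apply: leq_trans h _.
  rewrite -dimv_sum_cap (_ : (_ :&: (_ :&: _) = 0)%VS) ?dimv0 ?addn0 //.
  apply/eqP; rewrite -subv0; apply: (@subv_trans _ _ (H c :&: G (n - c.+1)%N)%VS).
    by rewrite subv_cap; apply/andP; split;
      [exact: subv_trans (capvSr _ _) (capvSr _ _)|exact: subv_trans (capvSl _ _) (capvSr _ _)].
  rewrite adapted_capHG ?leq_subr // 1?ltnW // (_ : [set i : 'I_n | _] = finset.set0) ?cs0 ?subvv //.
  by apply/setP => i; rewrite !inE; have := ltn_ord c; lia.
move=> /eqP <-; rewrite subv_add; apply/andP; split.
  apply: subv_trans (capvSr _ _) _; rewrite hG ?leq_subr //; apply: csS.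
  by apply/fintype.subsetP => i; rewrite !inE -val_eqE /=; have := ltn_ord c; lia.
apply: subv_trans (capvSr _ _) _; rewrite hH; last exact: ltnW.
apply: csS.
by apply/fintype.subsetP => i; rewrite !inE -val_eqE /=; have := ltn_ord c; lia.
Qed.

(** The Richardson variety of w and w is a point: the conditions at the value [w x] put its basis
    vector into V_p for every x < p. *)
Lemma coord_of_eq V w : isflag V ->
  (forall p q, (p <= n)%N -> (q <= n)%N -> (p - rk w p q <= \dim (V p :&: G (n - q)%N))%N) ->
  (forall p q, (p <= n)%N -> (q <= n)%N -> (rk w p q <= \dim (V p :&: H q))%N) ->
  forall p, (p <= n)%N -> V p = flag (e \o w) p.
Proof.
move=> fV hw hu p pn; apply/esym/eqP.
rewrite eqEdim (fV.1 _ pn) (flagP (basis_comp w eb)).1 // leqnn andbT.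
apply/cs_subP => x; rewrite inE /= => xp; apply: mem_cap_dims => //.
have := hw p (w x) pn (ltnW (ltn_ord _)); have := hu p (w x).+1 pn (ltn_ord _).
have -> : rk w p (w x).+1 = (rk w p (w x) + 1)%N.
  rewrite !rkE (bigD1 x) // [in RHS](bigD1 x) //= ltnSn ltnn xp /= add0n addnC.
  congr (_ + _)%N; apply: eq_bigr => y yx; congr (nat_of_bool (_ && _)).
  by rewrite ltnS leq_eqVlt val_eqE (inj_eq perm_inj) (negPf yx).
have := rk_le w p (w x); dlia.
Qed.

End Adapted.
End Position.

(** * The defect of two flags *)

Section Core.
Variables (K : fieldType) (n : nat).
Local Notation E := 'rV[K]_n.
Local Notation rk := (@rank_fun n).
Implicit Types (e f g : 'I_n -> E) (a b c w u t z : 'S_n).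
Implicit Types (V G H : nat -> {vspace E}).

(** Take [j] least with y j < j, then [i] greatest below [j] with i < y i. Every position strictly
    between them is fixed, so neither y i nor y j can land there. *)
Lemma exceedance_pair (y : 'S_n) : y != 1%g ->
  exists i j : 'I_n, [/\ (i < j)%N, (j <= y i)%N & (y j <= i)%N].
Proof.
move=> y1.
have [j0 hj0] : exists j, (y j < j)%N.
  apply/existsP; apply: contraR y1 => /existsPn h.
  rewrite -[y]invgK eq_invg1; apply/eqP/perm_le_id => i.
  by have := h ((y^-1)%g i); rewrite permKV -leqNgt.
have [j yj jmin] : exists2 j, (y j < j)%N & forall x, (y x < x)%N -> (j <= x)%N.
  by case: (@arg_minnP _ j0 (fun x => y x < x)%N val hj0) => j; exists j.
have ge (x : 'I_n) : (x < j)%N -> (x <= y x)%N.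
  by move=> xj; rewrite leqNgt; apply/negP => /jmin; lia.
have [i0 hi0] : exists i : 'I_n, (i < j)%N && (i < y i)%N.
  apply/existsP; apply: contraT => /existsPn h.
  have /perm_inj e : y (y j) = y j.
    apply/val_inj/eqP; rewrite eqn_leq ge // andbT.
    by have := h (y j); rewrite yj -leqNgt.
  by move: yj; rewrite e ltnn.
have [i /andP[ij yi] imax] : exists2 i : 'I_n, (i < j)%N && (i < y i)%N &
    forall x : 'I_n, (x < j)%N && (x < y x)%N -> (x <= i)%N.
  by case: (@arg_maxnP _ i0 (fun x => (x < j) && (x < y x))%N val hi0) => i; exists i.
have fixed (x : 'I_n) : (i < x < j)%N -> y x = x.
  move=> /andP[ix xj]; apply/val_inj/eqP; rewrite eqn_leq ge // andbT leqNgt.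
  by apply/negP => h; have := imax x; rewrite xj h => /(_ isT); lia.
exists i, j; split=> //; rewrite leqNgt; apply/negP => h.
  have /perm_inj e := fixed (y i) ltac:(lia); by move: yi; rewrite e ltnn.
have /perm_inj e := fixed (y j) ltac:(lia); by move: yj; rewrite e ltnn.
Qed.

Definition defect V V' : nat := (\sum_(p < n) (p - \dim (V p :&: V' p)%VS))%N.

Lemma flag_compA e a b p : flag (e \o permo a b) p = flag (e \o a \o b) p.
Proof. by congr (flag _ p); apply/funext => x /=; rewrite permoE. Qed.

Lemma flag_tpermK e (i j : 'I_n) p : flag (e \o tperm i j \o tperm i j) p = flag e p.
Proof. by congr (flag _ p); apply/funext => x /=; rewrite tpermK. Qed.

Lemma defect_move (i j : 'I_n) (k k' : nat -> nat) : (i < j)%N ->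
  (forall p, (p <= n)%N -> k p = k' p + (i < p <= j))%N ->
  (\sum_(p < n) k p = \sum_(p < n) k' p + (j - i))%N.
Proof.
move=> ij h; rewrite (eq_bigr (fun p : 'I_n => k' p + (i < p <= j))%N); last first.
  by move=> p _; rewrite h // ltnW.
rewrite big_split /=; congr (_ + _)%N.
have := @card_ord_interval n i.+1 j.+1 (ltn_ord j); rewrite subSS => <-.
rewrite -sum1dep_card [RHS]big_mkcond; apply: eq_bigr => p _.
by rewrite ltnS; case: ifP.
Qed.

(** The hypothesis on [a] amounts to dim (V_p :&: G_(n-q)) = p - rk a p q, that is, [V] lies in the
    open cell of the Schubert variety of [a] for [G]. The induction on the defect keeps [V] and
    moves [V'] towards it. *)
Lemma core_bound e G H V V' a b : adapted e G H -> isflag V -> isflag V' ->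
  relpos V G (permo (w0 n) a) -> relpos V' H b ->
  (forall p, (p <= n)%N -> V p = V' p) \/
  ((len a).+1 <= len b + 2 * defect V V')%N /\
  ((len b + 2 * defect V V' <= (len a).+1)%N ->
   exists i j : 'I_n, [/\ (i < j)%N, b = permo a (tperm i j),
     forall p, (p <= n)%N -> V p = flag (e \o a) p,
     forall p, (p <= n)%N -> V' p = flag (e \o b) p &
     forall p, (p <= n)%N -> (p - \dim (V p :&: V' p)%VS)%N = (i < p <= j)%N]).
Proof.
move=> ad fV; have fG := adapted_flagG ad; have fH := adapted_flagH ad.
have eb : is_basis e by case: ad.
have posG V1 a1 : relpos V1 G (permo (w0 n) a1) -> forall p q, (p <= n)%N -> (q <= n)%N ->
    \dim (V1 p :&: G (n - q)%N) = (p - rk a1 p q)%N.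
  by move=> h p q pn qn; rewrite h ?leq_subr // rk_rev ?leq_subr // subKn.
have order V1 a1 b1 : isflag V1 -> relpos V1 G (permo (w0 n) a1) -> relpos V1 H b1 ->
    ble a1 b1.
  move=> fV1 h1 h2; apply: (ble_of_flag ad fV1) => p q pn qn; first by rewrite (posG _ _ h1).
  by rewrite h2.
have coord V1 a1 : isflag V1 -> relpos V1 G (permo (w0 n) a1) -> relpos V1 H a1 ->
    forall p, (p <= n)%N -> V1 p = flag (e \o a1) p.
  move=> fV1 h1 h2; apply: (coord_of_eq ad fV1) => p q pn qn; first by rewrite (posG _ _ h1).
  by rewrite h2.
move: {2}(defect V V') (leqnn (defect V V')) => m.
elim: m V' b => [|m IH] V' b dm fV' ha hb.
all: have [f [z [fb hf hz]]] := bruhat fV fV'.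
all: pose y : 'S_n := (z^-1)%g.
all: have hy p : (p <= n)%N -> V' p = flag (f \o y) p by
  move=> pn; rewrite hz // /flag cs_comp; congr cs; apply/setP => i; rewrite inE;
  apply/idP/imsetP => [zi|[x]]; [by exists (z i); rewrite ?inE // /y permK
    | by rewrite inE => xp ->; rewrite /y permKV].
all: have dimk V1 (y1 : 'S_n) p : (p <= n)%N -> V1 p = flag (f \o y1) p ->
    (p - \dim (V p :&: V1 p))%N = (p - rk y1 p p)%N by
  move=> pn e1; rewrite hf // e1 relpos_sym_flag.
all: case: (eqVneq y 1%g) => [y1|/exceedance_pair[i [j [ij yi yj]]]];
  first by left=> p pn; rewrite hf // hy // y1; congr (flag _ p); apply/funext => x /=; rewrite perm1.
all: pose y1 := permo y (tperm i j).
all: pose V1 := flag (f \o y1).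
all: have fV1 : isflag V1 by apply/flagP/basis_comp.
all: have kV p : (p <= n)%N -> (p - \dim (V p :&: V' p) =
      (p - \dim (V p :&: V1 p)) + (i < p <= j))%N by
  move=> pn; rewrite (dimk V' y) ?(dimk V1 y1) ?hy //; have := @rk_tperm n y1 i j p p ij;
  rewrite /y1 !permoE tpermL tpermR permo_tperm2; have := rk_le (permo y (tperm i j)) p p;
  have := rk_le y p p; lia.
all: have dV : defect V V' = (defect V V1 + (j - i))%N by
  rewrite /defect; apply: (@defect_move i j (fun p => (p - \dim (V p :&: V' p))%N)
    (fun p => (p - \dim (V p :&: V1 p))%N)).
  (* In the base case the defect is zero, whereas a nontrivial [y] makes it at least j - i > 0. *)
  by move: dm; rewrite dV; lia.
have [b1 hb1] := relpos_exists fV1 fH.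
have hb' : relpos (flag (f \o y)) H b by apply: relpos_eq hb => p pn; rewrite hy.
have V1E p : V1 p = flag (f \o y \o tperm i j) p by rewrite /V1 /y1 flag_compA.
have lb : (len b1 <= len b + (2 * (j - i) - 1))%N.
  apply: (relpos_move ij (basis_comp y fb) fH hb').
  exact: relpos_eq hb1.
(* If [V1] still differs from [V], its own bound applies, and this move adds to it: twice the defect
   drops by 2(j - i), the length rises by at most 2(j - i) - 1. Equality is then impossible. *)
have [VV1|[h1 h2]] := IH V1 b1 ltac:(move: dm; rewrite dV; lia) fV1 ha hb1; last first.
  right; split; first by move: dV; lia.
  by move=> h3; exfalso; move: dV h1 h3; lia.
right.
have hVb1 : relpos V H b1 by apply: relpos_eq hb1 => p pn; rewrite VV1.
have ab1 := order V a b1 fV ha hVb1.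
have lab1 := ble_len_le ab1.
have d0 : defect V V1 = 0%N.
  rewrite /defect big1 // => p _; rewrite -VV1 ?capvv ?fV.1 ?subnn //; exact: ltnW.
split; first by move: dV d0; lia.
move=> hle.
have ab : a = b1 by apply: ble_len_eq => //; move: dV d0; lia.
subst b1; have Va := coord V a fV ha hVb1.
(* Equality also fixes the position of [V'] relative to [G]: the same move bounds the length of [a']
   below by that of [b], while a' <= b. *)
have [c' hc'] := relpos_exists fV' fG.
pose a' := permo (w0 n) c'.
have w02 (s : 'S_n) : permo (w0 n) (permo (w0 n) s) = s.
  by apply/permP => x; rewrite !permoE !permE rev_ordK.
have ha' : relpos V' G (permo (w0 n) a') by rewrite /a' w02.
have haV1 : relpos V1 G (permo (w0 n) a) by apply: relpos_eq ha => p pn; rewrite VV1.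
have lm : (len (permo (w0 n) a') <= len (permo (w0 n) a) + (2 * (j - i) - 1))%N.
  apply: (relpos_move ij (basis_comp y1 fb) fG haV1).
  apply: relpos_eq ha' => p pn; rewrite hy // -[in LHS](@flag_tpermK _ i j).
  by congr (flag _ p); apply/funext => x /=; rewrite permoE.
have := len_w0 a'; have := len_w0 a => la la'.
have ba' := order V' a' b fV' ha' hb.
have a'b : a' = b by apply: ble_len_eq => //; move: dV d0; lia.
rewrite a'b in ha'.
have Vb := coord V' b fV' ha' hb.
exists i, j; split=> //.
  (* Both permutations are the relative position of [V] and [V'], computed once in the basis [e] and
     once in [f]. *)
  have tb : (b * a^-1)%g = tperm i j.
    apply: rk_inj => p q pn qn.
    have := relpos_sym_flag (b * a^-1)%g q p (basis_comp a eb).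
    have -> : flag (e \o a \o (b * a^-1)%g) p = V' p.
      rewrite Vb //; congr (flag _ p); apply/funext => x /=; by rewrite permM permKV.
    rewrite -Va // => <-.
    have := relpos_sym_flag (tperm i j) q p (basis_comp y1 fb).
    have -> : flag (f \o y1 \o tperm i j) p = V' p.
      rewrite hy //; congr (flag _ p); apply/funext => x /=; by rewrite permoE tpermK.
    by rewrite -/(V1 q) -VV1.
  by apply/permP => x; rewrite permoE -tb permM permKV.
by move=> p pn; rewrite kV // -VV1 // capvv fV.1 // subnn.
Qed.

Section Line.
Variables (e : 'I_n -> E) (G H : nat -> {vspace E}) (w : 'S_n) (k l : 'I_n).
Hypotheses (ad : adapted e G H) (kl : (k < l)%N).

(** The ranks of w and w t_kl differ only on the rectangle k < p <= l, w k < q <= w l. Away from it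
    the two conditions force basis vectors into V_p or coordinates out of it; the gap hypothesis
    keeps the values w x with k < x < l away from the rectangle. *)
Lemma line_flag V : (w k < w l)%N ->
  (forall x : 'I_n, (k < x < l)%N -> ~~ (w k < w x < w l)%N) ->
  isflag V ->
  (forall p q, (p <= n)%N -> (q <= n)%N -> (p - rk w p q <= \dim (V p :&: G (n - q)%N))%N) ->
  (forall p q, (p <= n)%N -> (q <= n)%N ->
     (rk (permo w (tperm k l)) p q <= \dim (V p :&: H q))%N) ->
  (forall p, (p <= n)%N -> ~~ (k < p <= l)%N -> V p = flag (e \o w) p) /\
  (forall p, (k < p <= l)%N -> (cs (e \o w) (init n p :\ k) <= V p)%VS /\
      (V p <= cs (e \o w) (l |: init n p))%VS).
Proof.
move=> wkl gap fV hG hH; have eb : is_basis e by case: ad.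
have rkw p q := @rk_tperm n w k l p q kl wkl.
have mem1 p (x : 'I_n) : (p <= n)%N -> (x < p)%N -> 
   ~~ [&& (k < p)%N, (p <= l)%N, (w k <= w x)%N & (w x < w l)%N] -> e (w x) \in V p.
  move=> pn xp; rewrite !negb_and => h; apply: (mem_cap_dims ad) => //.
  have := hG p (w x) pn (ltnW (ltn_ord _)); have := hH p (w x).+1 pn (ltn_ord _).
  have -> : rk (permo w (tperm k l)) p (w x).+1 = (rk w p (w x).+1 -
      [&& (k < p), (p <= l), (w k < (w x).+1) & ((w x).+1 <= w l)])%N by rewrite (rkw p) addnK.
  have -> : rk w p (w x).+1 = (rk w p (w x) + 1)%N.
    rewrite !rkE (bigD1 x) // [in RHS](bigD1 x) //= ltnSn ltnn xp /= add0n addnC.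
    congr (_ + _)%N; apply: eq_bigr => y yx; congr (nat_of_bool (_ && _)).
    by rewrite ltnS leq_eqVlt val_eqE (inj_eq perm_inj) (negPf yx).
  have := rk_le w p (w x); dlia.
have out p : (p <= n)%N -> ~~ (k < p <= l)%N -> V p = flag (e \o w) p.
  move=> pn hp; apply/esym/eqP.
  rewrite eqEdim (fV.1 _ pn) (flagP (basis_comp w eb)).1 // leqnn andbT.
  apply/cs_subP => x; rewrite inE /= => xp; apply: mem1 => //; lia.
have dV := fV.1; have sV := fV.2.
split=> // p /andP[kp pl]; have pn : (p <= n)%N by have := ltn_ord l; lia.
split.
  apply/cs_subP => x; rewrite !inE /= => /andP[xk xp].
  case: (ltnP x k) => xk'.
    have kn := ltnW (ltn_ord k).
    apply: (subvP (sV k p (ltnW kp) pn)); rewrite out // ?ltnn //.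
    by apply: (@cs_mem _ _ (e \o w)); rewrite inE.
  apply: mem1 => //.
  have kx : (k < x < l)%N by move: xk; rewrite -val_eqE /=; lia.
  have := gap x kx; have := @perm_neq n w x k xk; lia.
have sub1 : (V p <= flag (e \o w) l.+1)%VS.
  rewrite -out ?ltn_ord //; last by lia.
  by apply: sV; rewrite ?ltn_ord //; lia.
have sub2 (x : 'I_n) : (p <= x)%N -> (x < l)%N -> (V p <= cs e [set~ (w x)])%VS.
  move=> px xl; apply: (sub_off_coord ad fV pn).
  have := hG p (w x).+1 pn (ltn_ord _); have := hH p (w x) pn (ltnW (ltn_ord _)).
  have -> : rk (permo w (tperm k l)) p (w x) = (rk w p (w x) -
      [&& (k < p), (p <= l), (w k < (w x)) & ((w x) <= w l)])%N by rewrite (rkw p) addnK.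
  have -> : rk w p (w x).+1 = rk w p (w x).
    rewrite !rkE; apply: eq_bigr => y _; congr nat_of_bool.
    case yp: (y < p)%N => //=; rewrite ltnS leq_eqVlt val_eqE (inj_eq perm_inj).
    by rewrite -val_eqE /=; case: eqP => //; lia.
  have kx : (k < x < l)%N by lia.
  have := gap x kx; have xl' : x != l by rewrite -val_eqE /=; lia.
  have := @perm_neq n w x l xl'; have := rk_le w p (w x); dlia.
apply/subvP => v vV.
(* The coordinates at x with p <= x < l are removed one at a time, by intersecting with the
   hyperplanes of [sub2]. *)
have inT (D : {set 'I_n}) : (forall x, x \in D -> (p <= x < l)%N) -> v \in cs (e \o w) (init n l.+1 :\: D).
  move: {2}#|D| (leqnn #|D|) => m; elim: m D => [|m IH] D Dm hD.
    have -> : D = finset.set0 by apply/eqP; rewrite -cards_eq0 -leqn0.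
    by rewrite finset.setD0; exact: (subvP sub1).
  case: (set_0Vmem D) => [->|[x xD]].
    by rewrite finset.setD0; exact: (subvP sub1).
  have := IH (D :\ x); rewrite (cardsD1 x D) xD in Dm => /(_ ltac:(lia)) h.
  have {}h : v \in cs (e \o w) (init n l.+1 :\: (D :\ x)) by apply: h => y; rewrite inE => /andP[_ /hD].
  have /andP[px xl] := hD x xD.
  have h2 : v \in cs (e \o w) [set~ x].
    have := subvP (sub2 x px xl) v vV; rewrite cs_comp; apply: subvP; apply: csS.
    apply/fintype.subsetP => y; rewrite !inE => yx; apply/imsetP; exists ((w^-1)%g y).
      by rewrite !inE; apply: contraNneq yx => <-; rewrite permKV.
    by rewrite permKV.
  have : v \in (cs (e \o w) (init n l.+1 :\: (D :\ x)) :&: cs (e \o w) [set~ x])%VS.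
    by rewrite memv_cap h h2.
  rewrite cs_cap; last exact: basis_comp.
  apply: subvP; apply: csS; apply/fintype.subsetP => y; rewrite !inE.
  by case: (eqVneq y x) => //=; rewrite ?andbF // andbT.
have := inT [set x : 'I_n | (p <= x < l)%N].
move=> /(_ _)/(subvP (csS _ _)) h; apply: h; last by move=> x; rewrite inE.
apply/fintype.subsetP => x; rewrite !inE -val_eqE /=; lia.
Qed.

End Line.
End Core.

(** * The pencil of flags through two coordinate flags *)

Section TFlag.
Variables (K : fieldType) (n : nat).
Local Notation E := 'rV[K]_n.
Local Notation P2 := 'rV[K]_2.
Local Notation rk := (@rank_fun n).
Variables (g : 'I_n -> E) (k l : 'I_n).
Hypotheses (gb : is_basis g) (kl : (k < l)%N).

Definition tphi : 'Hom(P2, E) :=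
  linfun (mulmxr (\matrix_(a < 2) (if a == 0 then g k else g l))).

(* [tflag <[v]>] is the flag of g with g_k replaced by v_0 g_k + v_1 g_l; it runs from
   the flag of g (v = pt10) to that of g t_kl (v = pt01). *)
Definition tflag (L : {vspace P2}) (p : nat) : {vspace E} :=
  if (k < p <= l)%N then (cs g (init n p :\ k) + tphi @: L)%VS else flag g p.

Definition pt10 : P2 := \row_(i < 2) (if i == 0 then 1 else 0).
Definition pt01 : P2 := \row_(i < 2) (if i == 0 then 0 else 1).

Lemma pt10_neq0 : pt10 != 0.
Proof. by apply/eqP => /rowP/(_ 0); rewrite !mxE /= => /eqP; rewrite oner_eq0. Qed.

Lemma pt01_neq0 : pt01 != 0.
Proof. by apply/eqP => /rowP/(_ 1); rewrite !mxE /= => /eqP; rewrite oner_eq0. Qed.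

Lemma tphiE v : tphi v = v 0 0 *: g k + v 0 1 *: g l.
Proof.
rewrite lfunE /= mulmx_sum_row !big_ord_recl big_ord0 addr0 !rowK /=.
by congr (_ *: _ + _ *: _); congr (v _ _); apply/val_inj.
Qed.

Lemma tphi_mem v : tphi v \in cs g [set k; l].
Proof. by rewrite tphiE rpredD ?rpredZ ?cs_mem // !inE eqxx ?orbT. Qed.

Lemma tphi_inj : injective tphi.
Proof.
have kl' : k != l by rewrite -val_eqE /=; lia.
suff h v : tphi v = 0 -> v = 0.
  move=> v v' vv'; apply/eqP; rewrite -subr_eq0; apply/eqP/h.
  by rewrite linearB /= vv' subrr.
rewrite tphiE => /eqP v0.
have gl0 x : g x != 0.
  by apply/eqP => gx; have := cs_memE finset.set0 x gb; rewrite gx mem0v inE.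
have aux (x y : 'I_n) (s t : K) : x != y -> s *: g x + t *: g y == 0 -> s = 0.
  move=> xy; rewrite addr_eq0 => /eqP h; apply/eqP; apply: contraT => s0.
  have : g x \in cs g [set y].
    rewrite -[g x]scale1r -(mulVf s0) -scalerA h rpredZ // rpredN rpredZ //.
    by rewrite cs_mem // inE.
  by rewrite cs_memE // inE (negPf xy).
apply/rowP => i; rewrite !mxE.
case: (unliftP 0 i) => [j ->|->]; last exact: aux v0.
have -> : lift 0 j = 1 by apply/val_inj; rewrite /= [j]ord1.
by apply: (aux l k _ (v 0 0)); [rewrite eq_sym|rewrite addrC].
Qed.

(** A basis whose flag is the member of the pencil at [v]. Position [l] has to complete [tphi v] to
    the plane of g_k and g_l; for v_0 = 0 that vector is a multiple of g_l, so g_k is needed. *)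
Definition tbasis (v : P2) (x : 'I_n) : E :=
  if x == k then tphi v else if x == l then (if v 0 0 == 0 then g k else g l) else g x.

Lemma tbasisP v : v != 0 -> is_basis (tbasis v).
Proof.
move=> v0; have lk : (l == k) = false by apply/negbTE; rewrite -val_eqE /=; lia.
have hk : tphi v \in cs (tbasis v) finset.setT.
  by have := @cs_mem _ _ (tbasis v) finset.setT k; rewrite inE /tbasis eqxx; apply.
have hl : (if v 0 0 == 0 then g k else g l) \in cs (tbasis v) finset.setT.
  by have := @cs_mem _ _ (tbasis v) finset.setT l; rewrite inE /tbasis lk eqxx; apply.
have hkl : g k \in cs (tbasis v) finset.setT /\ g l \in cs (tbasis v) finset.setT.
  move: hk hl; rewrite tphiE; case: eqP => [v00|/eqP v00] h1 h2; split=> //.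
    have v1 : v 0 1 != 0.
      apply: contraNneq v0 => v1; apply/eqP/rowP => i; rewrite mxE.
      case: (unliftP 0 i) => [j ->|->//].
      by have -> : lift 0 j = 1 by apply/val_inj; rewrite /= [j]ord1.
    by move: h1; rewrite v00 scale0r add0r => /(memvZ (v 0 1)^-1); rewrite scalerA mulVf // scale1r.
  have := memvB h1 (memvZ (v 0 1) h2); rewrite addrK => /(memvZ (v 0 0)^-1).
  by rewrite scalerA mulVf // scale1r.
apply/eqP; rewrite eqEsubv subvf /= -gb; apply/cs_subP => x _.
case: (eqVneq x k) => [->|xk]; first by case: hkl.
case: (eqVneq x l) => [->|xl]; first by case: hkl.
have := @cs_mem _ _ (tbasis v) finset.setT x.
by rewrite inE /tbasis (negPf xk) (negPf xl); apply.
Qed.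

Lemma eq_cs (f f' : 'I_n -> E) (S : {set 'I_n}) :
  (forall x, x \in S -> f x = f' x) -> cs f S = cs f' S.
Proof. by move=> h; apply: eq_bigr => x xS; rewrite h. Qed.

Lemma tflag_in v p : (k < p <= l)%N -> tflag <[v]>%VS p = flag (tbasis v) p.
Proof.
move=> kpl; rewrite /tflag kpl limg_line /flag.
have -> : init n p = (init n p :\ k) :|: [set k].
  by apply/setP => x; rewrite !inE; case: eqVneq => [->|_] /=; rewrite ?orbF //; lia.
rewrite csU cs1 finset.setDUl finset.setDv finset.setU0 finset.setDDl finset.setUid.
congr (_ + _)%VS; last by rewrite /tbasis eqxx.
apply: eq_cs => x; rewrite !inE /tbasis => /andP[/negPf -> xp].
by rewrite ifN // -val_eqE /=; lia.
Qed.

Lemma tflag_flag v p : v != 0 -> (p <= n)%N -> tflag <[v]>%VS p = flag (tbasis v) p.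
Proof.
move=> v0 pn; case kpl : (k < p <= l)%N; first exact: tflag_in.
rewrite /tflag kpl; case: (leqP p k) => pk.
  apply: eq_cs => x; rewrite !inE /tbasis => xp.
  by rewrite !ifN // -val_eqE /=; lia.
apply/esym/eqP; rewrite eqEdim !dim_cs ?leqnn ?andbT //; last exact: tbasisP.
apply/cs_subP => x; rewrite inE /tbasis => xp.
have mk : g k \in flag g p by rewrite cs_mem // inE.
have ml : g l \in flag g p by rewrite cs_mem // inE; lia.
case: eqP => _; first by rewrite tphiE rpredD ?rpredZ.
by case: eqP => _; [case: eqP|rewrite cs_mem // inE].
Qed.

Lemma tflagP v : v != 0 -> isflag (tflag <[v]>%VS).
Proof.
move=> v0; have [h1 h2] := flagP (tbasisP v0); split=> [p pn|p q pq qn].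
  by rewrite tflag_flag // h1.
by rewrite !tflag_flag ?h2 // (leq_trans pq).
Qed.

Lemma tflag_sub L p : (k < p <= l)%N ->
  (cs g (init n p :\ k) <= tflag L p)%VS /\ (tflag L p <= cs g (l |: init n p))%VS.
Proof.
move=> kpl; rewrite /tflag kpl addvSl; split=> //.
rewrite subv_add csS /=; last by apply/fintype.subsetP => x; rewrite !inE => /andP[_ ->]; rewrite orbT.
apply/subvP => y /memv_imgP[v _ ->]; have := tphi_mem v.
apply: subvP; apply: csS; apply/fintype.subsetP => x; rewrite !inE => /orP[]/eqP->.
  by case/andP: kpl => ->; rewrite orbT.
by rewrite eqxx.
Qed.

Lemma tphi_cap p : (k < p <= l)%N -> (cs g (init n p :\ k) :&: cs g [set k; l] = 0)%VS.
Proof.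
move=> kpl; rewrite cs_cap // (_ : _ :&: _ = finset.set0) ?cs0 //.
apply/setP => x; rewrite !inE; case: eqVneq => //= xk; case: eqVneq => [->|_] /=; rewrite ?andbF //; lia.
Qed.

Lemma tflag_inj v v' p : (k < p <= l)%N -> v != 0 -> v' != 0 ->
  tflag <[v]>%VS p = tflag <[v']>%VS p -> <[v]>%VS = <[v']>%VS.
Proof.
move=> kpl v0 v'0; rewrite /tflag kpl !limg_line => h.
have : tphi v \in (cs g (init n p :\ k) + <[tphi v']>)%VS.
  by rewrite -h memvE addvSr.
case/memv_addP => a aA [b /vlineP[c ->] hv].
have ha : a = tphi (v - c *: v') by rewrite linearB linearZ /= hv addrK.
have a0 : a \in (cs g (init n p :\ k) :&: cs g [set k; l])%VS.
  by rewrite memv_cap aA ha tphi_mem.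
move: a0; rewrite tphi_cap // memv0 ha => /eqP h0.
have vc : v = c *: v'.
  by apply/eqP; rewrite -subr_eq0; apply/eqP/tphi_inj; rewrite h0 linear0.
have c0 : c != 0 by apply: contraNneq v0 => c0; rewrite vc c0 scale0r.
apply/eqP; rewrite eqEdim !dim_vline v0 v'0 /= andbT -memvE vc.
by rewrite memvZ // memv_line.
Qed.

Lemma is_tflag V : isflag V ->
  (forall p, (p <= n)%N -> ~~ (k < p <= l)%N -> V p = flag g p) ->
  (forall p, (k < p <= l)%N -> (cs g (init n p :\ k) <= V p)%VS /\
      (V p <= cs g (l |: init n p))%VS) ->
  exists2 v, v != 0 & forall p, (p <= n)%N -> V p = tflag <[v]>%VS p.
Proof.
move=> fV out inl.
have k1 : (k < k.+1 <= l)%N by rewrite ltnSn.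
have [i1 i2] := inl _ k1.
have ik : init n k.+1 :\ k = init n k.
  by apply/setP => x; rewrite !inE -val_eqE /=; lia.
have /subvPn[x xV xA] : ~~ (V k.+1 <= cs g (init n k.+1 :\ k))%VS.
  apply: contraTN isT => /dimvS; rewrite (fV.1 _ (ltn_ord k)) dim_cs // ik card_init ?ltnn //.
  exact: ltnW.
have : x \in (cs g (init n k.+1 :\ k) + (<[g k]> + <[g l]>))%VS.
  rewrite -!cs1 -!csU; apply: (subvP (subv_trans i2 _)) xV.
  apply: csS; apply/fintype.subsetP => y; rewrite !inE -!val_eqE /=; lia.
case/memv_addP => a aA [b /memv_addP[c /vlineP[s ->] [d /vlineP[t ->] hb]] hx].
pose v : P2 := \row_(i < 2) (if i == 0 then s else t).
have pv : tphi v = b by rewrite tphiE !mxE /= hb.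
have v0 : v != 0.
  by apply: contraNneq xA => v0; rewrite hx -pv v0 linear0 addr0.
exists v => // p pn; case kpl : (k < p <= l)%N; last by rewrite /tflag kpl out ?kpl.
apply/esym/eqP; rewrite eqEdim (tflagP v0).1 // fV.1 // leqnn andbT.
rewrite /tflag kpl subv_add (inl _ kpl).1 limg_line -memvE /= pv.
have bV : b \in V k.+1.
  have -> : b = x - a by rewrite hx addrC addKr.
  by rewrite memvB // (subvP i1).
by apply: (subvP (fV.2 k.+1 p _ pn)) bV; case/andP: kpl.
Qed.

Lemma tflag10 p : tflag <[pt10]>%VS p = flag g p.
Proof.
case kpl : (k < p <= l)%N; last by rewrite /tflag kpl.
rewrite tflag_in //; apply: eq_cs => x; rewrite inE /tbasis => xp.
case: eqVneq => [->|_]; first by rewrite tphiE !mxE /= scale1r scale0r addr0.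
by rewrite ifN // -val_eqE /=; lia.
Qed.

Lemma tflag01 p : tflag <[pt01]>%VS p = flag (g \o tperm k l) p.
Proof.
case kpl : (k < p <= l)%N; last by rewrite /tflag kpl flag_tperm // kpl; lia.
rewrite tflag_in //; apply: eq_cs => x; rewrite inE /tbasis /= => xp.
case: eqVneq => [->|xk]; first by rewrite tphiE !mxE /= scale1r scale0r add0r tpermL.
have xl : x != l by rewrite -val_eqE /=; lia.
by rewrite ifN // tpermD // eq_sym.
Qed.

(** F has codimension p, so it meets the (p+1)-dimensional span of the pencil; the plane component
    of a common vector is the parameter. *)
Lemma tflag_meet (F : {vspace E}) p : (k < p <= l)%N -> \dim F = (n - p)%N ->
  exists2 v, v != 0 & (0 < \dim (tflag <[v]>%VS p :&: F))%N.
Proof.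
move=> kpl dF.
have pn : (p < n)%N by have := ltn_ord l; lia.
have lp : l \notin init n p by rewrite inE; lia.
have dB : \dim (cs g (l |: init n p)) = p.+1 by rewrite dim_cs // cardsU1 lp card_init // ltnW.
have dBF : (0 < \dim (cs g (l |: init n p) :&: F))%N.
  have := dimv_sum_cap (cs g (l |: init n p)) F; have := dim_le_n (cs g (l |: init n p) + F)%VS.
  dlia.
move: dBF; rewrite lt0n dimv_eq0 -vpick0; set x := vpick _ => x0.
have := memv_pick (cs g (l |: init n p) :&: F)%VS; rewrite -/x memv_cap => /andP[xB xF].
have : x \in (cs g (init n p :\ k) + (<[g k]> + <[g l]>))%VS.
  rewrite -!cs1 -!csU; apply: (subvP _) xB.
  apply: csS; apply/fintype.subsetP => y; rewrite !inE -!val_eqE /=; lia.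
case/memv_addP => a aA [b /memv_addP[c /vlineP[s ->] [d /vlineP[t ->] hb]] hx].
pose v : P2 := \row_(i < 2) (if i == 0 then s else t).
have pv : tphi v = b by rewrite tphiE !mxE /= hb.
have fin v1 : v1 != 0 -> x \in tflag <[v1]>%VS p -> exists2 v, v != 0 & (0 < \dim (tflag <[v]>%VS p :&: F))%N.
  move=> v10 xv; exists v1 => //; rewrite lt0n dimv_eq0; apply: contraNneq x0 => h.
  by rewrite -memv0 -h memv_cap xv.
case: (eqVneq v 0) => v0; last first.
  by apply: fin v0 _; rewrite /tflag kpl limg_line hx -pv memv_add // memv_line.
(* Here [x] lies in the fixed part of the pencil, so any parameter would do. *)
have one0 : pt10 != 0 := pt10_neq0.
apply: fin one0 _; rewrite /tflag kpl hx -pv v0 linear0 addr0.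
by apply: (subvP (addvSl _ _)).
Qed.

(** F meets the span of the pencil in at most a line, because it avoids one hyperplane of that span.
    Two distinct members share only the fixed part, which lies in [flag g p] and avoids F, so they
    cannot both contain the line. *)
Lemma tflag_meet_uniq (F : {vspace E}) p v v' : (k < p <= l)%N ->
  (flag g p :&: F = 0)%VS -> v != 0 -> v' != 0 ->
  (0 < \dim (tflag <[v]>%VS p :&: F))%N -> (0 < \dim (tflag <[v']>%VS p :&: F))%N ->
  <[v]>%VS = <[v']>%VS.
Proof.
move=> kpl gF v0 v'0 h h'; apply: (@tflag_inj _ _ p) => //.
have pn : (p < n)%N by have := ltn_ord l; lia.
pose A := cs g (init n p :\ k); pose B := cs g (l |: init n p).
have lp : l \notin init n p by rewrite inE; lia.
have dBF : (\dim (B :&: F) <= 1)%N.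
  have := @dim_cap_succ _ _ (flag g p) B F; rewrite gF dimv0; apply.
    by apply: csS; exact: finset.subsetUr.
  by rewrite /B /flag !dim_cs // cardsU1 lp card_init // ltnW.
have eqBF u : (0 < \dim (tflag <[u]>%VS p :&: F))%N -> (tflag <[u]>%VS p :&: F = B :&: F)%VS.
  move=> hu; apply/eqP; rewrite eqEdim capvS ?subvv ?(tflag_sub _ kpl).2 //=.
  exact: leq_trans dBF hu.
have AF : (A :&: F = 0)%VS.
  apply/eqP; rewrite -subv0 -gF capvS ?subvv //; apply: csS.
  by apply/fintype.subsetP => y; rewrite !inE => /andP[].
pose Z := (tflag <[v]>%VS p :&: tflag <[v']>%VS p)%VS.
have AZ : (A <= Z)%VS by rewrite subv_cap !(tflag_sub _ kpl).1.
have dA : (\dim A).+1 = p.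
  rewrite dim_cs //; have := cardsD1 k (init n p); rewrite inE (andP kpl).1 card_init; last exact: ltnW.
  by move=> hp; rewrite [RHS]hp.
have dv := (tflagP v0).1 p (ltnW pn); have dv' := (tflagP v'0).1 p (ltnW pn).
have AneZ : A != Z.
  have h0 := h; apply: contraTneq h0 => AZ'; rewrite -leqNgt leqn0 dimv_eq0 -subv0 -AF AZ' /Z.
  by rewrite subv_cap capvSr subv_cap capvSl eqBF // -(eqBF v') // capvSl.
have dZ : (p <= \dim Z)%N.
  rewrite -dA ltn_neqAle dimvS // andbT.
  by apply: contra AneZ => /eqP dAZ; rewrite eqEdim AZ dAZ leqnn.
have /eqP e1 : Z == tflag <[v]>%VS p by rewrite eqEdim capvSl dv.
have /eqP e2 : Z == tflag <[v']>%VS p by rewrite eqEdim capvSr dv'.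
by rewrite -e1 -e2.
Qed.

End TFlag.

(** * Schubert conditions for coordinate flags and for the pencil *)

Section TFlagSchubert.
Variables (K : fieldType) (n : nat).
Local Notation E := 'rV[K]_n.
Local Notation rk := (@rank_fun n).
Variables (e : 'I_n -> E) (G H : nat -> {vspace E}).
Hypothesis ad : adapted e G H.

Lemma coord_G (w : 'S_n) (f : 'I_n -> E) p q : is_basis f -> (p <= n)%N -> (q <= n)%N ->
  (forall i : 'I_n, (i < p)%N -> (q <= w i)%N -> f i \in G (n - q)%N) ->
  (p - rk w p q <= \dim (flag f p :&: G (n - q)%N))%N.
Proof.
move=> fb pn qn h; rewrite -rk_compl // -(dim_cs _ fb); apply: dimvS.
rewrite subv_cap csS /=; last by apply/fintype.subsetP => i; rewrite !inE => /andP[].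
by apply/cs_subP => i; rewrite inE => /andP[ip]; exact: h.
Qed.

Lemma coord_H (u : 'S_n) (f : 'I_n -> E) p q : is_basis f -> (p <= n)%N -> (q <= n)%N ->
  (forall i : 'I_n, (i < p)%N -> (u i < q)%N -> f i \in H q) ->
  (rk u p q <= \dim (flag f p :&: H q))%N.
Proof.
move=> fb pn qn h; rewrite /rank_fun -(dim_cs _ fb); apply: dimvS.
rewrite subv_cap csS /=; last by apply/fintype.subsetP => i; rewrite !inE => /andP[].
by apply/cs_subP => i; rewrite inE => /andP[ip]; exact: h.
Qed.

Lemma e_memG q (c : 'I_n) : (q <= n)%N -> (q <= c)%N -> e c \in G (n - q)%N.
Proof.
case: ad => eb hH hG qn qc; rewrite hG ?leq_subr // cs_mem // inE; lia.
Qed.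

Lemma e_memH q (c : 'I_n) : (q <= n)%N -> (c < q)%N -> e c \in H q.
Proof. by case: ad => eb hH hG qn qc; rewrite hH // cs_mem // inE. Qed.

Let eb : is_basis e. Proof. by case: ad. Qed.

Lemma coord_flag_G (w : 'S_n) p q : (p <= n)%N -> (q <= n)%N ->
  (p - rk w p q <= \dim (flag (e \o w) p :&: G (n - q)%N))%N.
Proof.
move=> pn qn; apply: coord_G => //; first exact: basis_comp.
by move=> i ip qi; exact: e_memG.
Qed.

Lemma coord_flag_H (u : 'S_n) p q : (p <= n)%N -> (q <= n)%N ->
  (rk u p q <= \dim (flag (e \o u) p :&: H q))%N.
Proof.
move=> pn qn; apply: coord_H => //; first exact: basis_comp.
by move=> i ip qi; exact: e_memH.
Qed.

Variables (w : 'S_n) (k l : 'I_n).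
Hypotheses (kl : (k < l)%N) (wkl : (w k < w l)%N).

Lemma tflag_G v p q : v != 0 -> (p <= n)%N -> (q <= n)%N ->
  (p - rk w p q <= \dim (tflag (e \o w) k l <[v]>%VS p :&: G (n - q)%N))%N.
Proof.
move=> v0 pn qn; case kpl : (k < p <= l)%N; last by rewrite /tflag kpl coord_flag_G.
rewrite tflag_in //; apply: coord_G => //.
  by apply: tbasisP => //; exact: basis_comp.
move=> i ip qi; rewrite /tbasis; case: eqVneq => [ik|_].
  by rewrite tphiE rpredD // rpredZ // e_memG //; move: qi; rewrite ik; lia.
by rewrite ifN ?e_memG // -val_eqE /=; lia.
Qed.

Lemma tflag_H v p q : v != 0 -> (p <= n)%N -> (q <= n)%N ->
  (rk (permo w (tperm k l)) p q <= \dim (tflag (e \o w) k l <[v]>%VS p :&: H q))%N.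
Proof.
move=> v0 pn qn; case kpl : (k < p <= l)%N; last first.
  rewrite /tflag kpl -(@flag_tperm _ _ (e \o w) k l) ?kpl; last lia.
  rewrite -flag_compA coord_flag_H //.
rewrite tflag_in //; apply: coord_H => //.
  by apply: tbasisP => //; exact: basis_comp.
move=> i ip; rewrite permoE /tbasis; case: eqVneq => [->|ik].
  by rewrite tpermL => qi; rewrite tphiE rpredD // rpredZ // e_memH //; lia.
have il : i != l by rewrite -val_eqE /=; lia.
have -> : tperm k l i = i by rewrite tpermD // eq_sym.
by rewrite (negPf il) => qi; exact: e_memH.
Qed.

End TFlagSchubert.

(** * Minors and generic points *)

Section Minors.
Variables (K : fieldType) (n : nat).
Local Notation E := 'rV[K]_n.
Implicit Types (u : E) (V A : {vspace E}).

Definition bmx (V : {vspace E}) : 'M[K]_(\dim V, n) := \matrix_a (vbasis V)`_a.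

Lemma mem_bmx V u : (u \in V) = (u <= bmx V)%MS.
Proof.
apply/idP/submxP => [/coord_vbasis ->|[x ->]].
  exists (\row_a coord (vbasis V) a u); rewrite mulmx_sum_row; apply: eq_bigr => a _.
  by rewrite mxE rowK.
rewrite mulmx_sum_row; apply: memv_suml => a _; rewrite rowK memvZ // vbasis_mem //.
by rewrite mem_nth // size_tuple.
Qed.

Lemma bmx_free V : row_free (bmx V).
Proof.
apply/row_freeP; exists (\matrix_(c, a) coord (vbasis V) a (delta_mx 0 c)).
apply/matrixP => a b; rewrite !mxE.
have -> : (a == b)%:R = coord (vbasis V) b (vbasis V)`_a.
  by rewrite coord_free ?(basis_free (vbasisP V)).
rewrite [X in coord _ b X]row_sum_delta linear_sum; apply: eq_bigr => c _.
by rewrite linearZ /= !mxE.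
Qed.

Lemma rank_bmx V : \rank (bmx V) = \dim V.
Proof. exact/eqP/bmx_free. Qed.

Lemma equations_of (i : nat) (A : {vspace E}) : (i <= n)%N -> \dim A = (n - i)%N ->
  exists Y : 'M[K]_(n, i), forall u : E, (u \in A) = (u *m Y == 0).
Proof.
move=> le_in dA.
have: \rank (cokermx (bmx A)) = i by rewrite mxrank_coker rank_bmx dA subKn.
clear le_in dA; case: i /.
exists (col_base (cokermx (bmx A))) => u; rewrite mem_bmx submxE.
rewrite -{1}(mulmx_base (cokermx (bmx A))) mulmxA; apply/eqP/eqP => [h|->]; last by rewrite mul0mx.
by apply: (row_free_inj (row_base_free (cokermx (bmx A)))); rewrite mul0mx.
Qed.

Lemma det_equations (V A : {vspace E}) (Y : 'M[K]_(n, \dim V)) :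
  (forall u : E, (u \in A) = (u *m Y == 0)) ->
  (\det (bmx V *m Y) == 0) = ((V :&: A)%VS != 0%VS).
Proof.
move=> hA; apply/det0P/idP => [[x x0]|].
  rewrite mulmxA => /eqP; rewrite -hA => xA; rewrite -vpick0.
  have xV : x *m bmx V \in V by rewrite mem_bmx submxMl.
  apply: contraNneq x0 => /eqP; rewrite vpick0 => /eqP VA0.
  have : x *m bmx V \in (V :&: A)%VS by rewrite memv_cap xV xA.
  rewrite VA0 memv0 => /eqP h; apply/eqP.
  by apply: (row_free_inj (bmx_free V)); rewrite h mul0mx.
rewrite -vpick0; set u := vpick _ => u0.
have := memv_pick (V :&: A)%VS; rewrite -/u memv_cap mem_bmx => /andP[/submxP[x ux]].
rewrite hA => /eqP uY; exists x; last by rewrite mulmxA -ux.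
by apply: contraNneq u0 => x0; rewrite ux x0 mul0mx.
Qed.

Lemma rank_equations (V A : {vspace E}) (Y : 'M[K]_(n, \dim V)) :
  (forall u : E, (u \in A) = (u *m Y == 0)) ->
  (\rank (bmx V *m Y) + \dim (V :&: A) <= \dim V)%N.
Proof.
move=> hA; have /submxP[T hT] : (bmx (V :&: A) <= bmx V)%MS.
  apply/row_subP => a; rewrite -mem_bmx rowK.
  by apply: (subvP (capvSl V A)); rewrite vbasis_mem // mem_nth // size_tuple.
have : (T *m (bmx V *m Y) = 0).
  rewrite mulmxA -hT; apply/row_matrixP => a; rewrite row_mul row0.
  apply/eqP; rewrite -hA rowK.
  by apply: (subvP (capvSr V A)); rewrite vbasis_mem // mem_nth // size_tuple.
move/mulmx0_rank_max; apply: leq_trans; rewrite addnC leq_add2r.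
by have := mxrankM_maxl T (bmx V); rewrite -hT rank_bmx.
Qed.

Section CauchyBinet.
Variable i : nat.

Lemma sorted_enum (A : {set 'I_n}) : sorted (fun x y : 'I_n => (x < y)%N) (enum A).
Proof.
rewrite /enum_mem; apply: sorted_filter; first by move=> x y z; exact: ltn_trans.
by have := iota_ltn_sorted 0 n; rewrite -val_enum_ord sorted_map enumT.
Qed.

Lemma pindex_of (A : {set 'I_n}) : #|A| = i -> exists g : pindex n i, forall x,
  x \in A -> exists b, val g b = x.
Proof.
move=> cA; have sz : size (enum A) = i by rewrite -cardE.
pose g := [ffun b : 'I_i => tnth (in_tuple (enum A)) (cast_ord (esym sz) b)].
have gP : [forall a : 'I_i, forall b : 'I_i, (a < b)%N ==> (g a < g b)%N].
  apply/forallP => a; apply/forallP => b; apply/implyP => ab; rewrite !ffunE.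
  have x0 := g a; rewrite !(tnth_nth x0) /=.
  by apply: (sorted_ltn_nth _ _ (sorted_enum A));
    rewrite ?inE ?sz ?ltn_ord //; move=> x y z; exact: ltn_trans.
exists (exist _ g gP) => x xA.
have xi : (index x (enum A) < i)%N by rewrite -sz index_mem mem_enum.
by exists (Ordinal xi); rewrite /= ffunE (tnth_nth x) /= nth_index // mem_enum.
Qed.

Lemma minor_reindex (phi : 'I_i -> 'I_n) : exists kap : pindex n i -> K,
  forall B : 'M[K]_(i, n), \det (colsub phi B) = \sum_g kap g * \det (colsub (val g) B).
Proof.
case: (boolP (injectiveb phi)) => [/injectiveP inj|/injectivePn[a [b ab pab]]]; last first.
  exists (fun=> 0) => B; rewrite big1 => [|g _]; last by rewrite mul0r.
  rewrite -det_tr; apply: (determinant_alternate ab) => c; by rewrite !mxE pab.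
have [g gP] : exists g : pindex n i, forall a, exists b, val g b = phi a.
  have [|g gP] := @pindex_of (phi @: [set: 'I_i]); first by rewrite card_imset // cardsT card_ord.
  by exists g => a; apply: gP; apply: imset_f; rewrite inE.
have /(_ _)/sigW sig : forall a, exists b, val g b == phi a.
  by move=> a; have [b <-] := gP a; exists b.
pose s a := sval (sig a).
have sE a : val g (s a) = phi a by apply/eqP; exact: (svalP (sig a)).
have sinj : injective s by move=> a b sab; apply: inj; rewrite -!sE sab.
exists (fun g' => (g' == g)%:R * (-1) ^+ (perm sinj)) => B.
rewrite (bigD1 g) //= [X in _ + X]big1 ?addr0 => [|g' /negPf ->]; last by rewrite !mul0r.
have -> : colsub phi B = col_perm (perm sinj) (colsub (val g) B).
  by apply/matrixP => a b; rewrite !mxE permE sE.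
by rewrite col_permE det_mulmx det_perm odd_permV eqxx mul1r mulrC.
Qed.

Hypothesis char0 : forall m : nat, (m.+1)%:R != 0 :> K.

(** A form of Cauchy-Binet; what matters is that the coefficients do not depend on [B]. The
    expansion over all index maps is averaged over the symmetric group, then reduced to increasing
    indices; dividing by i! is where characteristic zero enters. *)
Lemma det_mul_minors (Y : 'M[K]_(n, i)) : exists h : pindex n i -> K,
  forall B : 'M[K]_(i, n), \det (B *m Y) = \sum_g h g * \det (colsub (val g) B).
Proof.
have /(_ _)/cid kap := minor_reindex.
pose D (phi : {ffun 'I_i -> 'I_n}) := \det (rowsub phi Y).
have expand (B : 'M[K]_(i, n)) : \det (B *m Y) =
    \sum_(phi : {ffun 'I_i -> 'I_n}) (\prod_a B a (phi a)) * D phi.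
  rewrite /D /determinant.
  transitivity (\sum_(s : 'S_i) \sum_(phi : {ffun 'I_i -> 'I_n})
      (-1) ^+ s * \prod_a (B a (phi a) * Y (phi a) (s a))).
    apply: eq_bigr => s _; rewrite -big_distrr /=; congr (_ * _).
    by rewrite -(bigA_distr_bigA (fun a c => B a c * Y c (s a))) /=;
       apply: eq_bigr => a _; rewrite mxE.
  rewrite exchange_big /=; apply: eq_bigr => phi _; rewrite big_distrr /=.
  apply: eq_bigr => s _; rewrite big_split /= mulrCA; congr (_ * (_ * _)).
  by apply: eq_bigr => a _; rewrite mxE.
have fact0 : (i`!)%:R != 0 :> K by rewrite -(prednK (fact_gt0 i)) char0.
have symm (B : 'M[K]_(i, n)) : \det (B *m Y) = (i`!)%:R^-1 *
    \sum_(phi : {ffun 'I_i -> 'I_n}) D phi * \det (colsub phi B).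
  apply: (mulfI fact0); rewrite mulrA mulfV // mul1r.
  transitivity (\sum_(s : 'S_i) \sum_(phi : {ffun 'I_i -> 'I_n})
      D phi * ((-1) ^+ s * \prod_a B a (phi (s a)))); last first.
    rewrite exchange_big /=; apply: eq_bigr => phi _; rewrite /determinant big_distrr /=.
    apply: eq_bigr => s _; congr (_ * (_ * _)); apply: eq_bigr => a _; by rewrite mxE.
  rewrite -card_Sn -sum1_card natr_sum big_distrl /=.
  apply: eq_big => [s|s _]; first by rewrite inE.
  rewrite mul1r expand.
  pose h (phi : {ffun 'I_i -> 'I_n}) := [ffun a => phi (s a)] : {ffun 'I_i -> 'I_n}.
  have hinj : injective h.
    move=> f f' /ffunP ff'; apply/ffunP => a; have := ff' ((s^-1)%g a).
    by rewrite !ffunE permKV.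
  rewrite (reindex_inj hinj) /=; apply: eq_bigr => phi _; rewrite mulrC.
  have -> : D (h phi) = (-1) ^+ s * D phi.
    have -> : D (h phi) = \det (row_perm s (rowsub phi Y)).
      by congr (\det _); apply/matrixP => a b; rewrite !mxE ffunE.
    by rewrite row_permE det_mulmx det_perm.
  rewrite [RHS]mulrA [D phi * _]mulrC; congr (_ * _).
  by apply: eq_bigr => a _; rewrite ffunE.
exists (fun g => \sum_(phi : {ffun 'I_i -> 'I_n}) (i`!)%:R^-1 * D phi * sval (kap phi) g) => B.
rewrite symm; under [RHS]eq_bigr do rewrite big_distrl /=.
rewrite exchange_big /= big_distrr /=; apply: eq_bigr => phi _.
rewrite (svalP (kap phi)) mulrA big_distrr /=; apply: eq_bigr => g _; by rewrite mulrA.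
Qed.

End CauchyBinet.

(** A constant row reduction at [t] makes the last i - r rows vanish at [t], and each of them
    contributes a factor X - t. *)
Lemma det_vanishing (i : nat) (Z : 'M[{poly K}]_i) (t : K) :
  ('X - t%:P) ^+ (i - \rank (map_mx (horner_eval t) Z)) %| \det Z.
Proof.
set Z0 := map_mx _ Z; set r := \rank Z0.
pose L : 'M[K]_i := invmx (col_ebase Z0).
have uL : L \in unitmx by rewrite unitmx_inv col_ebase_unit.
have [Z1 Z1def] : exists Z1, Z1 = map_mx polyC L *m Z by exists (map_mx polyC L *m Z).
have Z1t : map_mx (horner_eval t) Z1 = pid_mx r *m row_ebase Z0.
  rewrite Z1def map_mxM -map_mx_comp (_ : map_mx _ L = L); last first.
    by apply/matrixP => a b; rewrite !mxE /= /horner_eval hornerC.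
  by rewrite -/Z0 -{1}(mulmx_ebase Z0) !mulmxA mulVmx ?col_ebase_unit // mul1mx.
have rt (a b : 'I_i) : (r <= a)%N -> ('X - t%:P) %| Z1 a b.
  move=> ra; rewrite dvdp_XsubCl; apply/eqP.
  have /matrixP/(_ a b) := Z1t; rewrite [LHS]mxE /horner_eval => ->.
  by rewrite mxE big1 // => c _; rewrite mxE (ltnNge a) ra andbF mul0r.
pose Z2 : 'M[{poly K}]_i := \matrix_(a, b) (if (a < r)%N then Z1 a b else Z1 a b %/ ('X - t%:P)).
have Z1E : Z1 = diag_mx (\row_a (if (a < r)%N then 1 else 'X - t%:P)) *m Z2.
  apply/matrixP => a b; rewrite mul_diag_mx !mxE; case: ltnP => ra; first by rewrite mul1r.
  by rewrite mulrC divpK // rt.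
have dL : \det L != 0 by rewrite -unitfE -unitmxE.
rewrite -(@dvdpZr _ (\det L)) // -mul_polyC -det_map_mx -det_mulmx -Z1def Z1E det_mulmx.
apply: dvdp_mulr; rewrite det_diag.
have ri : (r <= i)%N by exact: rank_leq_row.
rewrite (eq_bigr (fun a : 'I_i => if (r <= a)%N then 'X - t%:P else 1)); last first.
  by move=> a _; rewrite mxE; case: ltnP.
rewrite -big_mkcond /= prodr_const.
suff -> : #|[pred a : 'I_i | (r <= a)%N]| = (i - r)%N by [].
rewrite -sum1_card -(big_mkord (fun k => (r <= k)%N) (fun=> 1%N)) -[RHS]muln1 -sum_nat_const_nat.
by rewrite (big_nat_widenl r 0) //; apply: eq_bigl => k; rewrite andbT.
Qed.
End Minors.

Section GenericPoints.
Variable K : numClosedFieldType.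
Implicit Types (p q : {poly K}) (s t : K).

Lemma poly_nonroot p : p != 0 -> exists s, p.[s] != 0.
Proof.
move=> p0; pose rs := [seq (k%:R : K) | k <- iota 0 (size p)].
have : ~~ all (root p) rs.
  apply/negP => h; have := max_poly_roots p0 h; rewrite size_map size_iota ltnn => /(_ _)/notF.
  by apply; rewrite map_inj_uniq ?iota_uniq // => x y /eqP; rewrite eqr_nat => /eqP.
by case/allPn => s _ h; exists s; rewrite -rootE.
Qed.

Lemma poly_eqP_eval p q : (forall t, p.[t] = q.[t]) -> p = q.
Proof.
move=> h; apply/eqP; rewrite -subr_eq0; apply: contraT => /poly_nonroot[s].
by rewrite hornerD hornerN h subrr eqxx.
Qed.

Lemma poly_roots p : p != 0 -> exists rs : seq K, forall t, (t \in rs) = (p.[t] == 0).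
Proof.
move=> p0; have [rs hrs] := closed_field_poly_normal p; exists rs => t.
rewrite hrs hornerZ mulf_eq0 lead_coef_eq0 (negPf p0) /=.
by rewrite -rootE root_prod_XsubC.
Qed.

Lemma base_inj k N (a b : nat -> nat) :
  (forall i, (i < k)%N -> (a i < N)%N) -> (forall i, (i < k)%N -> (b i < N)%N) ->
  (\sum_(i < k) a i * N ^ i = \sum_(i < k) b i * N ^ i)%N ->
  forall i, (i < k)%N -> a i = b i.
Proof.
elim: k a b => [//|k IH] a b ha hb.
have rec (c : nat -> nat) : (\sum_(i < k.+1) c i * N ^ i = (\sum_(i < k) c i.+1 * N ^ i) * N + c 0)%N.
  rewrite big_ord_recl /= expn0 muln1 addnC big_distrl /=; congr (_ + _)%N.
  by apply: eq_bigr => i _; rewrite /bump /= add1n expnSr mulnA.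
rewrite !rec => h.
have a0 : a 0%N = b 0%N.
  have := congr1 (modn^~ N) h; rewrite /= !modnMDl !modn_small //; [exact: hb|exact: ha].
case=> [//|i] ik.
apply: (IH (fun i => a i.+1) (fun i => b i.+1)) => // [j jk|j jk|]; [exact: ha|exact: hb|].
move/eqP: h; rewrite a0 eqn_add2r eqn_pmul2r => [/eqP //|].
exact: leq_ltn_trans (ha 0%N isT).
Qed.

(** Kronecker substitution x_i = s^(N^i): with N above all exponents, distinct monomials become
    distinct powers of s. *)
Lemma mpoly_nonzero m (Q : {mpoly K[m]}) : Q != 0 -> exists x : 'I_m -> K, Q.@[x] != 0.
Proof.
move=> Q0; pose N := (\max_(mm <- msupp Q) \max_(i < m) mm i).+1.
have NP mm i : mm \in msupp Q -> (mm i < N)%N.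
  move=> mmQ; rewrite ltnS; apply: leq_trans (leq_bigmax_seq _ mmQ isT).
  exact: (leq_bigmax i).
pose ex (mm : 'X_{1..m}) := (\sum_(i < m) mm i * N ^ i)%N.
have exinj mm mm' : mm \in msupp Q -> mm' \in msupp Q -> ex mm = ex mm' -> mm = mm'.
  move=> h h' e; apply/mnmP => i.
  pose a (mm : 'X_{1..m}) j := if insub j is Some j' then mm (j' : 'I_m) else 0%N.
  have aE mm1 (j : 'I_m) : a mm1 j = mm1 j by rewrite /a valK.
  have aN mm1 j : mm1 \in msupp Q -> (j < m)%N -> (a mm1 j < N)%N.
    by move=> hm jm; rewrite (aE mm1 (Ordinal jm)) NP.
  rewrite -!aE; apply: (@base_inj m N (a mm) (a mm')) => // [j|j|]; [exact: aN|exact: aN|].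
  have toex mm1 : (\sum_(i0 < m) a mm1 i0 * N ^ i0)%N = ex mm1 by apply: eq_bigr => j _; rewrite aE.
  by rewrite !toex.
pose P := \sum_(mm <- msupp Q) Q@_mm *: 'X^(ex mm) : {poly K}.
have P0 : P != 0.
  have [mm0 h0] : exists mm, mm \in msupp Q.
    by exists (mlead Q); apply: mlead_supp.
  apply/eqP => /polyP/(_ (ex mm0)); rewrite coef0 /P coef_sum (bigD1_seq mm0) //=.
  rewrite coefZ coefXn eqxx mulr1 big1_seq ?addr0 => [/eqP|mm /andP[ne hm]].
    by rewrite mcoeff_eq0 h0.
  rewrite coefZ coefXn; case: eqP => [e|_]; last by rewrite mulr0.
  by case/eqP: ne; apply: exinj.
have [s hs] := poly_nonroot P0; exists (fun i => s ^+ (N ^ i)).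
apply: contraNneq hs => h; rewrite -h mevalE /P horner_sum; apply/eqP.
apply: eq_bigr => mm _; rewrite hornerZ hornerXn /ex; congr (_ * _).
rewrite -prodrXr; apply: eq_bigr => i _; by rewrite mulnC exprM.
Qed.

(** On the moment curve (s^0, s^1, ...) each hyperplane becomes a nonzero polynomial in s, and so
    does their product. *)
Lemma avoid_hyperplanes (I : finType) (xs : seq {ffun I -> K}) :
  (forall x, x \in xs -> exists g, x g != 0) ->
  exists h : I -> K, forall x, x \in xs -> \sum_g h g * x g != 0.
Proof.
move=> hx; pose P (x : {ffun I -> K}) := \sum_g x g *: 'X^(enum_rank g) : {poly K}.
have P0 x : x \in xs -> P x != 0.
  move=> /hx[g xg]; apply/eqP => /polyP/(_ (enum_rank g)); rewrite coef0 /P coef_sum.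
  rewrite (bigD1 g) //= coefZ coefXn eqxx mulr1 big1 ?addr0 => [/eqP|g' ne].
    by rewrite (negPf xg).
  rewrite coefZ coefXn; case: eqP => [/val_inj/enum_rank_inj e|_]; last by rewrite mulr0.
  by rewrite e eqxx in ne.
have /poly_nonroot[s] : \prod_(x <- xs) P x != 0.
  by rewrite prodf_seq_neq0; apply/allP => x /P0.
rewrite horner_prod prodf_seq_neq0 => /allP h; exists (fun g => s ^+ enum_rank g) => x xxs.
have := h x xxs; rewrite /= /P horner_sum; apply: contraNneq => e; rewrite -[X in _ == X]e; apply/eqP.
by apply: eq_bigr => g _; rewrite hornerZ hornerXn mulrC.
Qed.

Definition lin (a b : K) : {poly K} := a%:P + b *: 'X.

Lemma linE a b s : (lin a b).[s] = a + s * b.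
Proof. by rewrite hornerD hornerC hornerZ hornerX mulrC. Qed.

Lemma mpoly_on_line m (Q : {mpoly K[m]}) (x y : 'I_m -> K) :
  exists L : {poly K}, forall s, L.[s] = Q.@[fun k => x k + s * y k].
Proof.
exists (\sum_(mm <- msupp Q) Q@_mm *: \prod_i (lin (x i) (y i)) ^+ mm i) => s.
rewrite mevalE horner_sum; apply: eq_bigr => mm _; rewrite hornerZ horner_prod.
by congr (_ * _); apply: eq_bigr => i _; rewrite horner_exp linE.
Qed.

Definition comb (I : finType) (q : I -> {poly K}) (h : I -> K) : {poly K} := \sum_g h g *: q g.

Lemma horner_comb (I : finType) (q : I -> {poly K}) h t :
  (comb q h).[t] = \sum_g h g * (q g).[t].
Proof. by rewrite horner_sum; apply: eq_bigr => g _; rewrite hornerZ. Qed.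

Lemma coef_comb (I : finType) (q : I -> {poly K}) h j :
  (comb q h)`_j = \sum_g h g * (q g)`_j.
Proof. by rewrite coef_sum; apply: eq_bigr => g _; rewrite coefZ. Qed.

Lemma size_comb (I : finType) (q : I -> {poly K}) h D :
  (forall g, (size (q g) <= D)%N) -> (size (comb q h) <= D)%N.
Proof.
move=> hq; apply: leq_trans (size_sum _ _ _) _; apply/bigmax_leqP => g _.
exact: leq_trans (size_scale_leq _ _) (hq g).
Qed.

(* A general member of the pencil spanned by two coprime polynomials has simple
   roots, since its double roots are zeros of their Wronskian. *)
Lemma generic_section (I : finType) (Q : {mpoly K[#|I|]}) (q : I -> {poly K}) D (T : seq K) :
  Q != 0 -> (forall t, exists g, (q g).[t] != 0) ->
  (forall g, (size (q g) <= D.+1)%N) -> (exists g, (q g)`_D != 0) -> (0 < D)%N ->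
  exists h : I -> K, Q.@[fun k => h (enum_val k)] != 0 /\
    exists zs, [/\ uniq zs, size zs = D, forall z, z \in zs -> (comb q h).[z] = 0 &
      forall z, z \in zs -> z \notin T].
Proof.
move=> Q0 hq sq [gD hgD] D0.
(* The coefficient of degree [D] as a linear form in the hyperplane; where it is nonzero the section
   has exact degree [D]. *)
pose Lf : {mpoly K[#|I|]} := \sum_g (q g)`_D *: 'X_(enum_rank g).
have LfE x : Lf.@[x] = \sum_g (q g)`_D * x (enum_rank g).
  by rewrite /Lf raddf_sum /=; apply: eq_bigr => g _; rewrite mevalZ mevalXU.
have Lf0 : Lf != 0.
  apply/eqP => h; have := LfE (fun k => (k == enum_rank gD)%:R); rewrite h meval0.
  rewrite (bigD1 gD) //= eqxx mulr1 big1 ?addr0 => [/esym/eqP|g ne]; first by rewrite (negPf hgD).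
  by rewrite (inj_eq enum_rank_inj) (negPf ne) mulr0.
have [x] := mpoly_nonzero (mulf_neq0 Q0 Lf0); rewrite mevalM mulf_eq0 negb_or => /andP[Qx Lx].
pose h0 g := x (enum_rank g); pose phi := comb q h0.
have phiD : phi`_D != 0.
  by rewrite coef_comb; move: Lx; rewrite LfE; under eq_bigr do rewrite mulrC.
have phi0 : phi != 0 by apply: contraNneq phiD => ->; rewrite coef0.
have sphi : size phi = D.+1.
  apply/eqP; rewrite eqn_leq size_comb //= ltnNge; apply: contra phiD => /leq_sizeP -> //.
have [rs hrs] := poly_roots phi0.
have [h1 hh1] : exists h1 : I -> K, forall t, t \in rs ++ T -> (comb q h1).[t] != 0.
  have [|h hh] := @avoid_hyperplanes I [seq [ffun g => (q g).[t]] | t <- rs ++ T].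
    move=> y /mapP[t _ ->]; have [g hg] := hq t; by exists g; rewrite ffunE.
  exists h => t ht; rewrite horner_comb; have := hh _ (map_f _ ht).
  by under eq_bigr do rewrite ffunE.
pose psi := comb q h1.
have nocommon t : phi.[t] = 0 -> psi.[t] != 0.
  by move=> pt; apply: hh1; rewrite mem_cat hrs pt eqxx.
have cop : coprimep phi psi.
  by apply/Pdiv.ClosedField.coprimepP => t; rewrite rootE => /eqP/nocommon.
pose w := phi^`() * psi - phi * psi^`().
have w0 : w != 0.
  rewrite /w subr_eq0; apply/eqP => e.
  have : phi %| phi^`() * psi by rewrite e dvdp_mulr.
  rewrite Gauss_dvdpl // => /dvdp_leq h.
  have d0 : phi^`() != 0.
    apply/eqP => /polyP/(_ D.-1); rewrite coef_deriv prednK // coef0 => /eqP.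
    by rewrite mulrn_eq0 (negPf phiD) orbF; case: (D) D0.
  by have := h d0; rewrite leqNgt lt_size_deriv.
have [ws hws] := poly_roots w0.
have lin0 a b : (a != 0) || (b != 0) -> lin a b != 0.
  apply: contraTneq => e; rewrite negb_or !negbK.
  have := linE a b 0; rewrite e horner0 mul0r addr0 => <-; rewrite eqxx /=.
  by have := linE a b 1; have := linE a b 0; rewrite e !horner0 mul0r mul1r addr0 => <-; rewrite add0r => <-.
have [LQ LQE'] := mpoly_on_line Q x (fun k => h1 (enum_val k)).
have LQE s : LQ.[s] = Q.@[fun k => h0 (enum_val k) + s * h1 (enum_val k)].
  by rewrite LQE'; apply: meval_eq => k; rewrite /h0 enum_valK.
have LQ0 : LQ != 0.
  apply/eqP => e; have := LQE 0; rewrite e horner0 => /esym/eqP; apply/negP.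
  apply: contraNneq Qx => <-; apply/eqP/meval_eq => k; by rewrite mul0r addr0 /h0 enum_valK.
(* The values of [s] to avoid: those where [Q] vanishes, the degree drops, or the section vanishes
   at a zero of the Wronskian or at a point of [T]. *)
pose bad := LQ * lin phi`_D psi`_D * \prod_(t <- ws ++ T) lin phi.[t] psi.[t].
have bad0 : bad != 0.
  rewrite /bad !mulf_neq0 // ?lin0 ?phiD // prodf_seq_neq0; apply/allP => t _ /=.
  by rewrite lin0 //; case: eqP => //= /nocommon ->.
have [s] := poly_nonroot bad0; rewrite !hornerM !mulf_eq0 !negb_or => /andP[/andP[s1 s2] s3].
pose h g := h0 g + s * h1 g.
have hE : comb q h = phi + s *: psi.
  rewrite /comb /phi /psi /comb scaler_sumr -big_split /=; apply: eq_bigr => g _.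
  by rewrite scalerDl scalerA.
exists h; split; first by rewrite -LQE.
have chit t : t \in ws ++ T -> (comb q h).[t] != 0.
  move: s3; rewrite horner_prod prodf_seq_neq0 => /allP hh /hh /=.
  by rewrite linE hE hornerD hornerZ.
have chiD : (comb q h)`_D != 0 by move: s2; rewrite linE hE coefD coefZ.
have chi0 : comb q h != 0 by apply: contraNneq chiD => ->; rewrite coef0.
have schi : size (comb q h) = D.+1.
  apply/eqP; rewrite eqn_leq size_comb //= ltnNge; apply: contra chiD => /leq_sizeP -> //.
have sep : separable_poly (comb q h).
  rewrite unlock; apply/Pdiv.ClosedField.coprimepP => t; rewrite rootE => ct.
  apply: contraTneq ct => dt; apply: contraTneq isT => ct.
  have tw : w.[t] = 0.
    have {}ct : phi.[t] + s * psi.[t] = 0 by rewrite -ct hE hornerD hornerZ.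
    have {}dt : phi^`().[t] + s * psi^`().[t] = 0.
      by rewrite -dt hE derivD derivZ hornerD hornerZ.
    rewrite /w hornerD hornerN !hornerM.
    have -> : phi.[t] = - (s * psi.[t]) by apply/eqP; rewrite -addr_eq0 ct.
    have -> : phi^`().[t] = - (s * psi^`().[t]) by apply/eqP; rewrite -addr_eq0 dt.
    by ring.
  by have := chit t; rewrite mem_cat hws tw eqxx ct eqxx => /(_ isT).
have [zs hzs] := closed_field_poly_normal (comb q h).
have lc0 : lead_coef (comb q h) != 0 by rewrite lead_coef_eq0.
exists zs; split.
- rewrite -separable_prod_XsubC -(eqp_separable (eqp_scale _ lc0)) -hzs //.
- by move: schi; rewrite hzs size_scale // size_prod_XsubC => -[].
- by move=> z hz; apply/eqP; rewrite -rootE hzs rootZ // root_prod_XsubC.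
move=> z hz; apply/negP => zT; have := chit z; rewrite mem_cat zT orbT => /(_ isT).
by rewrite -rootE hzs rootZ // root_prod_XsubC hz.
Qed.

End GenericPoints.

(** * The kernel and the span of a curve of given degree *)

Section Kernel.
Variables (K : numClosedFieldType) (n i : nat).
Local Notation E := 'rV[K]_n.
Hypothesis le_in : (i <= n)%N.

Definition brow (V : {vspace E}) : 'M[K]_(i, n) := \matrix_a (vbasis V)`_a.
Definition plu (V : {vspace E}) (g : pindex n i) : K := \det (colsub (val g) (brow V)).

Let ch0 (m : nat) : (m.+1)%:R != 0 :> K. Proof. by rewrite pnatr_eq0. Qed.

Lemma brow_mul (V : {vspace E}) (Y : 'M[K]_(n, i)) : \dim V = i ->
  exists h : pindex n i -> K, \det (brow V *m Y) = \sum_g h g * plu V g.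
Proof. by have [h hh] := det_mul_minors ch0 Y; exists h; rewrite hh. Qed.

Lemma det_brow (V A : {vspace E}) (Y : 'M[K]_(n, i)) : \dim V = i ->
  (forall u : E, (u \in A) = (u *m Y == 0)) ->
  (\det (brow V *m Y) == 0) = ((V :&: A)%VS != 0%VS).
Proof.
by rewrite /brow => dV; move: Y; case: i / dV => Y hA; exact: det_equations.
Qed.

Lemma mem_brow (V : {vspace E}) (u : E) : \dim V = i -> (u \in V) = (u <= brow V)%MS.
Proof. by rewrite /brow => dV; case: i / dV; exact: mem_bmx. Qed.

Lemma brow_free (V : {vspace E}) : \dim V = i -> \rank (brow V) = i.
Proof. by rewrite /brow => dV; case: i / dV; exact: rank_bmx. Qed.

Lemma rank_brow (V A : {vspace E}) (Y : 'M[K]_(n, i)) : \dim V = i ->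
  (forall u : E, (u \in A) = (u *m Y == 0)) ->
  (\rank (brow V *m Y) + \dim (V :&: A) <= i)%N.
Proof.
by rewrite /brow => dV; move: Y; case: i / dV => Y hA; exact: rank_equations.
Qed.

(** [Y] defines a hyperplane section that misses [V], while the part of [W] outside [V] lies in [A].
    This separates subspaces in [plu_inj] and bounds intersections in [kernel_bound]. *)
Lemma complement (V W : {vspace E}) : \dim V = i -> \dim W = i ->
  exists (A : {vspace E}) (Y : 'M[K]_(n, i)), [/\ (forall u : E, (u \in A) = (u *m Y == 0)),
    (V :&: A = 0)%VS & (W :\: V <= A)%VS].
Proof.
move=> dV dW; pose A := ((W :\: V) + (V + W)^C)%VS.
have dA : \dim A = (n - i)%N.
  have := dimv_sum_cap (V + W)%VS ((V + W)^C)%VS; rewrite capv_compl addv_complf dimv0 dim_E.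
  have := dimv_sum_cap (W :\: V)%VS ((V + W)^C)%VS.
  have -> : ((W :\: V) :&: (V + W)^C = 0)%VS.
    apply/eqP; rewrite -subv0 -(capv_compl (V + W)%VS) capvS ?subvv //.
    exact: subv_trans (diffvSl _ _) (addvSr _ _).
  rewrite dimv0 -/A; have := dimv_cap_compl W V; have := dimv_sum_cap V W.
  rewrite dV dW (capvC V W); dlia.
have [Y hY] := equations_of le_in dA; exists A, Y; split=> //; last exact: addvSl.
have := dimv_sum_cap V A; rewrite /A addvA (addvC V) addv_diff (addvC W) addv_complf dim_E -/A dA dV.
move=> h; apply/eqP; rewrite -dimv_eq0; dlia.
Qed.

Lemma plu_neq0 (V : {vspace E}) : \dim V = i -> exists g, plu V g != 0.
Proof.
move=> dV; have [A [Y [hY VA _]]] := complement dV dV.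
have [h hh] := brow_mul Y dV; have := det_brow dV hY; rewrite VA eqxx /= hh => h0.
apply/existsP; apply: contraFT h0 => /existsPn hn; rewrite big1 // => g _.
by have := hn g; rewrite negbK => /eqP ->; rewrite mulr0.
Qed.

Lemma plu_inj (V W : {vspace E}) c : \dim V = i -> \dim W = i ->
  (forall g, plu W g = c * plu V g) -> V = W.
Proof.
move=> dV dW hc; have [A [Y [hY VA WA]]] := complement dV dW.
have [h hh] := det_mul_minors ch0 Y.
have hVW : \det (brow W *m Y) = c * \det (brow V *m Y).
  by rewrite !hh big_distrr /=; apply: eq_bigr => g _; rewrite -!/(plu _ _) hc mulrCA.
have c0 : c != 0.
  have [g] := plu_neq0 dW; rewrite hc; apply: contraNneq => ->; by rewrite mul0r.
have : \det (brow W *m Y) != 0.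
  by rewrite hVW mulf_neq0 // (det_brow dV hY) VA eqxx.
rewrite (det_brow dW hY) negbK => /eqP WA0.
have : (W :\: V <= W :&: A)%VS by rewrite subv_cap diffvSl WA.
rewrite WA0 subv0 diffv_eq0 => WV; apply/esym/eqP; by rewrite eqEdim WV dV dW leqnn.
Qed.

(** Cramer's rule. It turns the entries of an adjugate times a basis matrix into determinants, which
    are linear forms in Pluecker coordinates. *)
Lemma cramer_row (M : 'M[K]_i) (B : 'M[K]_(i, n)) a c :
  (\adj M *m B) a c = \det (\matrix_(x, y) if y == a then B x c else M x y).
Proof.
rewrite (expand_det_col _ a) mxE; apply: eq_bigr => x _; rewrite !mxE eqxx mulrC.
congr (_ * _); rewrite /cofactor; congr (_ * \det _); apply/matrixP => y z; rewrite !mxE.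
by rewrite eq_sym (negPf (neq_lift _ _)).
Qed.

(** [D] is the degree of the Pluecker polynomials, [d] bounds the number of distinct subspaces on a
    general hyperplane section. [D] may exceed [d], since [F] need not be injective. *)
Variables (F : K -> {vspace E}) (q : pindex n i -> {poly K}) (D d : nat).
Variable (Q : {mpoly K[#|pindex n i|]}).
Hypotheses (dF : forall t, \dim (F t) = i)
  (qF : forall t, exists2 c, c != 0 & forall g, (q g).[t] = c * plu (F t) g)
  (sq : forall g, (size (q g) <= D.+1)%N) (qD : exists g, (q g)`_D != 0)
  (Q0 : Q != 0)
  (degree : forall h : pindex n i -> K, Q.@[fun k => h (enum_val k)] != 0 ->
     forall zs : seq K, (forall z, z \in zs -> \sum_g h g * plu (F z) g = 0) ->
     (size (undup [seq F z | z <- zs]) <= d)%N).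

Lemma q_nonzero t : exists g, (q g).[t] != 0.
Proof.
by have [c c0 h] := qF t; have [g hg] := plu_neq0 (dF t); exists g; rewrite h mulf_neq0.
Qed.

Lemma comb_zero h t : ((comb q h).[t] == 0) = (\sum_g h g * plu (F t) g == 0).
Proof.
have [c c0 hc] := qF t; rewrite horner_comb.
under eq_bigr do rewrite hc mulrCA; by rewrite -big_distrr /= mulf_eq0 (negPf c0).
Qed.

(* A general hyperplane section has D simple roots and at most d distinct points, so
   one of the points has at least D / d preimages. *)
Lemma fiber (T : seq K) : (0 < D)%N -> exists (U : {vspace E}) (ts : seq K),
  [/\ uniq ts, forall t, t \in ts -> F t = U, forall t, t \in ts -> t \notin T,
    (D <= size ts * d)%N & (0 < size ts)%N].
Proof.
move=> D0; have [h [Qh [zs [uz sz rz nT]]]] := generic_section T Q0 q_nonzero sq qD D0.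
have hd := degree Qh (zs := zs) (fun z zz => eqP (etrans (esym (comb_zero h z)) (introT eqP (rz z zz)))).
pose us := undup [seq F z | z <- zs].
pose cnt U := size [seq z <- zs | F z == U].
have total : (\sum_(U <- us) cnt U = D)%N.
  rewrite -sz -(size_map F zs) -(perm_size (perm_count_undup [seq F z | z <- zs])).
  rewrite size_flatten /shape -map_comp sumnE big_map; apply: eq_bigr => U _.
  by rewrite /= size_nseq count_map /cnt size_filter.
have [U hU] : exists U, (D <= cnt U * d)%N.
  apply: contrapT => hN.
  have {}hN U : (cnt U * d <= D.-1)%N.
    by rewrite -ltnS prednK // ltnNge; apply/negP => h1; apply: hN; exists U.
  have : (D * d <= size us * D.-1)%N.
    rewrite -[X in (X * d <= _)%N]total big_distrl /= -sum1_size big_distrl /=.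
    rewrite big_seq [X in (_ <= X)%N]big_seq.
    by apply: leq_sum => U _; rewrite mul1n; exact: hN.
  have : (0 < size us)%N.
    by rewrite lt0n; apply: contraTneq D0 => /size0nil u0; rewrite -total u0 big_nil.
  have : (size us * D.-1 <= d * D.-1)%N by rewrite leq_mul2r hd orbT.
  have := hd; rewrite -/us; case: (D) D0 => // D' _ /=; nia.
exists U, [seq z <- zs | F z == U]; split=> //.
- exact: filter_uniq.
- by move=> t; rewrite mem_filter => /andP[/eqP].
- by move=> t; rewrite mem_filter => /andP[_]; exact: nT.
- by move: hU; rewrite /cnt; case: size => //; rewrite mul0n leqn0 => /eqP D00; rewrite D00 in D0.
Qed.

(* The section is, up to factors nonzero at t, the determinant of a matrix of
   polynomials whose value at t has corank dim (F t :&: A). *)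
Lemma vanishing (Y : 'M[K]_(n, i)) (A : {vspace E}) (h : pindex n i -> K) t :
  (forall u : E, (u \in A) = (u *m Y == 0)) ->
  (forall B : 'M[K]_(i, n), \det (B *m Y) = \sum_g h g * \det (colsub (val g) B)) ->
  ('X - t%:P) ^+ (\dim (F t :&: A)) %| comb q h.
Proof.
move=> hA hh.
have [A0 [Y0 [hA0 FA0 _]]] := complement (dF t) (dF t).
have [h0 hh0] := det_mul_minors ch0 Y0.
(* Column [a] of [Y0] is replaced by a unit vector, so by [cramer_row] the matrix [N] evaluates at
   [s] to a multiple of the adjugate of [brow (F s) *m Y0] times [brow (F s)]: a polynomial frame of
   the curve wherever [comb q h0] does not vanish. *)
pose Yc a c : 'M[K]_(n, i) := \matrix_(x, y) if y == a then (x == c)%:R else Y0 x y.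
have /(_ _ _)/cid hc a c := det_mul_minors ch0 (Yc a c).
pose N : 'M[{poly K}]_(i, n) := \matrix_(a, c) comb q (sval (hc a c)).
pose Z := N *m map_mx polyC Y.
have evalE s c : (forall g : pindex n i, (q g).[s] = c * plu (F s) g) ->
   forall (h1 : pindex n i -> K) (Y1 : 'M[K]_(n, i)),
   (forall B : 'M[K]_(i, n), \det (B *m Y1) = \sum_g h1 g * \det (colsub (val g) B)) ->
   (comb q h1).[s] = c * \det (brow (F s) *m Y1).
  move=> hs h1 Y1 hh1; rewrite horner_comb hh1 big_distrr /=; apply: eq_bigr => g _.
  by rewrite hs mulrCA.
have Zs s c : (forall g : pindex n i, (q g).[s] = c * plu (F s) g) ->
    map_mx (horner_eval s) Z = c *: \adj (brow (F s) *m Y0) *m (brow (F s) *m Y).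
  move=> hs; rewrite map_mxM [RHS]mulmxA; congr (_ *m _); last first.
    by apply/matrixP => a b; rewrite !mxE /= /horner_eval hornerC.
  apply/matrixP => a b; rewrite mxE [N _ _]mxE -scalemxAl [RHS]mxE cramer_row /horner_eval.
  rewrite [LHS](evalE _ _ hs _ _ (svalP (hc a b))); congr (_ * \det _).
  apply/matrixP => x y; rewrite [LHS]mxE [RHS]mxE; case: eqVneq => [->|ya].
    rewrite (bigD1 b) //= [Yc _ _ _ _]mxE !eqxx /= mulr1 big1 ?addr0 // => z /negPf zb.
    by rewrite [Yc _ _ _ _]mxE eqxx zb mulr0.
  by rewrite [RHS]mxE; apply: eq_bigr => z _; rewrite [Yc _ _ _ _]mxE (negPf ya).
(* This comes from det (adj M) det M = (det M)^i. As [comb q h0] is nonzero at [t], the order of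
   vanishing passes from det Z to [comb q h]. *)
have idet : \det Z * comb q h0 = (comb q h0) ^+ i * comb q h.
  apply: poly_eqP_eval => s; have [c c0 hs] := qF s.
  rewrite !hornerM horner_exp (evalE _ _ hs _ _ hh) (evalE _ _ hs _ _ hh0).
  have -> : (\det Z).[s] = \det (map_mx (horner_eval s) Z) by rewrite det_map_mx.
  rewrite (Zs _ _ hs) det_mulmx detZ.
  have : \det (\adj (brow (F s) *m Y0)) * \det (brow (F s) *m Y0) = \det (brow (F s) *m Y0) ^+ i.
    by rewrite -det_mulmx mul_adj_mx det_scalar.
  rewrite exprMn => <-; ring.
have r0 : (comb q h0).[t] != 0.
  have [c c0 hs] := qF t; rewrite (evalE _ _ hs _ _ hh0) mulf_neq0 //.
  by rewrite (det_brow (dF t) hA0) FA0 eqxx.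
have cop k m : coprimep (('X - t%:P) ^+ k) ((comb q h0) ^+ m).
  by rewrite coprimep_expl // coprimep_expr // coprimep_sym coprimep_XsubC rootE.
rewrite -(@Gauss_dvdpr _ _ (comb q h0 ^+ i)) // -idet dvdp_mulr //.
apply: dvdp_trans (det_vanishing Z t); apply: dvdp_exp2l.
have [c c0 hs] := qF t; rewrite (Zs _ _ hs).
have := rank_brow (dF t) hA; have := mxrankM_maxr (c *: \adj (brow (F t) *m Y0)) (brow (F t) *m Y).
by move=> h1 h2; rewrite leq_subRL; [apply: leq_trans h2; rewrite leq_add2r|exact: rank_leq_row].
Qed.

Lemma size_roots (p : {poly K}) (ts : seq K) k : p != 0 -> uniq ts ->
  (forall t, t \in ts -> ('X - t%:P) ^+ k %| p) -> (size ts * k < size p)%N.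
Proof.
move=> p0 uts hts; suff : \prod_(t <- ts) ('X - t%:P) ^+ k %| p.
  move=> /(dvdp_leq p0); apply: leq_trans.
  set P := \prod_(_ <- _) _; have P0 : (0 < size P)%N.
    rewrite size_poly_gt0 prodf_seq_neq0; apply/allP => t _ /=.
    by rewrite expf_neq0 // polyXsubC_eq0.
  by rewrite -(prednK P0) ltnS /P prodrXl size_exp size_prod_XsubC.
elim: ts uts hts => [|t ts IH] /=; first by rewrite big_nil dvd1p.
move=> /andP[tts uts] hts; rewrite big_cons Gauss_dvdp.
  by rewrite hts ?inE ?eqxx //= IH // => t' h; rewrite hts // inE h orbT.
rewrite coprimep_expl // prodrXl coprimep_expr // coprimep_sym coprimep_XsubC.
by rewrite root_prod_XsubC.
Qed.

Lemma constant_curve t t' : D = 0%N -> F t = F t'.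
Proof.
move=> D0; have [c c0 hc] := qF t; have [c' c'0 hc'] := qF t'.
apply: (plu_inj (c := c'^-1 * c) (dF t) (dF t')) => g.
rewrite -mulrA -hc; have := sq g; rewrite D0 => /size1_polyC qg.
by have := hc' g; rewrite qg !hornerC => ->; rewrite mulKf.
Qed.

(* Let U be a point with m >= D / d preimages and U :&: A2 = 0, where A2 contains
   F t1 :\: F t2, and let A be a complement of F t1 containing U :\: F t1.  The
   Pluecker section that vanishes on the spaces meeting A has degree at most D and
   vanishes to order dim (U :&: A) at the m preimages, so dim (U :&: A) <= d. *)
Lemma kernel_bound t1 t2 : (i <= \dim (F t1 :&: F t2)%VS + d)%N.
Proof.
case: (posnP D) => [D0|D0].
  by rewrite (constant_curve t2 t1 D0) capvv dF leq_addr.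
have [A2 [Y2 [hY2 FA2 sA2]]] := complement (dF t2) (dF t1).
have [h2 hh2] := det_mul_minors ch0 Y2.
have root2 t : (comb q h2).[t] != 0 -> (F t :&: A2 = 0)%VS.
  rewrite comb_zero; under eq_bigr do rewrite /plu.
  by rewrite -hh2 (det_brow (dF t) hY2) negbK => /eqP.
have r2 : comb q h2 != 0.
  apply: contraTneq isT => e; have := det_brow (dF t2) hY2.
  rewrite FA2 eqxx /= hh2 => /negbT; rewrite -comb_zero e horner0 eqxx //.
have [T hT] := poly_roots r2.
have [U [ts [uts Uts nts Dts ts0]]] := fiber T D0.
have [t0 t0ts] : exists t0, t0 \in ts by case: (ts) ts0 => // t0 ts' _; exists t0; rewrite inE eqxx.
have dU : \dim U = i by rewrite -(Uts t0 t0ts).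
have UA2 : (U :&: A2 = 0)%VS.
  by rewrite -(Uts t0 t0ts); apply: root2; rewrite -hT nts.
have dUF : (\dim (U :&: F t1) <= \dim (F t1 :&: F t2))%N.
  have := dimv_sum_cap (U :&: F t1)%VS (F t1 :\: F t2)%VS.
  have -> : (U :&: F t1 :&: (F t1 :\: F t2) = 0)%VS.
    apply/eqP; rewrite -subv0 -UA2; apply: capvS sA2; exact: capvSl.
  have : (\dim (U :&: F t1 + (F t1 :\: F t2)) <= \dim (F t1))%N.
    by apply: dimvS; rewrite subv_add capvSr diffvSl.
  have := dimv_cap_compl (F t1) (F t2); rewrite dimv0; dlia.
have [A [Y [hY FA sA]]] := complement (dF t1) dU.
have [h hh] := det_mul_minors ch0 Y.
have r1 : comb q h != 0.
  apply: contraTneq isT => e; have := det_brow (dF t1) hY.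
  rewrite FA eqxx /= hh => /negbT; rewrite -comb_zero e horner0 eqxx //.
have hsz : (size ts * \dim (U :&: A) <= D)%N.
  rewrite -ltnS; apply: leq_trans (size_comb h sq); apply: size_roots => // t tts.
  by rewrite -(Uts t tts); exact: vanishing.
have : (\dim (U :\: F t1) <= \dim (U :&: A))%N.
  by apply: dimvS; rewrite subv_cap diffvSl.
have := leq_trans hsz Dts; rewrite leq_pmul2l // => h1 h3.
have := dimv_cap_compl U (F t1); rewrite dU; dlia.
Qed.

(** For d = 1 some subspace U has D preimages. A linear form vanishing at U and at one other point
    of the curve has D + 1 roots, hence vanishes on the whole curve, which thus lies on the line
    through these two points. *)
Lemma line_span t1 t2 t3 : d = 1%N -> F t1 != F t2 ->
  exists a b, forall g, plu (F t3) g = a * plu (F t1) g + b * plu (F t2) g.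
Proof.
move=> d1 F12; have D0 : (0 < D)%N.
  by case: (posnP D) => // /(constant_curve t1 t2) e; rewrite e eqxx in F12.
have [U [ts [uts Uts _ Dts ts0]]] := fiber [::] D0.
rewrite d1 muln1 in Dts.
have span t t' : F t != U -> exists a b, forall g, plu (F t') g = a * plu U g + b * plu (F t) g.
  move=> tU; pose m := #|pindex n i|.
  pose row (V : {vspace E}) : 'rV[K]_m := \row_k plu V (enum_val k).
  have : (row (F t') <= col_mx (row U) (row (F t)))%MS.
    rewrite submxE; apply/eqP/rowP => j; rewrite !mxE.
    pose h g := cokermx (col_mx (row U) (row (F t))) (enum_rank g) j.
    have sumh V : \sum_g h g * plu V g = (row V *m cokermx (col_mx (row U) (row (F t)))) 0 j.
      rewrite mxE (reindex_onto enum_val enum_rank) /= => [|g _]; last exact: enum_rankK.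
      rewrite (eq_bigl xpredT) => [|k]; last by rewrite enum_valK eqxx.
      by apply: eq_bigr => k _; rewrite /h enum_valK !mxE mulrC.
    have /eqP := mulmx_coker (col_mx (row U) (row (F t))).
    rewrite mul_col_mx -col_mx0 => /eqP/eq_col_mx[hU hF].
    have zU : \sum_g h g * plu U g = 0 by rewrite sumh hU mxE.
    have zF : \sum_g h g * plu (F t) g = 0 by rewrite sumh hF mxE.
    have -> : \sum_k row (F t') 0 k * cokermx (col_mx (row U) (row (F t))) k j =
       \sum_g h g * plu (F t') g by rewrite sumh mxE.
    apply/eqP; rewrite -comb_zero; apply: contraT => nz.
    have c0 : comb q h != 0 by apply: contraNneq nz => ->; rewrite horner0.
    suff : ((size (t :: ts) * 1)%N < D.+1)%N by rewrite muln1 /= ltnS ltnNge Dts.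
    apply: leq_trans (size_comb h sq); apply: size_roots => // [|t''].
      by rewrite /= uts andbT; apply: contra tU => /Uts ->.
    rewrite expr1 dvdp_XsubCl rootE comb_zero inE => /orP[/eqP ->|/Uts ->].
      by rewrite zF.
    by rewrite zU.
  case/submxP => x hx; exists (x 0 (lshift 1 0)), (x 0 (rshift 1 0)) => g.
  have : row (F t') = lsubmx x *m row U + rsubmx x *m row (F t).
    by rewrite -mul_row_col hsubmxK.
  by move=> /rowP/(_ (enum_rank g)); rewrite !mxE !big_ord1 !mxE !enum_rankK.
case: (eqVneq (F t1) U) => [t1U|t1U].
  have t2U : F t2 != U by rewrite -t1U eq_sym.
  by have [a [b h]] := span t2 t3 t2U; exists a, b => g; rewrite h t1U.
have [a [b h]] := span t1 t2 t1U; have [a' [b' h']] := span t1 t3 t1U.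
have a0 : a != 0.
  apply: contraNneq F12 => a0; apply/eqP; apply: (plu_inj (c := b)) => // g.
  by rewrite h a0 mul0r add0r.
exists (b' - a' / a * b), (a' / a) => g; rewrite h' h.
by field.
Qed.

End Kernel.

(** * Polynomial presentations of rational curves in affine charts *)

Section PrimitiveFamily.
Variable K : numClosedFieldType.

(** Common roots are divided out one at a time, by induction on the size of one nonzero member. *)
Lemma primitive_family (I : finType) (p : I -> {poly K}) g0 : p g0 != 0 ->
  exists c q, [/\ c != 0, forall g, p g = c * q g & forall t, exists g, (q g : {poly K}).[t] != 0].
Proof.
move: {2}(size (p g0)) (leqnn (size (p g0))) => m; elim: m p => [|m IH] p.
  by rewrite leqn0 size_poly_eq0 => /eqP ->; rewrite eqxx.
move=> sm p0.
have [h|] := pselect (forall t, exists g, (p g).[t] != 0).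
  by exists 1, p; split; rewrite ?oner_neq0 // => g; rewrite mul1r.
move=> /existsNP[t ht].
have dv g : 'X - t%:P %| p g.
  rewrite dvdp_XsubCl rootE; apply: contrapT => h; apply: ht; exists g; exact/negP.
pose p' g := p g %/ ('X - t%:P).
have pE g : p g = ('X - t%:P) * p' g by rewrite mulrC divpK.
have p'0 : p' g0 != 0 by apply: contraNneq p0 => h; rewrite pE h mulr0.
have [|c [q [c0 hq nq]]] := IH p' _ p'0.
  rewrite -ltnS; apply: leq_trans sm; rewrite (pE g0).
  by rewrite mulrC size_Mmonic ?monicXsubC // size_XsubC addn2.
exists (('X - t%:P) * c), q; split=> // [|g]; first by rewrite mulf_neq0 // polyXsubC_eq0.
by rewrite -mulrA -hq.
Qed.

(* The affine chart of P^1 whose point at infinity is (1, c). *)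
Definition ptv (c t : K) : 'rV[K]_2 := \row_(j < 2) (if j == 0 then t else 1 + c * t).

Lemma ptv_neq0 c t : ptv c t != 0.
Proof.
apply/eqP => /rowP h; have := h 0; have := h 1; rewrite !mxE /= => + t0.
by rewrite t0 mulr0 addr0 => /eqP; rewrite oner_eq0.
Qed.

End PrimitiveFamily.

Section RegularCurve.
Local Open Scope classical_set_scope.
Local Open Scope card_scope.
Variables (R : realType) (n : nat).
Local Notation C := R[i].
Local Notation E := 'rV[C]_n.
Local Notation P2 := 'rV[C]_2.

Lemma pluE i (V : {vspace E}) (g : pindex n i) : pluecker V g = plu V g.
Proof. by congr (\det _); apply/matrixP => a b; rewrite !mxE. Qed.

Lemma card_seq_le (T : choiceType) (A : set T) (d : nat) (s : seq T) :
  A #= `I_d -> uniq s -> (forall x, x \in s -> A x) -> (size s <= d)%N.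
Proof.
elim: d A s => [|d IH] A s.
  rewrite II0 card_eq0 => /eqP A0 _ sA; case: s sA => // x s /(_ x).
  by rewrite inE eqxx A0 => /(_ isT).
case/eq_cardSP => x Ax Ad us sA.
have := IH _ (rem x s) Ad (rem_uniq x us).
have memr y : y \in rem x s -> (A `\ x) y.
  by rewrite mem_rem_uniq // inE => /andP[/eqP yx /sA].
move=> /(_ memr); case: (boolP (x \in s)) => xs; last by rewrite rem_id // => /leqW.
by rewrite size_rem //; case: (s) xs.
Qed.

(** A chart misses one point of P^1, and [pol v] vanishes at [c] exactly when that point is [v];
    finitely many points can be avoided. *)
Lemma chart_direction (vs : seq P2) : (forall v, v \in vs -> v != 0) ->
  exists c, forall v, v \in vs -> exists t, <[v]>%VS = <[ptv c t]>%VS.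
Proof.
move=> vs0; pose pol (v : P2) := lin (v 0 1) (- v 0 0).
have P0 : \prod_(v <- vs) pol v != 0.
  rewrite prodf_seq_neq0; apply/allP => v /vs0 v0 /=; apply: contraNneq v0 => h.
  have := linE (v 0 1) (- v 0 0) 0; have := linE (v 0 1) (- v 0 0) 1.
  rewrite -/(pol v) h !horner0 mul0r mul1r addr0 => + /esym v1.
  rewrite v1 add0r => /esym/eqP; rewrite oppr_eq0 => /eqP v00.
  apply/eqP/rowP => j; rewrite mxE; case: (unliftP 0 j) => [j' ->|->//].
  by have -> : lift 0 j' = 1 by apply/val_inj; rewrite /= [j']ord1.
have [c] := poly_nonroot P0; rewrite horner_prod prodf_seq_neq0 => /allP hc.
exists c => v vvs; have := hc v vvs; rewrite /= linE => y0.
set y := v 0 1 + _ in y0; exists (v 0 0 / y).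
have vE : v = y *: ptv c (v 0 0 / y).
  apply/rowP => j; rewrite !mxE; case: (unliftP 0 j) => [j' ->|->] /=.
    have -> : lift 0 j' = 1 by apply/val_inj; rewrite /= [j']ord1.
    by rewrite /= /y; field.
  by field.
apply/eqP; rewrite eqEdim !dim_vline (vs0 v vvs) ptv_neq0 leqnn andbT -memvE [X in X \in _]vE.
by rewrite memvZ // memv_line.
Qed.

Section Chart.
Variables (f : {vspace P2} -> flagseq R n) (p : 'I_n.-1) (d : nat) (c : C).
Hypotheses (rf : regular_map f)
  (deg : pluecker_degree p.+1 [set V p | V in [set f <[v]>%VS | v in [set v | v != 0]]] d).

Let F (t : C) : {vspace E} := f <[ptv c t]>%VS p.

Let dF t : \dim (F t) = p.+1.
Proof. by have [/(_ _ (ptv_neq0 c t))[/(_ p)]] := rf. Qed.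

Let pn : (p.+1 <= n)%N. Proof. by have := ltn_ord p; lia. Qed.

Lemma local_chart t0 : exists (de : {poly C}) (q : pindex n p.+1 -> {poly C}),
  de.[t0] != 0 /\ forall t, de.[t] != 0 ->
    exists2 c : C, c != 0 & forall g, (q g).[t] = c * plu (F t) g.
Proof.
have [_ /(_ p _ (ptv_neq0 c t0))[e [m [De [P [_ De0 _ hP]]]]]] := rf.
pose x (j : 'I_2) : C := if j == 0 then 0 else 1.
pose y (j : 'I_2) : C := if j == 0 then 1 else c.
have ev t : (fun k => x k + t * y k) = (fun k => ptv c t 0 k).
  by apply/funext => j; rewrite /x /y !mxE; case: eqP => _; rewrite ?add0r ?mulr1 // mulrC.
have [de hde] := mpoly_on_line De x y.
have /(_ _)/cid hq g := mpoly_on_line (P g) x y.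
exists de, (fun g => sval (hq g)); split; first by rewrite hde ev.
move=> t; rewrite hde ev => h; have [s [s0 hs]] := hP _ (ptv_neq0 c t) h.
by exists s => // g; rewrite (svalP (hq g)) ev -pluE -hs.
Qed.

(** The local presentation at 0, freed of common roots, is valid everywhere: it has the same ratios
    as the presentation near any [t0], by an identity of polynomials that holds wherever both
    denominators are nonzero. *)
Lemma global_chart : exists q : pindex n p.+1 -> {poly C},
  forall t, exists2 c : C, c != 0 & forall g, (q g).[t] = c * plu (F t) g.
Proof.
have [de0 [q0 [de00 h0]]] := local_chart 0.
have [g0 hg0] := plu_neq0 pn (dF 0).
have q00 : q0 g0 != 0.
  apply/eqP => e; have [s s0 hs] := h0 0 de00.
  by have := hs g0; rewrite e horner0 => /esym/eqP; rewrite mulf_eq0 (negPf s0) (negPf hg0).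
have [ga [q [ga0 hq nq]]] := primitive_family q00.
exists q => t0; have [de1 [q1 [de10 h1]]] := local_chart t0.
have prop g h : q1 g * q h = q1 h * q g.
  have nz : ga * de0 * de1 != 0.
    rewrite !mulf_neq0 //; first by apply: contraNneq de00 => ->; rewrite horner0.
    by apply: contraNneq de10 => ->; rewrite horner0.
  apply: (mulfI nz); apply: poly_eqP_eval => t; rewrite !hornerM.
  case: (eqVneq de0.[t] 0) => [->|d0]; first by rewrite mulr0 !mul0r.
  case: (eqVneq de1.[t] 0) => [->|d1]; first by rewrite mulr0 !mul0r.
  have [s s0 hs] := h0 t d0; have [s' s'0 hs'] := h1 t d1.
  have hga g' : ga.[t] * (q g').[t] = s * plu (F t) g' by rewrite -hornerM -hq hs.
  rewrite !hs'; transitivity (de0.[t] * de1.[t] * (s' * plu (F t) g) * (ga.[t] * (q h).[t])).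
    by ring.
  transitivity (de0.[t] * de1.[t] * (s' * plu (F t) h) * (ga.[t] * (q g).[t])); last by ring.
  by rewrite !hga; ring.
have [s s0 hs] := h1 t0 de10; have [g1 hg1] := plu_neq0 pn (dF t0).
have key h : (q h).[t0] = (q g1).[t0] / plu (F t0) g1 * plu (F t0) h.
  have /(congr1 (fun P => P.[t0])) := prop g1 h; rewrite !hornerM !hs => e.
  apply: (mulfI (mulf_neq0 s0 hg1)); rewrite e; by field.
exists ((q g1).[t0] / plu (F t0) g1); last exact: key.
have [h hh] := nq t0; apply: contraNneq hh => e; by rewrite key e mul0r.
Qed.

Lemma chart_data : exists (q : pindex n p.+1 -> {poly C}) (D : nat) (Q : {mpoly C[#|pindex n p.+1|]}),
  [/\ forall t, exists2 c : C, c != 0 & forall g, (q g).[t] = c * plu (F t) g,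
      forall g, (size (q g) <= D.+1)%N, exists g, (q g)`_D != 0, Q != 0 &
      forall h : pindex n p.+1 -> C, Q.@[fun k => h (enum_val k)] != 0 ->
        forall zs : seq C, (forall z, z \in zs -> \sum_g h g * plu (F z) g = 0) ->
        (size (undup [seq F z | z <- zs]) <= d)%N].
Proof.
have [q hq] := global_chart; have [Q [Q0 hQ]] := deg.
have [g0 hg0] := plu_neq0 pn (dF 0).
have q0 : q g0 != 0.
  have [s s0 hs] := hq 0; apply/eqP => e; have := hs g0; rewrite e horner0.
  by move=> /esym/eqP; rewrite mulf_eq0 (negPf s0) (negPf hg0).
have [gm hgm] : exists gm, forall g, (size (q g) <= size (q gm))%N.
  by exists [arg max_(g > g0) size (q g)]; case: arg_maxnP => // g _ h g'; exact: h.
have sgm : (0 < size (q gm))%N by apply: leq_trans (hgm g0); rewrite size_poly_gt0.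
exists q, (size (q gm)).-1, Q; split=> //.
- by move=> g; rewrite prednK.
- by exists gm; rewrite -lead_coefE lead_coef_eq0 -size_poly_gt0.
move=> h Qh zs hzs; have := hQ h Qh => hc; apply: (card_seq_le hc) => [|U]; first exact: undup_uniq.
rewrite mem_undup => /mapP[z zz ->]; split; last first.
  by rewrite -[RHS](hzs z zz); apply: eq_bigr => g _; rewrite pluE.
exists (f <[ptv c z]>%VS) => //; exists (ptv c z) => //; exact: ptv_neq0.
Qed.

End Chart.

Lemma curve_kernel (f : {vspace P2} -> flagseq R n) (p : 'I_n.-1) d v1 v2 :
  regular_map f ->
  pluecker_degree p.+1 [set V p | V in [set f <[v]>%VS | v in [set v | v != 0]]] d ->
  v1 != 0 -> v2 != 0 -> (p.+1 <= \dim (f <[v1]> p :&: f <[v2]> p)%VS + d)%N.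
Proof.
move=> rf deg v10 v20.
have [|c hc] := @chart_direction [:: v1; v2].
  by move=> v; rewrite !inE => /orP[]/eqP->.
have [t1 ->] := hc v1 ltac:(by rewrite inE eqxx).
have [t2 ->] := hc v2 ltac:(by rewrite !inE eqxx orbT).
have [q [D [Q [h1 h2 h3 h4 h5]]]] := chart_data c rf deg.
have dF t : \dim (f <[ptv c t]>%VS p) = p.+1.
  by have [/(_ _ (ptv_neq0 c t))[/(_ p)]] := rf.
apply: (kernel_bound _ dF h1 h2 h3 h4 h5).
by have := ltn_ord p; lia.
Qed.

Lemma curve_line (f : {vspace P2} -> flagseq R n) (p : 'I_n.-1) v1 v2 v3 :
  regular_map f ->
  pluecker_degree p.+1 [set V p | V in [set f <[v]>%VS | v in [set v | v != 0]]] 1 ->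
  v1 != 0 -> v2 != 0 -> v3 != 0 -> f <[v1]>%VS p != f <[v2]>%VS p ->
  exists a b : C, forall g : pindex n p.+1,
    plu (f <[v3]>%VS p) g = a * plu (f <[v1]>%VS p) g + b * plu (f <[v2]>%VS p) g.
Proof.
move=> rf deg v10 v20 v30.
have [|c hc] := @chart_direction [:: v1; v2; v3].
  by move=> v; rewrite !inE => /or3P[]/eqP->.
have [t1 ->] := hc v1 ltac:(by rewrite inE eqxx).
have [t2 ->] := hc v2 ltac:(by rewrite !inE eqxx orbT).
have [t3 ->] := hc v3 ltac:(by rewrite !inE eqxx !orbT).
have [q [D [Q [h1 h2 h3 h4 h5]]]] := chart_data c rf deg.
have dF t : \dim (f <[ptv c t]>%VS p) = p.+1.
  by have [/(_ _ (ptv_neq0 c t))[/(_ p)]] := rf.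
have pn : (p.+1 <= n)%N by have := ltn_ord p; lia.
by move=> ne; have := line_span pn dF h1 h2 h3 h4 h5 t3 erefl ne.
Qed.

End RegularCurve.

Section Lines.
Variable K : numClosedFieldType.

Lemma line_eqP (v v' : 'rV[K]_2) : v != 0 -> v' != 0 ->
  v 0 0 * v' 0 1 = v 0 1 * v' 0 0 -> <[v]>%VS = <[v']>%VS.
Proof.
move=> v0 v'0 e.
have rowP2 (x y : 'rV[K]_2) : x 0 0 = y 0 0 -> x 0 1 = y 0 1 -> x = y.
  move=> h0 h1; apply/rowP => j; case: (unliftP 0 j) => [j' ->|->//].
  by have -> : lift 0 j' = 1 by apply/val_inj; rewrite /= [j']ord1.
suff [c vE] : exists c, v = c *: v'.
  by apply/eqP; rewrite eqEdim !dim_vline v0 v'0 leqnn andbT -memvE vE memvZ // memv_line.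
case: (eqVneq (v' 0 0) 0) => [z|nz].
  have v'1 : v' 0 1 != 0 by apply: contraNneq v'0 => z1; apply/eqP/rowP2; rewrite mxE.
  exists (v 0 1 / v' 0 1); apply: rowP2; rewrite !mxE; last by field.
  by apply: (mulIf v'1); rewrite e z !mulr0 mul0r.
exists (v 0 0 / v' 0 0); apply: rowP2; rewrite !mxE; first by field.
by apply: (mulIf nz); rewrite -e; field.
Qed.

Lemma linear_root (al be : K) : al != 0 -> exists2 u : 'rV[K]_2, u != 0 &
  u 0 0 * al + u 0 1 * be = 0 /\
  forall v : 'rV[K]_2, v != 0 -> v 0 0 * al + v 0 1 * be = 0 -> <[v]>%VS = <[u]>%VS.
Proof.
move=> al0; pose u : 'rV[K]_2 := \row_(j < 2) (if j == 0 then be else - al).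
have u0 : u != 0.
  by apply/eqP => /rowP/(_ 1); rewrite !mxE /= => /eqP; rewrite oppr_eq0 (negPf al0).
exists u => //; split=> [|v v0 e]; first by rewrite !mxE /=; ring.
apply: line_eqP => //; rewrite !mxE /= mulrN; apply/eqP.
by rewrite -subr_eq0 -opprD oppr_eq0 e.
Qed.

End Lines.

(** * Pluecker coordinates of the pencil *)

Section PlueckerBasis.
Variables (K : numClosedFieldType) (n : nat).
Local Notation E := 'rV[K]_n.

Definition bas_mx (e : 'I_n -> E) i (le_in : (i <= n)%N) : 'M[K]_(i, n) :=
  \matrix_a e (widen_ord le_in a).

Lemma plu_flag (e : 'I_n -> E) i (le_in : (i <= n)%N) : is_basis e ->
  exists2 c, c != 0 & forall g : pindex n i,
    \det (colsub (val g) (bas_mx e le_in)) = c * plu (flag e i) g.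
Proof.
move=> eb; have di : \dim (flag e i) = i by rewrite (flagP eb).1.
have memE (u : E) : (u \in flag e i) -> (u <= bas_mx e le_in)%MS.
  case/memv_sumP => us hus ->; apply: summx_sub => j ji.
  have ji' : (j < i)%N by move: ji; rewrite inE.
  have /vlineP[x ->] := hus j ji; apply: scalemx_sub.
  have -> : e j = row (Ordinal ji') (bas_mx e le_in).
    by rewrite rowK; congr e; apply/val_inj.
  exact: row_sub.
have /submxP[T hT] : (bas_mx e le_in <= brow i (flag e i))%MS.
  apply/row_subP => a; rewrite rowK -mem_brow //.
  by rewrite cs_mem // inE /=.
have rT : (i <= \rank T)%N.
  apply: leq_trans (mxrankM_maxl T (brow i (flag e i))); rewrite -hT -{1}(brow_free di).
  apply/mxrankS/row_subP => a; apply: memE; rewrite (mem_brow _ di); exact: row_sub.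
exists (\det T) => [|g].
  by rewrite -unitfE -unitmxE -row_free_unit /row_free eqn_leq rank_leq_row.
rewrite hT /plu -det_mulmx; congr (\det _); apply/matrixP => a b; rewrite !mxE.
by apply: eq_bigr => x _; rewrite !mxE.
Qed.

Section TCurvePluecker.
Variables (g : 'I_n -> E) (k l : 'I_n) (i : nat).
Hypotheses (gb : is_basis g) (kl : (k < l)%N) (kil : (k < i <= l)%N).

Let le_in : (i <= n)%N. Proof. by have := ltn_ord l; lia. Qed.

(** Minors of an explicit basis instead of [vbasis]: proportional to the Pluecker coordinates, but
    normalized so as to be linear in [v]. *)
Definition tcoord (v : 'rV[K]_2) (x : pindex n i) : K :=
  \det (colsub (val x) (bas_mx (tbasis g k l v) le_in)).

Lemma tcoord_plu v : v != 0 -> exists2 c, c != 0 & forall x,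
  tcoord v x = c * plu (tflag g k l <[v]>%VS i) x.
Proof.
by move=> v0; have [c c0 h] := plu_flag le_in (tbasisP gb kl v0); exists c => // x;
  rewrite tflag_in // -h.
Qed.

(** Only row k of the matrix depends on [v], because i <= l excludes position l. *)
Lemma tcoordE v x : tcoord v x = v 0 0 * tcoord (pt10 K) x + v 0 1 * tcoord (pt01 K) x.
Proof.
have ki : (k < i)%N by case/andP: kil.
have rowE v' (a : 'I_i) : row a (colsub (val x) (bas_mx (tbasis g k l v') le_in)) =
    \row_b (tbasis g k l v' (widen_ord le_in a)) 0 (val x b).
  by apply/rowP => b; rewrite !mxE.
have notl (a : 'I_i) : (widen_ord le_in a == l) = false.
  by apply/negbTE; rewrite -val_eqE /=; have := ltn_ord a; lia.
apply: (determinant_multilinear (i0 := Ordinal ki)).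
- rewrite !rowE; apply/rowP => b; rewrite !mxE /tbasis.
  have -> : (widen_ord le_in (Ordinal ki) == k) by rewrite -val_eqE.
  by rewrite !tphiE !mxE /= !mul0r !mul1r addr0 add0r.
all: apply/matrixP => a b; rewrite !mxE /tbasis notl.
all: rewrite (_ : (_ == k) = false) //; apply/negbTE; rewrite -val_eqE /=.
all: by have := neq_lift (Ordinal ki) a; rewrite -val_eqE /= eq_sym.
Qed.

Lemma pt_neq : <[pt10 K]>%VS != <[pt01 K]>%VS.
Proof.
apply/eqP => e; have : pt10 K \in <[pt01 K]>%VS by rewrite -e memv_line.
by case/vlineP => c /rowP/(_ 0); rewrite !mxE /= mulr0 => /eqP; rewrite oner_eq0.
Qed.

Lemma tcoord_sum (h : pindex n i -> K) (v : 'rV[K]_2) : v != 0 -> exists2 c, c != 0 &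
  v 0 0 * (\sum_x h x * tcoord (pt10 K) x) + v 0 1 * (\sum_x h x * tcoord (pt01 K) x) =
  c * \sum_x h x * plu (tflag g k l <[v]>%VS i) x.
Proof.
move=> v0; have [c c0 hc] := tcoord_plu v0; exists c => //.
rewrite !big_distrr -big_split /=; apply: eq_bigr => x _.
by rewrite [RHS]mulrCA -hc (tcoordE v) mulrDr; congr (_ + _); rewrite mulrCA.
Qed.

Lemma tcoord_neq0 v : v != 0 -> exists x, tcoord v x != 0.
Proof.
move=> v0; have [c c0 h] := tcoord_plu v0.
have [x hx] := plu_neq0 le_in ((tflagP gb kl v0).1 i le_in).
by exists x; rewrite h mulf_neq0.
Qed.

(** If all these minors vanished, the two end points of the pencil would have proportional Pluecker
    coordinates and coincide. *)
Lemma tcoord_minor : exists x y,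
  tcoord (pt10 K) x * tcoord (pt01 K) y - tcoord (pt10 K) y * tcoord (pt01 K) x != 0.
Proof.
have v0 := pt10_neq0 K; have v1 := pt01_neq0 K.
apply: contrapT => h; have {}h x y :
    tcoord (pt10 K) x * tcoord (pt01 K) y = tcoord (pt10 K) y * tcoord (pt01 K) x.
  by apply/eqP; rewrite -subr_eq0; apply: contraT => h'; case: h; exists x, y.
have [x0 hx0] := tcoord_neq0 v0.
have [c c0 hc] := tcoord_plu v0; have [c' c'0 hc'] := tcoord_plu v1.
have /eqP := pt_neq; apply; apply: (tflag_inj gb kl kil v0 v1).
apply: (@plu_inj _ _ _ le_in _ _ (c'^-1 * (tcoord (pt01 K) x0 / tcoord (pt10 K) x0) * c)).
- exact: (tflagP gb kl v0).1.
- exact: (tflagP gb kl v1).1.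
move=> y; rewrite -[_ * c * _]mulrA -hc; apply: (mulfI c'0); rewrite -hc' !mulrA mulfV // mul1r.
by apply: (mulfI hx0); rewrite [LHS]h; field.
Qed.

Lemma tflag_of_plu (V : {vspace E}) (a b : K) : \dim V = i ->
  (forall x, plu V x = a * tcoord (pt10 K) x + b * tcoord (pt01 K) x) ->
  exists2 v, v != 0 & V = tflag g k l <[v]>%VS i.
Proof.
move=> dV hV; pose v : 'rV[K]_2 := \row_(j < 2) (if j == 0 then a else b).
have hv x : plu V x = tcoord v x by rewrite hV (tcoordE v) !mxE /=.
have v0 : v != 0.
  have [x] := plu_neq0 le_in dV; rewrite hv (tcoordE v); apply: contraNneq => ->.
  by rewrite !mxE !mul0r addr0.
exists v => //; have [c c0 hc] := tcoord_plu v0.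
apply/esym; apply: (@plu_inj _ _ _ le_in _ _ c) => //; first exact: (tflagP gb kl v0).1.
by move=> x; rewrite -hc hv.
Qed.

End TCurvePluecker.
End PlueckerBasis.

(** * Schubert varieties and the pencil as a rational curve *)

Section FlagSeq.
Variables (R : realType) (n : nat).
Local Notation C := R[i].
Local Notation E := 'rV[C]_n.
Local Notation P2 := 'rV[C]_2.
Local Notation rk := (@rank_fun n).
Implicit Types (V F G H : flagseq R n) (W : nat -> {vspace E}).

(* The flag with its trivial terms V_0 = 0 and V_n = E added. *)
Definition ext V (p : nat) : {vspace E} :=
  if p is p'.+1 then (if insub p' is Some j then V j else fullv) else 0%VS.

Definition trunc W : flagseq R n := fun p => W p.+1.

Lemma extE V (p : 'I_n.-1) : ext V p.+1 = V p.
Proof. by rewrite /ext valK. Qed.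

Lemma ext_ge V p : (n <= p)%N -> (0 < p)%N -> ext V p = fullv.
Proof. by case: p => // p np _; rewrite /ext insubN // -leqNgt; lia. Qed.

Lemma ext_cases p : (p <= n)%N -> [\/ p = 0%N, exists j : 'I_n.-1, p = j.+1 | (0 < p)%N /\ p = n].
Proof.
case: p => [|p] pn; first by constructor 1.
case: (ltnP p n.-1) => h; first by constructor 2; exists (Ordinal h).
by constructor 3; lia.
Qed.

Lemma extP V : Fl V -> isflag (ext V).
Proof.
move=> [dV sV]; split=> [p pn|p q pq qn].
  case: (ext_cases pn) => [->|[j ->]|[p0 pE]]; rewrite ?extE ?dimv0 //.
  by subst p; rewrite ext_ge // dim_E.
case: (ext_cases qn) pq => [->|[j ->]|[q0 qE]] pq.
- by rewrite leqn0 in pq; rewrite (eqP pq) subvv.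
- have pn : (p <= n)%N by have := ltn_ord j; lia.
  case: (ext_cases pn) pq => [->|[j' ->]|[p0 pE]] pq; first exact: sub0v.
    by rewrite !extE sV.
  by have := ltn_ord j; lia.
by rewrite (@ext_ge _ q) ?subvf // qE.
Qed.

Lemma truncP W : isflag W -> Fl (trunc W).
Proof.
move=> [dW sW]; split=> [p|p q pq]; rewrite /trunc.
  by rewrite dW //; have := ltn_ord p; lia.
by apply: sW => //; have := ltn_ord q; lia.
Qed.

Lemma ext_trunc W p : isflag W -> (p <= n)%N -> ext (trunc W) p = W p.
Proof.
move=> fW pn; case: (ext_cases pn) => [->|[j ->]|[p0 pE]].
- by rewrite (flag0 fW).
- by rewrite extE.
by subst p; rewrite ext_ge // (flagn fW).
Qed.

Lemma ext_inj V V' : (forall p, (p <= n)%N -> ext V p = ext V' p) -> V = V'.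
Proof.
by move=> h; apply/funext => p; rewrite -!extE h //; have := ltn_ord p; lia.
Qed.

Lemma OmegaP w G V : Fl G -> Fl V -> Omega w G V <->
  forall p q, (p <= n)%N -> (q <= n)%N ->
    (p - rk w p q <= \dim (ext V p :&: ext G (n - q)%N)%VS)%N.
Proof.
move=> fG fV; have [dV _] := extP fV; have [dG _] := extP fG; split=> [[_ h] p q pn qn|h].
  case: (ext_cases pn) => [->//|[j pj]|[p0 pE]].
    have qn' : (n - q <= n)%N by exact: leq_subr.
    case: (ext_cases qn') => [nq|[j' nq]|[q0 nq]].
    - have -> : q = n by lia.
      by rewrite rk_pn // subnn.
    - have -> : q = (n - j'.+1)%N by lia.
      rewrite subKn; last by have := ltn_ord j'; lia.
      by rewrite pj !extE; exact: h.
    have -> : ext G (n - q)%N = fullv by rewrite ext_ge // nq.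
    by rewrite capvf dV // leq_subr.
  subst p; rewrite (@ext_ge _ n) // capfv dG ?leq_subr // rk_nq //.
split=> // p q; have := ltn_ord p; have := ltn_ord q => hq hp.
rewrite -!extE; have := h p.+1 (n - q.+1)%N; rewrite leq_subr subKn; last lia.
by apply=> //; lia.
Qed.

Lemma Omega_wdual u H V : Fl H -> Fl V -> Omega (wdual u) H V <->
  forall p q, (p <= n)%N -> (q <= n)%N -> (rk u p q <= \dim (ext V p :&: ext H q)%VS)%N.
Proof.
move=> fH fV; rewrite OmegaP //; split=> h p q pn qn.
  have := h p (n - q)%N pn (leq_subr _ _); rewrite /wdual rk_rev ?leq_subr // !subKn //.
  exact: rk_le.
have := h p (n - q)%N pn (leq_subr _ _); rewrite /wdual rk_rev // subKn //.
exact: rk_le.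
Qed.

(** The rank function of s_r is min(p, q) except at p = q = r + 1, where r counts from 0. The
    conditions with min(p, q) hold for any subspaces of these dimensions. *)
Lemma Omega_simple (r : 'I_n.-1) F V : Fl F -> Fl V -> Omega (simple_refl r) F V <->
  (0 < \dim (V r :&: ext F (n - r.+1)%N)%VS)%N.
Proof.
move=> fF fV; rewrite OmegaP //; have rn := ltn_ord r.
have rk1 p q : (p <= n)%N -> (q <= n)%N -> rk 1%g p q = minn p q.
  move=> pn qn; rewrite /rank_fun.
  rewrite -[RHS]subn0 -(@card_ord_interval n 0 (minn p q)); last by lia.
  by congr #|pred_of_set _|; apply/setP => x; rewrite !inE perm1 /=; lia.
set s := simple_refl r.
have rks p q : (p <= n)%N -> (q <= n)%N ->
    minn p q = (rk s p q + [&& (r < p), (p <= r.+1), (r < q) & (q <= r.+1)])%N.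
  move=> pn qn; rewrite -rk1 //.
  have := @rk_tperm n 1%g (Ordinal (fst_pos_subproof r)) (Ordinal (snd_pos_subproof r)) p q.
  rewrite !perm1 /= ltnSn => /(_ isT isT) ->; congr (rank_fun _ _ _ + _)%N.
  by apply/permP => x; rewrite permoE perm1.
split=> [h|h p q pn qn].
  have r1n : (r.+1 <= n)%N by lia.
  have := h r.+1 r.+1 r1n r1n; have := rks r.+1 r.+1 r1n r1n; rewrite extE; dlia.
have [dV _] := extP fV; have [dF _] := extP fF.
have := rks p q pn qn.
case: (boolP [&& (r < p)%N, (p <= r.+1)%N, (r < q)%N & (q <= r.+1)%N]) => [h1 _|_ e].
  have -> : p = r.+1 by lia.
  have -> : q = r.+1 by lia.
  have r1n : (r.+1 <= n)%N by lia.
  by move: h; have := rks r.+1 r.+1 r1n r1n; rewrite extE; dlia.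
have := dimv_sum_cap (ext V p) (ext F (n - q)%N); rewrite dV // dF ?leq_subr //.
have := dim_le_n (ext V p + ext F (n - q)%N)%VS; dlia.
Qed.

End FlagSeq.

(** * Degrees of points and of the pencil *)

Section ConstantDegree.
Local Open Scope classical_set_scope.
Local Open Scope card_scope.
Variables (R : realType) (n : nat).
Local Notation C := R[i].
Local Notation E := 'rV[C]_n.

Definition linform (I : finType) (c : I -> C) : {mpoly C[#|I|]} :=
  \sum_g c g *: 'X_(enum_rank g).

Lemma linformE (I : finType) (c h : I -> C) :
  (linform c).@[fun k => h (enum_val k)] = \sum_g h g * c g.
Proof.
rewrite /linform raddf_sum /=; apply: eq_bigr => g _.
by rewrite mevalZ mevalXU enum_rankK mulrC.
Qed.

Lemma linform_neq0 (I : finType) (c : I -> C) g : c g != 0 -> linform c != 0.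
Proof.
move=> cg; apply/eqP => h; have := linformE c (fun g' => (g' == g)%:R); rewrite h meval0.
rewrite (bigD1 g) //= eqxx mul1r big1 ?addr0 => [/esym/eqP|g' /negPf ->]; first by rewrite (negPf cg).
by rewrite mul0r.
Qed.

Lemma point_degree i (V : {vspace E}) : (i <= n)%N -> \dim V = i -> pluecker_degree i [set V] 0.
Proof.
move=> le_in dV; have [g hg] := plu_neq0 le_in dV.
exists (linform (plu V)); split; first exact: linform_neq0 hg.
move=> h; rewrite linformE => h0; rewrite II0 card_eq0; apply/eqP.
apply/seteqP; split=> // W [/= ->] /eqP; rewrite (eq_bigr (fun g => h g * plu V g)).
  by rewrite (negPf h0).
by move=> g' _; rewrite pluE.
Qed.

End ConstantDegree.

Section TCurve.
Local Open Scope classical_set_scope.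
Local Open Scope card_scope.
Variables (R : realType) (n : nat).
Local Notation C := R[i].
Local Notation E := 'rV[C]_n.
Local Notation P2 := 'rV[C]_2.
Variables (g : 'I_n -> E) (k l : 'I_n).
Hypotheses (gb : is_basis g) (kl : (k < l)%N).

Definition tseq (L : {vspace P2}) : flagseq R n := trunc (tflag g k l L).

Lemma tseq_Fl v : v != 0 -> Fl (tseq <[v]>%VS).
Proof. by move=> v0; apply: truncP; exact: tflagP. Qed.

(** Linear forms where the subspace moves, constants elsewhere; the denominator is 1. *)
Lemma tseq_regular : regular_map tseq.
Proof.
split=> [v v0|p v0 v00]; first exact: tseq_Fl.
case kpl : (k < p.+1 <= l)%N.
  exists 1%N, 0%N, 1, (fun x => tcoord g kl kpl (pt10 C) x *: 'X_0 + tcoord g kl kpl (pt01 C) x *: 'X_1).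
  split=> [| |x|v v1 _]; first exact: dhomog1.
  - by rewrite /eval2 meval1 oner_neq0.
  - by rewrite rpredD // rpredZ // dhomogX /= mdeg1.
  have [c c0 hc] := tcoord_plu gb kl kpl v1; exists c; split; [exact: c0|move=> x].
  rewrite pluE -hc (tcoordE g kl kpl v) /eval2 mevalD !mevalZ !mevalXU.
  by rewrite (mulrC (v 0 0)) (mulrC (v 0 1)).
exists 0%N, 0%N, 1, (fun x => (plu (flag g p.+1) x)%:MP).
split=> [| |x|v v1 _]; first exact: dhomog1.
- by rewrite /eval2 meval1 oner_neq0.
- by rewrite -alg_mpolyC rpredZ // dhomog1.
exists 1; split; first exact: oner_neq0.
by move=> x; rewrite pluE mul1r /eval2 mevalC /tseq /trunc /tflag kpl.
Qed.

Definition tcurve : set (flagseq R n) := [set tseq <[v]>%VS | v in [set v | v != 0]].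

Lemma tcurve_rational : rational_curve tcurve.
Proof. by exists tseq; split=> //; exact: tseq_regular. Qed.

Definition interval_deg : 'X_{1..n.-1} := [multinom ((k <= m < l)%N : nat) | m < n.-1].

(** Where the subspace moves, a hyperplane pulls back to a linear form in [v]; it has one root as
    soon as its coefficient at [pt10] is nonzero, which is the generic condition chosen. *)
Lemma tcurve_degree : has_multidegree tcurve interval_deg.
Proof.
move=> p; rewrite mnmE; have pn : (p.+1 <= n)%N by have := ltn_ord p; lia.
case kpl : (k < p.+1 <= l)%N; last first.
  have -> : [set V p | V in tcurve] = [set flag g p.+1].
    apply/seteqP; split=> [V [_ [v v0 <-] <-]|V ->] /=.
      by rewrite /tseq /trunc /tflag kpl.
    exists (tseq <[pt10 C]>%VS); first by exists (pt10 C) => //=; exact: pt10_neq0.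
    by rewrite /tseq /trunc /tflag kpl.
  by apply: point_degree => //; rewrite (flagP gb).1.
have [x0 hx0] := tcoord_neq0 gb kl kpl (pt10_neq0 C).
exists (linform (tcoord g kl kpl (pt10 C))); split; first exact: linform_neq0 hx0.
move=> h; rewrite linformE => al0.
have [u u0 [uroot uuniq]] := linear_root (\sum_x h x * tcoord g kl kpl (pt01 C) x) al0.
have hv v : v != 0 -> \sum_x h x * pluecker (tseq <[v]>%VS p) x = 0 <->
    v 0 0 * (\sum_x h x * tcoord g kl kpl (pt10 C) x) +
    v 0 1 * (\sum_x h x * tcoord g kl kpl (pt01 C) x) = 0.
  move=> v0; have [c c0 ->] := tcoord_sum gb kl kpl h v0.
  rewrite (eq_bigr (fun x => h x * plu (tflag g k l <[v]>%VS p.+1) x)); last first.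
    by move=> x _; rewrite pluE.
  split=> [e|/eqP]; first by rewrite e mulr0.
  by rewrite mulf_eq0 (negPf c0) => /eqP.
have -> : [set V | [set V p | V in tcurve] V /\ \sum_x h x * pluecker V x = 0] =
    [set tseq <[u]>%VS p].
  apply/seteqP; split=> [V [[_ [v v0 <-] <-] /(hv _ v0)/(uuniq _ v0) e]|V ->].
    by rewrite e.
  split; first by exists (tseq <[u]>%VS); [exists u|].
  exact/(hv _ u0).
exact: card_set1.
Qed.

End TCurve.

(** * Maps from P^1 to P^1 are constant or onto *)

Section TwoCharts.
Variable K : numClosedFieldType.
Local Notation P2 := 'rV[K]_2.

(** The transition from chart 0 to chart 1 is t / (1 - t). A nonconstant [S1] would create a pole at
    t = 1: after clearing denominators, evaluation at 1 kills its leading coefficient. *)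
Lemma two_charts_constant (S0 S1 : {poly K}) :
  (forall t, t != 1 -> S0.[t] = S1.[t / (1 - t)]) -> exists a, S0 = a%:P /\ S1 = a%:P.
Proof.
move=> h; pose m := (size S1).-1.
pose u : {poly K} := 1 - 'X.
have uE t : u.[t] = 1 - t by rewrite /u hornerD hornerN hornerX hornerC.
have u0 : u != 0.
  by apply/eqP => /(congr1 (fun P => P.[0])); rewrite uE horner0 subr0 => /eqP; rewrite oner_eq0.
have cancel_u (P P' : {poly K}) : (forall t, t != 1 -> P.[t] = P'.[t]) -> P = P'.
  move=> e; apply: (mulfI u0); apply: poly_eqP_eval => t; rewrite !hornerM uE.
  by case: (eqVneq t 1) => [->|/e ->//]; rewrite subrr !mul0r.
have S1c : (size S1 <= 1)%N.
  rewrite leqNgt; apply/negP => s1.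
  pose T : {poly K} := \sum_(j < size S1) S1`_j *: ('X^j * u ^+ (m - j)).
  have TE : T = S0 * u ^+ m.
    apply: cancel_u => t t1; have t1' : 1 - t != 0 by rewrite subr_eq0 eq_sym.
    rewrite hornerM horner_exp uE h // (horner_coef S1) mulr_suml horner_sum.
    apply: eq_bigr => j _; rewrite hornerZ hornerM hornerXn horner_exp uE expr_div_n -!mulrA.
    congr (_ * (_ * _)).
    have jm : (j <= m)%N by have := ltn_ord j; rewrite /m; lia.
    by rewrite -{2}(subnKC jm) exprD mulKf // expf_neq0.
  have := congr1 (fun P => P.[1]) TE; rewrite /= hornerM horner_exp uE subrr expr0n.
  have -> : (m == 0%N) = false by rewrite /m; lia.
  rewrite mulr0 /T horner_sum.
  have mS : (m < size S1)%N by rewrite /m; lia.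
  rewrite (bigD1 (Ordinal mS)) //= big1 ?addr0 => [|j jm].
    rewrite subnn expr0 mulr1 hornerZ hornerXn expr1n mulr1 => /eqP.
    by rewrite -lead_coefE lead_coef_eq0 -size_poly_eq0; lia.
  rewrite hornerZ hornerM hornerXn horner_exp uE subrr expr0n.
  have -> : (m - j == 0)%N = false.
    have mE : size S1 = m.+1 by rewrite /m prednK // ltnW.
    apply/negbTE; move: jm; rewrite -val_eqE /= -lt0n subn_gt0.
    by have := ltn_ord j; rewrite [X in (_ < X)%N]mE; lia.
  by rewrite !mulr0.
have [a S1a] : exists a, S1 = a%:P by exists S1`_0; exact: size1_polyC.
exists a; split=> //; apply: cancel_u => t t1; by rewrite h // S1a !hornerC.
Qed.

Lemma ptv_line (v : P2) : v != 0 -> exists t, <[v]>%VS = <[ptv 0 t]>%VS \/ <[v]>%VS = <[ptv 1 t]>%VS.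
Proof.
move=> v0; case: (eqVneq (v 0 1) 0) => [y0|y0].
  have x0 : v 0 0 != 0.
    apply: contraNneq v0 => x0; apply/eqP/rowP => j; rewrite mxE.
    case: (unliftP 0 j) => [j' ->|->//].
    by have -> : lift 0 j' = 1 by apply/val_inj; rewrite /= [j']ord1.
  exists (- 1); right; apply: line_eqP => //; first exact: ptv_neq0.
  by rewrite !mxE /= y0; ring.
exists (v 0 0 / v 0 1); left; apply: line_eqP => //; first exact: ptv_neq0.
by rewrite !mxE /=; field.
Qed.

(* A regular map from P^1 to P^1 that misses the point (A, B) is given in each
   affine chart by a polynomial, which the transition map forces to be constant. *)
Lemma missed_point (X Y : {vspace P2} -> K) (A B : K) : (A != 0) || (B != 0) ->
  (forall c, exists qX qY : {poly K}, forall t, exists2 s, s != 0 &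
     qX.[t] = s * X <[ptv c t]>%VS /\ qY.[t] = s * Y <[ptv c t]>%VS) ->
  (forall v : P2, v != 0 -> Y <[v]>%VS * A - X <[v]>%VS * B != 0) ->
  forall v v' : P2, v != 0 -> v' != 0 ->
    X <[v]>%VS * Y <[v']>%VS = X <[v']>%VS * Y <[v]>%VS.
Proof.
move=> AB chart L0 va vb va0 vb0.
pose L (v : P2) := Y <[v]>%VS * A - X <[v]>%VS * B.
pose M (v : P2) := if A != 0 then X <[v]>%VS else Y <[v]>%VS.
have pchart c : exists S : {poly K}, forall t, S.[t] = M (ptv c t) / L (ptv c t).
  have [qX [qY hq]] := chart c; pose qM := if A != 0 then qX else qY.
  pose ell := A *: qY - B *: qX.
  have ellE t s : qX.[t] = s * X <[ptv c t]>%VS -> qY.[t] = s * Y <[ptv c t]>%VS ->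
      ell.[t] = s * L (ptv c t).
    by move=> hX hY; rewrite hornerD hornerN !hornerZ hX hY /L; ring.
  have ell0 t : ell.[t] != 0.
    by have [s s0 [hX hY]] := hq t; rewrite (ellE _ _ hX hY) mulf_neq0 // L0 // ptv_neq0.
  have [a ella] : exists a, ell = a%:P.
    exists ell`_0; apply: size1_polyC.
    suff /eqP -> : size ell == 1%N by [].
    by apply: contraT => /closed_rootP[t]; rewrite rootE (negPf (ell0 t)).
  exists (a^-1 *: qM) => t; have [s s0 [hX hY]] := hq t.
  have := ellE _ _ hX hY; rewrite ella hornerC => ->.
  have Lt : L (ptv c t) != 0 by apply: L0; exact: ptv_neq0.
  have -> : (((s * L (ptv c t))^-1 *: qM).[t]) = (s * L (ptv c t))^-1 * (s * M (ptv c t)).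
    by rewrite hornerZ /qM /M; case: ifP => _; rewrite ?hX ?hY.
  by field; rewrite s0 Lt.
have [S0 hS0] := pchart 0; have [S1 hS1] := pchart 1.
have ML v v' : <[v]>%VS = <[v']>%VS -> M v / L v = M v' / L v' by rewrite /M /L => ->.
have [|a [S0a S1a]] := @two_charts_constant S0 S1.
  move=> t t1; have t1' : 1 - t != 0 by rewrite subr_eq0 eq_sym.
  rewrite hS0 hS1; apply: ML; apply: line_eqP; rewrite ?ptv_neq0 // !mxE /=; by field.
have rho v : v != 0 -> M v = a * L v.
  move=> v0; suff <- : M v / L v = a by rewrite divfK // L0.
  have [t [e|e]] := ptv_line v0; rewrite (ML _ _ e).
    by rewrite -hS0 S0a hornerC.
  by rewrite -hS1 S1a hornerC.
have := rho va va0; have := rho vb vb0; rewrite /M; case: (eqVneq A 0) AB => [A0 /= B0|A0 _].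
  rewrite /L A0 !mulr0 !sub0r => hb ha; apply: (mulfI B0).
  by rewrite hb ha; ring.
rewrite /= => hb ha; apply: (mulfI A0).
have ha' : A * Y <[va]>%VS = L va + X <[va]>%VS * B by rewrite /L; ring.
have hb' : A * Y <[vb]>%VS = L vb + X <[vb]>%VS * B by rewrite /L; ring.
rewrite [LHS]mulrCA [RHS]mulrCA ha' hb' ha hb.
by move: (L va) (L vb) => La Lb; ring.
Qed.

(* As [missed_point], for a map into the line of points [x P + y Q], in coordinates in
   which P and Q become (p1, p2) and (q1, q2). *)
Lemma line_onto (X Y : {vspace P2} -> K) (p1 p2 q1 q2 : K) : p1 * q2 - p2 * q1 != 0 ->
  (forall c, exists qX qY : {poly K}, forall t, exists2 s, s != 0 &
     qX.[t] = s * X <[ptv c t]>%VS /\ qY.[t] = s * Y <[ptv c t]>%VS) ->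
  forall (u : P2 -> P2) (s : P2 -> K), 
  (forall v, v != 0 -> [/\ u v != 0, s v != 0,
     s v * X <[v]>%VS = u v 0 0 * p1 + u v 0 1 * q1 &
     s v * Y <[v]>%VS = u v 0 0 * p2 + u v 0 1 * q2]) ->
  forall va vb w : P2, va != 0 -> vb != 0 -> w != 0 -> <[u va]>%VS <> <[u vb]>%VS ->
  exists2 v, v != 0 & <[u v]>%VS = <[w]>%VS.
Proof.
move=> D0 chart u s hu va vb w va0 vb0 w0 ne.
pose A := w 0 0 * p1 + w 0 1 * q1; pose B := w 0 0 * p2 + w 0 1 * q2.
have AB : (A != 0) || (B != 0).
  apply: contraT; rewrite negb_or !negbK => /andP[/eqP A0 /eqP B0].
  have h0 : w 0 0 * (p1 * q2 - p2 * q1) = A * q2 - B * q1 by rewrite /A /B; ring.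
  have h1 : w 0 1 * (p1 * q2 - p2 * q1) = B * p1 - A * p2 by rewrite /A /B; ring.
  move/eqP: h0; rewrite A0 B0 !mul0r subrr mulf_eq0 (negPf D0) orbF => /eqP h0.
  move/eqP: h1; rewrite A0 B0 !mul0r subrr mulf_eq0 (negPf D0) orbF => /eqP h1.
  move: w0; rewrite (_ : w = 0) ?eqxx //; apply/rowP => j; rewrite mxE.
  case: (unliftP 0 j) => [j' ->|->//].
  by have -> : lift 0 j' = 1 by apply/val_inj; rewrite /= [j']ord1.
have [[v [v0 Lv]]|noL] := pselect (exists v, v != 0 /\ Y <[v]>%VS * A - X <[v]>%VS * B = 0).
  exists v => //; have [u0 s0 hX hY] := hu v v0.
  apply: line_eqP => //; apply/eqP; rewrite -subr_eq0.
  have : (u v 0 0 * w 0 1 - u v 0 1 * w 0 0) * (p1 * q2 - p2 * q1) =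
      - (s v * (Y <[v]>%VS * A - X <[v]>%VS * B)).
    by rewrite [in RHS]mulrBr ![in RHS]mulrA hX hY /A /B; ring.
  by rewrite Lv mulr0 oppr0 => /eqP; rewrite mulf_eq0 (negPf D0) orbF.
have L0 (v : P2) : v != 0 -> Y <[v]>%VS * A - X <[v]>%VS * B != 0.
  by move=> v0; apply/eqP => Lv; apply: noL; exists v.
have cross := missed_point AB chart L0 va0 vb0.
have [ua0 sa0 hXa hYa] := hu va va0; have [ub0 sb0 hXb hYb] := hu vb vb0.
case: ne; apply: line_eqP => //; apply/eqP; rewrite -subr_eq0.
have : (u va 0 0 * u vb 0 1 - u va 0 1 * u vb 0 0) * (p1 * q2 - p2 * q1) =
    s va * s vb * (X <[va]>%VS * Y <[vb]>%VS - X <[vb]>%VS * Y <[va]>%VS).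
  have -> : s va * s vb * (X <[va]>%VS * Y <[vb]>%VS - X <[vb]>%VS * Y <[va]>%VS) =
    (s va * X <[va]>%VS) * (s vb * Y <[vb]>%VS) - (s vb * X <[vb]>%VS) * (s va * Y <[va]>%VS) by ring.
  by rewrite hXa hYa hXb hYb; ring.
by rewrite cross subrr mulr0 => /eqP; rewrite mulf_eq0 (negPf D0) orbF.
Qed.

End TwoCharts.

Section Onto.
Local Open Scope classical_set_scope.
Variables (R : realType) (n : nat).
Local Notation C := R[i].
Local Notation E := 'rV[C]_n.
Local Notation P2 := 'rV[C]_2.
Variables (g : 'I_n -> E) (k l : 'I_n).
Hypotheses (gb : is_basis g) (kl : (k < l)%N).

(** A member of the pencil is determined by its subspace of dimension k + 1, so [f] becomes a map
    from P^1 to P^1. Two Pluecker coordinates with nonzero minor on the pencil serve as the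
    coordinates of [line_onto]. *)
Lemma tcurve_onto (f : {vspace P2} -> flagseq R n) (va vb : P2) : regular_map f ->
  (forall v, v != 0 -> tcurve g k l (f <[v]>%VS)) ->
  va != 0 -> vb != 0 -> f <[va]>%VS <> f <[vb]>%VS ->
  tcurve g k l `<=` [set f <[v]>%VS | v in [set v | v != 0]].
Proof.
move=> rf sub va0 vb0 fab _ [w0 /= w00 <-].
have kn : (k < n.-1)%N by have := ltn_ord l; lia.
pose p : 'I_n.-1 := Ordinal kn.
have kpl : (k < p.+1 <= l)%N by rewrite /= ltnSn.
have [g1 [g2 D0]] := tcoord_minor gb kl kpl.
have /choice[us hus] : forall v : P2, exists us : P2 * C, v != 0 ->
    [/\ us.1 != 0, us.2 != 0, f <[v]>%VS = tseq g k l <[us.1]>%VS &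
      forall x, us.2 * plu (f <[v]>%VS p) x = tcoord g kl kpl us.1 x].
  move=> v; case: (eqVneq v 0) => [v0|v0]; first by exists (0, 0); rewrite v0 eqxx.
  have [u u0 fu] := sub v v0; have [c c0 hc] := tcoord_plu gb kl kpl u0.
  by exists (u, c) => _; split; [exact: u0|exact: c0|rewrite fu|move=> x; rewrite -fu hc].
have chart c : exists qX qY : {poly C}, forall t, exists2 s, s != 0 &
     qX.[t] = s * plu (f <[ptv c t]>%VS p) g1 /\ qY.[t] = s * plu (f <[ptv c t]>%VS p) g2.
  have [q hq] := global_chart p c rf; exists (q g1), (q g2) => t.
  by have [s s0 hs] := hq t; exists s.
have ne : <[(us va).1]>%VS <> <[(us vb).1]>%VS.
  by move=> e; apply: fab; have [_ _ -> _] := hus va va0; have [_ _ -> _] := hus vb vb0; rewrite e.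
have hu (v : P2) : v != 0 -> [/\ (us v).1 != 0, (us v).2 != 0,
    (us v).2 * plu (f <[v]>%VS p) g1 =
      (us v).1 0 0 * tcoord g kl kpl (pt10 C) g1 + (us v).1 0 1 * tcoord g kl kpl (pt01 C) g1 &
    (us v).2 * plu (f <[v]>%VS p) g2 =
      (us v).1 0 0 * tcoord g kl kpl (pt10 C) g2 + (us v).1 0 1 * tcoord g kl kpl (pt01 C) g2].
  by move=> /hus[u0 c0 _ h]; rewrite !h -!tcoordE.
have [v v0 e] := @line_onto _ (fun L => plu (f L p) g1) (fun L => plu (f L p) g2) _ _ _ _ D0 chart
    (fun v => (us v).1) (fun v => (us v).2) hu va vb w0 va0 vb0 w00 ne.
by exists v => //; have [_ _ -> _] := hus v v0; rewrite e.
Qed.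

End Onto.

Lemma rescale (K : fieldType) (a b c c' x y t t' z : K) : c != 0 -> c' != 0 ->
  t = c * x -> t' = c' * y -> z = a * x + b * y -> z = a / c * t + b / c' * t'.
Proof. by move=> c0 c'0 -> -> ->; rewrite !mulrA !divfK. Qed.

(** * Curves meeting three Schubert varieties *)

Section Counting.
Local Open Scope classical_set_scope.
Local Open Scope card_scope.
Variables (R : realType) (n : nat).
Local Notation C := R[i].
Local Notation E := 'rV[C]_n.
Local Notation P2 := 'rV[C]_2.
Local Notation rk := (@rank_fun n).
Variables (w : 'S_n) (r : 'I_n.-1) (F G H : flagseq R n) (e : 'I_n -> E).
Hypotheses (fF : Fl F) (fG : Fl G) (fH : Fl H) (ad : adapted e (ext G) (ext H)).
Local Notation g := (e \o w).
Hypothesis FF : (flag g r.+1 :&: ext F (n - r.+1)%N = 0)%VS.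

Local Notation s := (simple_refl r).

Let gb : is_basis g. Proof. by apply: basis_comp; case: ad. Qed.

Lemma curve_Fl (K : set (flagseq R n)) V : rational_curve K -> K V -> Fl V.
Proof. by move=> [f [[h _] ->]] [v v0 <-]; exact: h. Qed.

Lemma curve_dims (K : set (flagseq R n)) d V V' (p : 'I_n.-1) : rational_curve K ->
  has_multidegree K d -> K V -> K V' -> (p.+1 <= \dim (V p :&: V' p)%VS + d p)%N.
Proof.
move=> [f [rf ->]] /(_ p) deg [v v0 <-] [v' v'0 <-].
exact: curve_kernel rf deg v0 v'0.
Qed.

Lemma curve_point (K : set (flagseq R n)) d V V' (p : 'I_n.-1) : rational_curve K ->
  has_multidegree K d -> K V -> K V' -> d p = 0%N -> V p = V' p.
Proof.
move=> rK dK KV KV' d0; have := curve_dims p rK dK KV KV'; rewrite d0 addn0.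
have [/(_ p) dV _] := curve_Fl rK KV; have [/(_ p) dV' _] := curve_Fl rK KV'.
move=> h; have /eqP <- : (V p :&: V' p)%VS == V p by rewrite eqEdim capvSl dV.
by apply/eqP; rewrite eqEdim capvSr dV'.
Qed.

(** Outside k <= r < l the subspace of dimension r + 1 is that of [flag g], which [FF] keeps away
    from F. *)
Lemma tseq_simple (k l : 'I_n) (v : P2) : Omega s F (tseq g k l <[v]>%VS) -> (k <= r < l)%N.
Proof.
move=> Om; have fV : Fl (tseq g k l <[v]>%VS) by case: Om.
move/(Omega_simple r fF fV): Om; rewrite /tseq /trunc /tflag.
by case: ifP => [//|_]; rewrite FF dimv0.
Qed.

Lemma tseq_omega_G (k l : 'I_n) (v : P2) : (k < l)%N -> (w k < w l)%N -> v != 0 ->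
  Omega w G (tseq g k l <[v]>%VS).
Proof.
move=> kl wkl v0; apply/(OmegaP _ fG (tseq_Fl gb kl v0)) => p q pn qn.
by rewrite ext_trunc //; [exact: (tflag_G ad)|exact: tflagP].
Qed.

Lemma tseq_omega_H (k l : 'I_n) (v : P2) : (k < l)%N -> (w k < w l)%N -> v != 0 ->
  Omega (wdual (permo w (tperm k l))) H (tseq g k l <[v]>%VS).
Proof.
move=> kl wkl v0; apply/(Omega_wdual _ fH (tseq_Fl gb kl v0)) => p q pn qn.
by rewrite ext_trunc //; [exact: (tflag_H ad)|exact: tflagP].
Qed.

Lemma cover_lt (k l : 'I_n) : (k < l)%N -> len (permo w (tperm k l)) = (len w).+1 -> (w k < w l)%N.
Proof.
move=> kl lu; rewrite ltnNge leq_eqVlt negb_or; apply/andP; split.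
  by apply: perm_neq; rewrite -val_eqE /=; lia.
apply/negP => h; have := @len_tperm_up n (permo w (tperm k l)) k l kl.
by rewrite !permoE tpermL tpermR h permo_tperm2 lu => /(_ isT); lia.
Qed.

Lemma richardson_line (k l : 'I_n) V : (k < l)%N -> len (permo w (tperm k l)) = (len w).+1 ->
  Omega w G V -> Omega (wdual (permo w (tperm k l))) H V ->
  exists2 v, v != 0 & V = tseq g k l <[v]>%VS.
Proof.
move=> kl lu OG OH; have fV : Fl V by case: OG.
have wkl := cover_lt kl lu; have gap x := @cover_gap n w k l x kl wkl lu.
have [h1 h2] := line_flag ad kl wkl gap (extP fV)
  (fun p q => (OmegaP _ fG fV).1 OG p q) (fun p q => (Omega_wdual _ fH fV).1 OH p q).
have [v v0 hv] := is_tflag gb kl (extP fV) h1 h2.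
exists v => //; apply: ext_inj => p pn; rewrite hv // ext_trunc //; exact: tflagP.
Qed.

Lemma point_curve (V : flagseq R n) : Fl V -> @rational_curve R n [set V].
Proof.
move=> fV; exists (fun=> V); split.
  split=> [//|p v0 v00]; exists 0%N, 0%N, 1, (fun x => (pluecker (V p) x)%:MP).
  split=> [| |x|v v1 _]; first exact: dhomog1.
  - by rewrite /eval2 meval1 oner_neq0.
  - by rewrite -alg_mpolyC rpredZ // dhomog1.
  exists 1; split; first exact: oner_neq0.
  by move=> x; rewrite mul1r /eval2 mevalC.
apply/seteqP; split=> [_ ->|_ [v _ <-]] //=.
by exists (pt10 C) => //=; exact: pt10_neq0.
Qed.

Lemma point_multidegree (V : flagseq R n) : Fl V -> @has_multidegree R n [set V] 0%MM.
Proof.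
move=> fV p; rewrite mnm0E image_set1; apply: point_degree; last exact: fV.1.
by have := ltn_ord p; lia.
Qed.

(** A curve of multidegree zero is a single flag. Its existence gives w <= u, so u covers w, and the
    flag lies on the pencil of that cover. *)
Lemma count_zero_empty u : len u = (len w).+1 ->
  (forall k l : 'I_n, (k <= r < l)%N -> u <> permo w (tperm k l)) ->
  curves_meeting 0%MM (Omega s F) (Omega w G) (Omega (wdual u) H) = set0.
Proof.
move=> lu hu; apply/seteqP; split=> // K [rK dK [V0 [K0 O0]] [V1 [K1 O1]] [V2 [K2 O2]]].
have same V V' : K V -> K V' -> V = V'.
  move=> KV KV'; apply/funext => p; apply: (curve_point rK dK KV KV'); exact: mnm0E.
have fV1 := curve_Fl rK K1.
rewrite (same V0 V1) // in O0; rewrite (same V2 V1) // in O2.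
have wu : ble w u.
  by apply: (ble_of_flag ad (extP fV1)); [exact/(OmegaP _ fG fV1)|exact/(Omega_wdual _ fH fV1)].
have [k [l [kl wkl uE]]] := ble_cover wu lu.
rewrite uE in lu O2; have [v v0 V1E] := richardson_line kl lu O1 O2.
by rewrite V1E in O0; exact: (hu k l (tseq_simple O0)).
Qed.

(** The curves are the flags of the pencil that satisfy the divisor condition; [tflag_meet] gives
    one and [tflag_meet_uniq] no other. *)
Lemma count_zero_one (k l : 'I_n) : (k <= r < l)%N -> len (permo w (tperm k l)) = (len w).+1 ->
  curves_meeting 0%MM (Omega s F) (Omega w G) (Omega (wdual (permo w (tperm k l))) H) #= `I_1.
Proof.
move=> krl lu; have kl : (k < l)%N by lia.
have wkl := cover_lt kl lu.
have kpl : (k < r.+1 <= l)%N by lia.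
have rn : (r.+1 <= n)%N by have := ltn_ord r; lia.
have dF : \dim (ext F (n - r.+1)%N) = (n - r.+1)%N by rewrite (extP fF).1 // leq_subr.
have [v v0 hv] := tflag_meet gb kl kpl dF.
pose V := tseq g k l <[v]>%VS; have fV : Fl V by exact: tseq_Fl.
suff -> : curves_meeting 0%MM (Omega s F) (Omega w G) (Omega (wdual (permo w (tperm k l))) H) =
    [set [set V]] by exact: card_set1.
apply/seteqP; split=> [K [rK dK [V0 [K0 O0]] [V1 [K1 O1]] [V2 [K2 O2]]]|K ->] /=.
  have same W W' : K W -> K W' -> W = W'.
    move=> KV KV'; apply/funext => p; apply: (curve_point rK dK KV KV'); exact: mnm0E.
  rewrite (same V0 V1) // in O0; rewrite (same V2 V1) // in O2.
  have [v' v'0 V1E] := richardson_line kl lu O1 O2.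
  have fV1 := curve_Fl rK K1.
  have vv' : <[v']>%VS = <[v]>%VS.
    apply: (tflag_meet_uniq gb kl kpl FF) => //.
    by move/(Omega_simple r fF fV1): O0; rewrite V1E.
  have V1V : V1 = V by rewrite V1E vv'.
  apply/seteqP; split=> [W KW|_ ->] /=; last by rewrite -V1V.
  by rewrite -V1V; apply: same.
split; [exact: point_curve|exact: point_multidegree| | |]; exists V; split=> //.
- exact/(Omega_simple r fF fV).
- exact: tseq_omega_G.
exact: tseq_omega_H.
Qed.

Lemma mem_line (K : set (flagseq R n)) d (k l : 'I_n) (V : flagseq R n) (p : 'I_n.-1) :
  (k < l)%N -> (k < p.+1 <= l)%N -> rational_curve K -> has_multidegree K d -> d p = 1%N ->
  K (tseq g k l <[pt10 C]>%VS) -> K (tseq g k l <[pt01 C]>%VS) -> K V ->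
  exists2 v, v != 0 & V p = tflag g k l <[v]>%VS p.+1.
Proof.
move=> kl kpl rK dK d1 K1 K2 KV; have [/(_ p) dV _] := curve_Fl rK KV.
have [f [rf KE]] := rK; have deg := dK p; rewrite KE d1 in deg.
move: K1 K2 KV; rewrite KE => -[v1 v10 e1] [v2 v20 e2] [v3 v30 e3].
have ne : f <[v1]>%VS p != f <[v2]>%VS p.
  apply/eqP; rewrite e1 e2 => /(tflag_inj gb kl kpl (pt10_neq0 C) (pt01_neq0 C)) h.
  exact: (elimN eqP (pt_neq C) h).
have [a [b hab]] := curve_line rf deg v10 v20 v30 ne.
rewrite e1 e2 e3 -![tseq _ _ _ _ p]/(tflag _ _ _ _ p.+1) in hab.
have [c c0 hc] := tcoord_plu gb kl kpl (pt10_neq0 C).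
have [c' c'0 hc'] := tcoord_plu gb kl kpl (pt01_neq0 C).
apply: (@tflag_of_plu _ _ _ _ _ _ gb kl kpl _ (a / c) (b / c')) => [//|x].
exact: (rescale c0 c'0 (hc x) (hc' x) (hab x)).
Qed.

(** Where d_p = 0 the subspace is constant; where d_p = 1 it lies on the Pluecker line through two
    members of K. So K lies in the pencil, and having two distinct points it is all of it. *)
Lemma curve_eq_tcurve (K : set (flagseq R n)) (k l : 'I_n) : (k < l)%N ->
  rational_curve K -> has_multidegree K (interval_deg k l) ->
  K (tseq g k l <[pt10 C]>%VS) -> K (tseq g k l <[pt01 C]>%VS) -> K = tcurve g k l.
Proof.
move=> kl rK dK K1 K2.
have sub : K `<=` tcurve g k l.
  move=> V KV; have fV := curve_Fl rK KV.
  have out p : (p <= n)%N -> ~~ (k < p <= l)%N -> ext V p = flag g p.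
    move=> pn hp; case: (ext_cases pn) hp => [->|[j ->]|[p0 pE]] hp.
    - by rewrite (flag0 (flagP gb)).
    - rewrite extE (@curve_point K (interval_deg k l) V (tseq g k l <[pt10 C]>%VS) j) //.
        by rewrite /tseq /trunc tflag10.
      by rewrite mnmE; case: (boolP (k <= j < l)%N) => // h; case/negP: hp.
    by subst p; rewrite (flagn (flagP gb)) ext_ge.
  have inl p : (k < p <= l)%N -> (cs g (init n p :\ k) <= ext V p)%VS /\
      (ext V p <= cs g (l |: init n p))%VS.
    move=> kpl; have pn : (p.-1 < n.-1)%N by have := ltn_ord l; lia.
    have pE : p = (Ordinal pn).+1 by rewrite /= prednK //; lia.
    rewrite pE in kpl *; rewrite extE.
    have d1 : interval_deg k l (Ordinal pn) = 1%N by rewrite mnmE; move: kpl; lia.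
    have [v v0 ->] := mem_line kl kpl rK dK d1 K1 K2 KV.
    exact: tflag_sub.
  have [v v0 hv] := is_tflag gb kl (extP fV) out inl.
  exists v; first exact: v0.
  by apply: ext_inj => p pn; rewrite hv // ext_trunc //; exact: tflagP.
apply/seteqP; split=> //.
have [f [rf KE]] := rK; subst K.
have [v1 v10 e1] := K1; have [v2 v20 e2] := K2.
apply: (tcurve_onto gb kl rf _ v10 v20).
  by move=> v v0; apply: sub; exists v.
have kn : (k < n.-1)%N by have := ltn_ord l; lia.
have kpl : (k < k.+1 <= l)%N by rewrite ltnSn.
rewrite e1 e2 => /(congr1 (fun V : flagseq R n => V (Ordinal kn))).
move/(tflag_inj gb kl kpl (pt10_neq0 C) (pt01_neq0 C)) => h.
exact: (elimN eqP (pt_neq C) h).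
Qed.

Lemma sum_shift m (f : nat -> nat) : f 0%N = 0%N -> (0 < m)%N ->
  (\sum_(p < m) f p = \sum_(p < m.-1) f p.+1)%N.
Proof. by case: m => // m f0 _; rewrite big_ord_recl f0 add0n; apply: eq_bigr. Qed.

Lemma eq_of_leq_sum (I : finType) (a b : I -> nat) : (forall i, a i <= b i)%N ->
  (\sum_i b i <= \sum_i a i)%N -> forall i, a i = b i.
Proof.
move=> ab sab i; apply/eqP; rewrite eqn_leq ab /=.
move: sab; rewrite (bigD1 i) //= [X in (_ <= X)%N](bigD1 i) //=.
have : (\sum_(j | j != i) a j <= \sum_(j | j != i) b j)%N by apply: leq_sum.
lia.
Qed.

Lemma curve_through (K : set (flagseq R n)) (u : 'S_n) d V1 V2 : d != 0%MM ->
  (len w).+1 = (len u + 2 * mdeg d)%N -> rational_curve K -> has_multidegree K d ->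
  K V1 -> Omega w G V1 -> K V2 -> Omega (wdual u) H V2 ->
  exists k l : 'I_n, [/\ (k < l)%N, u = permo w (tperm k l), d = interval_deg k l,
    V1 = tseq g k l <[pt10 C]>%VS & V2 = tseq g k l <[pt01 C]>%VS].
Proof.
move=> d0 lwu rK dK K1 O1 K2 O2.
have fV1 := curve_Fl rK K1; have fV2 := curve_Fl rK K2.
have n0 : (0 < n)%N by have := ltn_ord r; lia.
have [c hc] := relpos_exists (extP fV1) (extP fG).
have [b hb] := relpos_exists (extP fV2) (extP fH).
pose a := permo (w0 n) c.
have w02 (x : 'S_n) : permo (w0 n) (permo (w0 n) x) = x.
  by apply/permP => y; rewrite !permoE !permE rev_ordK.
have ha : relpos (ext V1) (ext G) (permo (w0 n) a) by rewrite /a w02.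
have wa : ble w a.
  move=> p q pn qn; have := (OmegaP _ fG fV1).1 O1 p q pn qn.
  rewrite ha ?leq_subr // rk_rev ?leq_subr // subKn //.
  have := rk_le w p q; have := rk_le a p q; lia.
have bu : ble b u.
  by move=> p q pn qn; have := (Omega_wdual _ fH fV2).1 O2 p q pn qn; rewrite hb.
pose kk p := (p - \dim (ext V1 p :&: ext V2 p)%VS)%N.
have kd (p : 'I_n.-1) : (kk p.+1 <= d p)%N.
  have := curve_dims p rK dK K1 K2; rewrite /kk !extE; lia.
have defE : defect (ext V1) (ext V2) = (\sum_(p < n.-1) kk p.+1)%N.
  by rewrite /defect -(@sum_shift n kk).
have defd : (defect (ext V1) (ext V2) <= mdeg d)%N.
  by rewrite defE mdegE; apply: leq_sum => p _.
have dpos : (0 < mdeg d)%N by rewrite lt0n mdeg_eq0.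
have lwa := ble_len_le wa; have lbu := ble_len_le bu.
have [same|[h1 h2]] := core_bound ad (extP fV1) (extP fV2) ha hb.
  (* Equal flags would give w <= a <= b <= u, against the length equation with |d| > 0. *)
  have ab : ble a b.
    apply: (ble_of_flag ad (extP fV1)) => p q pn qn.
      by rewrite ha ?leq_subr // rk_rev ?leq_subr // subKn.
    by rewrite same // hb.
  have := ble_len_le ab; lia.
have [|k [l [kl ba Va Vb hk]]] := h2; first lia.
(* The inequalities w <= a, b <= u and defect <= |d| must all be equalities, the last one in each
   dimension. *)
have aw : w = a by apply: ble_len_eq => //; lia.
have ub : b = u by apply: ble_len_eq => //; lia.
exists k, l; split=> //.
- by rewrite -ub ba aw.
- apply/mnmP => p; rewrite mnmE.
  have hs : (\sum_(i < n.-1) d i <= \sum_(i < n.-1) kk i.+1)%N by rewrite -defE -mdegE; lia.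
  rewrite -(eq_of_leq_sum kd hs p) /kk hk //; by have := ltn_ord p; lia.
- apply: ext_inj => p pn; rewrite Va // ext_trunc //; last exact: tflagP (pt10_neq0 C).
  by rewrite tflag10 // aw.
apply: ext_inj => p pn; rewrite Vb // ext_trunc //; last exact: tflagP (pt01_neq0 C).
by rewrite tflag01 // ba flag_compA aw.
Qed.

Lemma curve_through_meets (K : set (flagseq R n)) (u : 'S_n) d : d != 0%MM ->
  (len w).+1 = (len u + 2 * mdeg d)%N ->
  curves_meeting d (Omega s F) (Omega w G) (Omega (wdual u) H) K ->
  exists k l : 'I_n, [/\ (k <= r < l)%N, u = permo w (tperm k l), d = interval_deg k l &
    K = tcurve g k l].
Proof.
move=> d0 lwu [rK dK [V0 [K0 O0]] [V1 [K1 O1]] [V2 [K2 O2]]].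
have [k [l [kl uE dE V1E V2E]]] := curve_through d0 lwu rK dK K1 O1 K2 O2.
rewrite dE in dK; rewrite V1E in K1; rewrite V2E in K2.
have KE := curve_eq_tcurve kl rK dK K1 K2.
exists k, l; split=> //.
by move: K0 O0; rewrite KE => -[v v0 <-]; exact: tseq_simple.
Qed.

Lemma count_positive_empty (u : 'S_n) d : d != 0%MM ->
  (len w).+1 = (len u + 2 * mdeg d)%N ->
  (forall k l : 'I_n, (k <= r < l)%N -> d = interval_deg k l -> u <> permo w (tperm k l)) ->
  curves_meeting d (Omega s F) (Omega w G) (Omega (wdual u) H) = set0.
Proof.
move=> d0 lwu hu; apply/seteqP; split=> // K /(curve_through_meets d0 lwu)[k [l [krl uE dE _]]].
exact: (hu k l).
Qed.

Lemma tperm_ord_inj (k l k' l' : 'I_n) : (k < l)%N -> (k' < l')%N ->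
  tperm k l = tperm k' l' -> k = k' /\ l = l'.
Proof.
move=> kl kl' e'; have hk : tperm k' l' k = l by rewrite -e' tpermL.
have hl : tperm k' l' l = k by rewrite -e' tpermR.
move: hk; case: tpermP => [-> //|kE lE|_ _ kE].
  by rewrite kE in kl; rewrite lE in kl'; have := ltn_trans kl kl'; rewrite ltnn.
by move: kl; rewrite kE ltnn.
Qed.

(** The pencil itself qualifies: its end points are coordinate flags in the two Schubert varieties,
    and some member satisfies the divisor condition. *)
Lemma count_positive_one (k l : 'I_n) : (k <= r < l)%N ->
  (len w).+1 = (len (permo w (tperm k l)) + 2 * mdeg (interval_deg k l))%N ->
  curves_meeting (interval_deg k l) (Omega s F) (Omega w G)
    (Omega (wdual (permo w (tperm k l))) H) #= `I_1.
Proof.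
move=> krl lwu; have kl : (k < l)%N by lia.
have d0 : interval_deg k l != 0%MM.
  by apply/eqP => /mnmP/(_ r); rewrite mnmE mnm0E krl.
suff -> : curves_meeting (interval_deg k l) (Omega s F) (Omega w G)
    (Omega (wdual (permo w (tperm k l))) H) = [set tcurve g k l] by exact: card_set1.
apply/seteqP; split=> [K /(curve_through_meets d0 lwu)[k' [l' [krl' uE _ ->]]]|_ ->] /=.
  have kl' : (k' < l')%N by lia.
  have [<- <- //] : k = k' /\ l = l'.
  by apply: tperm_ord_inj => //; apply: (@mulIg _ w); exact: uE.
have kpl : (k < r.+1 <= l)%N by lia.
have rn : (r.+1 <= n)%N by have := ltn_ord r; lia.
have dF : \dim (ext F (n - r.+1)%N) = (n - r.+1)%N by rewrite (extP fF).1 // leq_subr.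
have [v v0 hv] := tflag_meet gb kl kpl dF.
have fl10 := tflagP gb kl (pt10_neq0 C); have fl01 := tflagP gb kl (pt01_neq0 C).
split; [exact: tcurve_rational|exact: tcurve_degree| | |].
- exists (tseq g k l <[v]>%VS); split; first by exists v.
  by apply/(Omega_simple r fF (tseq_Fl gb kl v0)).
- exists (tseq g k l <[pt10 C]>%VS); split; first by exists (pt10 C) => //=; exact: pt10_neq0.
  apply/(OmegaP _ fG (tseq_Fl gb kl (pt10_neq0 C))) => p q pn qn.
  by rewrite ext_trunc // tflag10 //; exact: (coord_flag_G ad).
exists (tseq g k l <[pt01 C]>%VS); split; first by exists (pt01 C) => //=; exact: pt01_neq0.
apply/(Omega_wdual _ fH (tseq_Fl gb kl (pt01_neq0 C))) => p q pn qn.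
by rewrite ext_trunc // tflag01 // -flag_compA; exact: (coord_flag_H ad).
Qed.

End Counting.

(** * General flags *)

Section GenericFrame.
Variables (K : comNzRingType) (n : nat).

Lemma shift_ord_subproof (q : nat) (c : 'I_n) : (c - q < n)%N.
Proof. exact: leq_ltn_trans (leq_subr _ _) (ltn_ord c). Qed.
Definition shift_ord q (c : 'I_n) : 'I_n := Ordinal (shift_ord_subproof q c).

(** For invertible H and G this is invertible exactly when H_q and G_(n-q) are complementary. *)
Definition stack (H G : 'M[K]_n) (q : nat) : 'M[K]_n :=
  \matrix_(c, j) if (c < q)%N then H c j else G (shift_ord q c) j.

(** Up to a determinant, the coordinates of the last row spanning G_(n-k) in the rows of H_(k+1) and
    G_(n-k-1). The H part of this expression lies in both H_(k+1) and G_(n-k); the adjugate keeps it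
    polynomial. *)
Definition frame_coef (H G : 'M[K]_n) (k : 'I_n) : 'rV[K]_n :=
  row (rev_ord k) G *m \adj (stack H G k.+1).

(* A vector on the line [H_(k+1) :&: G_(n-k)], polynomial in the entries of [H] and [G]. *)
Definition frame_vec (H G : 'M[K]_n) (k : 'I_n) : 'rV[K]_n :=
  (\row_c if (c <= k)%N then frame_coef H G k 0 c else 0) *m H.

(* Invertible exactly when the flag of w in the basis [frame_vec] is transversal to
   the flag of F in dimension p. *)
Definition frame_mx (F G H : 'M[K]_n) (w : 'S_n) (p : nat) : 'M[K]_n :=
  \matrix_(c, j) if (c < p)%N then frame_vec H G (w c) 0 j else F (shift_ord p c) j.

Definition frame_det (F G H : 'M[K]_n) (w : 'S_n) (p : nat) : K :=
  (\prod_(q < n.+1) \det (stack H G q)) * \det (frame_mx F G H w p) * \det F.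

End GenericFrame.

Section GenericFrameMap.
Variables (K K' : comNzRingType) (f : {rmorphism K -> K'}) (n : nat).

Lemma map_stack (H G : 'M[K]_n) q : map_mx f (stack H G q) = stack (map_mx f H) (map_mx f G) q.
Proof. by apply/matrixP => a b; rewrite !mxE; case: ifP. Qed.

Lemma map_frame_vec (H G : 'M[K]_n) k :
  map_mx f (frame_vec H G k) = frame_vec (map_mx f H) (map_mx f G) k.
Proof.
rewrite /frame_vec map_mxM; congr (_ *m _); apply/rowP => c.
have -> : frame_coef (map_mx f H) (map_mx f G) k = map_mx f (frame_coef H G k).
  by rewrite /frame_coef map_mxM map_mx_adj map_stack map_row.
by rewrite !mxE; case: ifP => // _; rewrite rmorph0.
Qed.

Lemma map_frame_det (F G H : 'M[K]_n) w p :
  f (frame_det F G H w p) = frame_det (map_mx f F) (map_mx f G) (map_mx f H) w p.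
Proof.
rewrite /frame_det !rmorphM rmorph_prod; congr (_ * _ * _); rewrite -?det_map_mx.
- by apply: eq_bigr => q _; rewrite -det_map_mx map_stack.
- congr (\det _); apply/matrixP => a b; rewrite [LHS]mxE [X in f X]mxE [RHS]mxE.
  by case: ifP => _; [rewrite -map_frame_vec [RHS]mxE|rewrite [RHS]mxE].
by [].
Qed.

End GenericFrameMap.

Section FrameBasis.
Variables (K : fieldType) (n : nat).
Local Notation E := 'rV[K]_n.

Definition rows (M : 'M[K]_n) : 'I_n -> E := fun c => row c M.

Lemma row_basis (M : 'M[K]_n) : \det M != 0 -> is_basis (rows M).
Proof.
move=> M0; apply/eqP; rewrite eqEsubv subvf /=; apply/subvP => u _.
have -> : u = (u *m invmx M) *m M by rewrite mulmxKV // unitmxE unitfE.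
by rewrite mulmx_sum_row; apply: memv_suml => c _; rewrite memvZ // cs_mem.
Qed.

Lemma det_scaled_perm (a : 'I_n -> K) (sg : 'I_n -> 'I_n) (M : 'M[K]_n) :
  (forall c, a c != 0) -> injective sg ->
  (forall c, row c M = a c *: delta_mx 0 (sg c)) -> \det M != 0.
Proof.
move=> a0 sgi hM; have -> : M = diag_mx (\row_c a c) *m perm_mx (perm sgi).
  apply/row_matrixP => c; rewrite hM row_mul row_diag_mx mxE -scalemxAl -rowE.
  by congr (_ *: _); apply/rowP => j; rewrite !mxE permE eqxx eq_sym.
rewrite det_mulmx det_perm mulf_neq0 ?signr_eq0 // det_diag.
by apply/prodf_neq0 => c _; rewrite mxE.
Qed.

(** With H the standard flag, G the reversed one and F beginning with the vectors numbered w(p),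
    ..., w(n-1), all matrices involved become scaled permutation matrices. *)
Lemma frame_det_point (w : 'S_n) (p : nat) : (p <= n)%N ->
  exists F G H : 'M[K]_n, frame_det F G H w p != 0.
Proof.
move=> pn.
pose rot (c : 'I_n) : nat := if (c + p < n)%N then (c + p)%N else (c + p - n)%N.
have rotP c : (rot c < n)%N by rewrite /rot; have := ltn_ord c; case: ifP; lia.
pose rho c : 'I_n := Ordinal (rotP c).
have rhoi : injective rho.
  move=> c c' /(congr1 val); rewrite /= /rot => h; apply/val_inj => /=; move: h.
  by have := ltn_ord c; have := ltn_ord c'; case: ifP; case: ifP; lia.
pose F : 'M[K]_n := \matrix_c delta_mx 0 (w (rho c)).
pose G : 'M[K]_n := \matrix_c delta_mx 0 (rev_ord c).
exists F, G, 1%:M.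
have H1 (c : 'I_n) : row c 1%:M = delta_mx 0 c :> 'rV[K]_n by rewrite rowE mulmx1.
have rowS q c : row c (stack 1%:M G q) =
    if (c < q)%N then delta_mx 0 c else delta_mx 0 (rev_ord (shift_ord q c)).
  case: ifP => cq; apply/rowP => j; rewrite !mxE cq.
    by have /rowP/(_ j) := H1 c; rewrite !mxE.
  by [].
have dS q : (q <= n)%N -> \det (stack 1%:M G q) != 0.
  move=> qn.
  apply: (@det_scaled_perm (fun=> 1) (fun c => if (c < q)%N then c else rev_ord (shift_ord q c))).
  - by move=> _; exact: oner_neq0.
  - move=> c c' e; have := congr1 val e; have := ltn_ord c; have := ltn_ord c'.
    by move=> hc' hc; case: ifP; case: ifP => /= h1 h2 h3; apply/val_inj => /=; lia.
  by move=> c; rewrite rowS scale1r; case: ifP.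
have vec (k : 'I_n) : frame_vec 1%:M G k = \det (stack 1%:M G k.+1) *: delta_mx 0 k.
  rewrite /frame_vec mulmx1.
  have -> : frame_coef 1%:M G k = \det (stack 1%:M G k.+1) *: delta_mx 0 k.
    rewrite /frame_coef rowK rev_ordK.
    have {1}<- : row k (stack 1%:M G k.+1) = delta_mx 0 k by rewrite rowS ltnSn.
    by rewrite -row_mul mul_mx_adj rowE mul_mx_scalar.
  apply/rowP => c; rewrite !mxE; case: ifP => // ck.
  by case: (eqVneq c k) => [e|_]; [by move: ck; rewrite e leqnn|rewrite andbF mulr0].
rewrite /frame_det !mulf_neq0 //.
- by apply/prodf_neq0 => q _; rewrite dS // -ltnS.
- apply: (@det_scaled_perm (fun c => if (c < p)%N then \det (stack 1%:M G (w c).+1) else 1) w).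
  + by move=> c; case: ifP => _; rewrite ?oner_neq0 // dS.
  + exact: perm_inj.
  move=> c; apply/rowP => j; rewrite mxE mxE; case: ifP => cp; first by rewrite vec.
  rewrite !mxE mul1r; congr (_ && (_ == _))%:R; congr (w _).
  apply/val_inj; have hs : nat_of_ord (shift_ord p c) = (c - p)%N by [].
  by have := ltn_ord c; rewrite /= /rot hs; case: ifP; lia.
apply: (@det_scaled_perm (fun=> 1) (fun c => w (rho c))).
- by move=> _; exact: oner_neq0.
- by move=> c c' /perm_inj/rhoi.
by move=> c; rewrite rowK scale1r.
Qed.

Lemma frame_dets (F G H : 'M[K]_n) w p : frame_det F G H w p != 0 ->
  [/\ forall q, (q <= n)%N -> \det (stack H G q) != 0, \det (frame_mx F G H w p) != 0,
      \det F != 0, \det G != 0 & \det H != 0].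
Proof.
rewrite /frame_det !mulf_eq0 !negb_or => /andP[/andP[S0 E0] F0].
have {}S0 q : (q <= n)%N -> \det (stack H G q) != 0.
  by move=> qn; have /prodf_neq0/(_ (inord q) isT) := S0; rewrite inordK.
split=> //.
  have <- : stack H G 0 = G; last exact: S0.
  by apply/matrixP => a b; rewrite mxE /=; congr (G _ b); apply/val_inj; rewrite /= subn0.
have <- : stack H G n = H; last exact: S0.
by apply/matrixP => a b; rewrite mxE ltn_ord.
Qed.

Lemma frame_transverse (Fm Gm Hm : 'M[K]_n) (w : 'S_n) (p : nat) (F G H : nat -> {vspace E}) :
  (p <= n)%N -> frame_det Fm Gm Hm w p != 0 ->
  (forall q, (q <= n)%N -> F q = flag (rows Fm) q) ->
  (forall q, (q <= n)%N -> G q = flag (rows Gm) q) ->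
  (forall q, (q <= n)%N -> H q = flag (rows Hm) q) ->
  exists e, adapted e G H /\ (flag (e \o w) p :&: F (n - p)%N = 0)%VS.
Proof.
move=> pn /frame_dets[S0 E0 F0 /row_basis Gb /row_basis Hb] hF hG hH.
have isfl (X : nat -> {vspace E}) f : is_basis f -> (forall q, (q <= n)%N -> X q = flag f q) -> isflag X.
  move=> fb hX; have [h1 h2] := flagP fb; split=> [q qn|q q' qq q'n]; first by rewrite hX // h1.
  by rewrite !hX ?h2 // (leq_trans qq).
have fG := isfl _ _ Gb hG; have fH := isfl _ _ Hb hH.
have low (M M0 : 'M[K]_n) q :
    (forall c : 'I_n, (c < n - q)%N -> exists c' : 'I_n, (q <= c')%N /\ row c' M = row c M0) ->
    (flag (rows M0) (n - q)%N <= cs (rows M) (~: init n q))%VS.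
  move=> h; apply/cs_subP => c; rewrite inE => /h[c' [qc]].
  by rewrite /rows => <-; apply: (@cs_mem _ _ (rows M)); rewrite !inE -leqNgt.
have [e ad] : exists e, adapted e G H.
  apply: adapted_exists => // q qn.
  have Sb := row_basis (S0 q qn).
  apply/eqP; rewrite -subv0.
  have -> : 0%VS = (cs (rows (stack Hm Gm q)) (init n q) :&: cs (rows (stack Hm Gm q)) (~: init n q))%VS.
    by rewrite cs_cap // finset.setICr cs0.
  apply: capvS.
    rewrite hH //; apply/cs_subP => c; rewrite inE => cq.
    have -> : rows Hm c = rows (stack Hm Gm q) c by apply/rowP => j; rewrite !mxE cq.
    by apply: (@cs_mem _ _ (rows (stack Hm Gm q))); rewrite inE.
  rewrite hG ?leq_subr //; apply: low => // c cn.
  have cqn : (c + q < n)%N by lia.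
  exists (Ordinal cqn); split; first by rewrite /= leq_addl.
  apply/rowP => j; rewrite !mxE /= ltnNge leq_addl /=; congr (Gm _ j).
  by apply/val_inj; rewrite /= addnK.
exists e; split=> //.
have eb : is_basis e by case: ad.
have vecH k : frame_vec Hm Gm k \in H k.+1.
  rewrite hH //; rewrite /frame_vec mulmx_sum_row; apply: memv_suml => c _.
  rewrite mxE; case: ifP => ck; last by rewrite scale0r mem0v.
  by rewrite memvZ // (@cs_mem _ _ (rows Hm)) // inE ltnS.
have vecG k : frame_vec Hm Gm k \in G (n - k)%N.
  rewrite hG ?leq_subr //.
  have kn := ltn_ord k.
  have : frame_coef Hm Gm k *m stack Hm Gm k.+1 \in flag (rows Gm) (n - k).
    rewrite /frame_coef -mulmxA mul_adj_mx mul_mx_scalar memvZ //.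
    by rewrite (@cs_mem _ _ (rows Gm)) // inE /=; lia.
  have -> : frame_coef Hm Gm k *m stack Hm Gm k.+1 = frame_vec Hm Gm k +
     \sum_(c < n | (k < c)%N) frame_coef Hm Gm k 0 c *: row (shift_ord k.+1 c) Gm.
    rewrite /frame_vec !mulmx_sum_row [X in _ = _ + X]big_mkcond -big_split /=.
    apply: eq_bigr => c _; rewrite mxE; case: leqP => ck.
      by rewrite addr0; congr (_ *: _); apply/rowP => j; rewrite !mxE ltnS ck.
    rewrite scale0r add0r; congr (_ *: _); apply/rowP => j; rewrite !mxE ltnS leqNgt ck //.
  pose tail := \sum_(c < n | (k < c)%N) frame_coef Hm Gm k 0 c *: row (shift_ord k.+1 c) Gm.
  move=> h; rewrite -[frame_vec _ _ _](addrK tail).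
  apply: memvB => //; apply: memv_suml => c kc; rewrite memvZ //.
  by rewrite (@cs_mem _ _ (rows Gm)) // inE /=; have := ltn_ord c; lia.
have Eb := row_basis E0.
have rowE1 (c : 'I_n) : (c < p)%N -> rows (frame_mx Fm Gm Hm w p) c = frame_vec Hm Gm (w c).
  by move=> cp; apply/rowP => j; rewrite !mxE cp.
(* Each [frame_vec] lies on the line of one basis vector of [e], so these rows span the coordinate
   subspace. *)
have <- : cs (rows (frame_mx Fm Gm Hm w p)) (init n p) = flag (e \o w) p.
  apply/eqP; rewrite eqEdim !dim_cs //; last exact: basis_comp.
  rewrite leqnn andbT; apply/cs_subP => c cp; rewrite rowE1; last by rewrite inE in cp.
  have : frame_vec Hm Gm (w c) \in (H (w c).+1 :&: G (n - w c)%N)%VS.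
    by rewrite memv_cap vecH vecG.
  rewrite (adapted_capHG ad) ?leq_subr ?ltn_ord //.
  have -> : [set i : 'I_n | (n - (n - w c) <= i < (w c).+1)%N] = [set w c].
    by apply/setP => i; rewrite !inE -val_eqE /=; have := ltn_ord (w c); lia.
  rewrite cs1; apply: subvP; rewrite -memvE; exact: (@cs_mem _ _ (e \o w)).
apply/eqP; rewrite -subv0.
have -> : 0%VS = (cs (rows (frame_mx Fm Gm Hm w p)) (init n p) :&:
    cs (rows (frame_mx Fm Gm Hm w p)) (~: init n p))%VS.
  by rewrite cs_cap // finset.setICr cs0.
rewrite capvS ?subvv // hF ?leq_subr //; apply: low => // c cn.
have cqn : (c + p < n)%N by lia.
exists (Ordinal cqn); split; first by rewrite /= leq_addl.
apply/rowP => j; rewrite !mxE /= ltnNge leq_addl /=; congr (Fm _ j).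
by apply/val_inj; rewrite /= addnK.
Qed.

End FrameBasis.

Section GenericFlags.
Variables (R : realType) (n : nat).
Local Notation C := R[i].
Local Notation T := ('I_3 * 'I_n * 'I_n)%type.
Local Notation N := #|{: T}|.

Lemma row_flag_ext (A : 'I_n -> 'I_n -> C) (F : flagseq R n) : row_flag A F ->
  \det (\matrix_(k, j) A k j) != 0 ->
  forall q, (q <= n)%N -> ext F q = flag (rows (\matrix_(k, j) A k j)) q.
Proof.
move=> [_ FE] /row_basis Mb q qn; have [->|[j ->]|[q0 qE]] := ext_cases qn.
- by rewrite (flag0 (flagP Mb)).
- rewrite extE FE span_def big_map big_filter big_enum_cond /flag /cs.
  apply: eq_big => [k|k _]; first by rewrite !inE.
  by congr vline; apply/rowP => b; rewrite /rows !mxE.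
by rewrite qE ext_ge; [rewrite (flagn (flagP Mb))|exact: leqnn|rewrite -qE].
Qed.

Lemma row_flag_exists (A : 'I_n -> 'I_n -> C) :
  \det (\matrix_(k, j) A k j) != 0 -> exists F, row_flag A F.
Proof.
move=> /row_basis Mb; have fl := flagP Mb; exists (trunc (flag (rows (\matrix_(k, j) A k j)))).
split=> [|q]; first exact: truncP.
rewrite span_def big_map big_filter big_enum_cond /trunc /flag /cs.
apply: eq_big => [k|k _]; first by rewrite !inE.
by congr vline; apply/rowP => b; rewrite /rows !mxE.
Qed.

Definition generic_mx (i : nat) : 'M[{mpoly C[N]}]_n :=
  \matrix_(k, j) 'X_(enum_rank ((inord i, k, j) : T)).

Definition generic_det (w : 'S_n) (p : nat) : {mpoly C[N]} :=
  frame_det (generic_mx 0) (generic_mx 1) (generic_mx 2) w p.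

Lemma generic_mxE (x : T -> C) i k j :
  (generic_mx i k j).@[fun k => x (enum_val k)] = x (inord i, k, j).
Proof. by rewrite [X in meval _ X]mxE mevalXU enum_rankK. Qed.

Lemma generic_detE (x : T -> C) w p : (generic_det w p).@[fun k => x (enum_val k)] =
  frame_det (\matrix_(k, j) x (inord 0, k, j)) (\matrix_(k, j) x (inord 1, k, j))
    (\matrix_(k, j) x (inord 2, k, j)) w p.
Proof.
rewrite /generic_det -[LHS]/(meval _ _) map_frame_det; congr frame_det;
  by apply/matrixP => k j; rewrite [LHS]mxE [RHS]mxE; exact: generic_mxE.
Qed.

Lemma generic_det_neq0 w p : (p <= n)%N -> generic_det w p != 0.
Proof.
move=> pn; have [F [G [H]]] := @frame_det_point C n w p pn; apply: contra_neq => Q0.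
pose x (t : T) : C := let M := [tuple F; G; H] in tnth M t.1.1 t.1.2 t.2.
have := generic_detE x w p; rewrite Q0 meval0 => ->; congr frame_det;
  by apply/matrixP => k j; rewrite !mxE /x (tnth_nth 0) /= inordK.
Qed.

Lemma general_flags_adapted (w : 'S_n) (r : 'I_n.-1)
    (P : flagseq R n -> flagseq R n -> flagseq R n -> Prop) :
  (forall F G H e, Fl F -> Fl G -> Fl H -> adapted e (ext G) (ext H) ->
     (flag (e \o w) r.+1 :&: ext F (n - r.+1)%N = 0)%VS -> P F G H) ->
  general_flags P.
Proof.
move=> hP; have rn : (r.+1 <= n)%N by have := ltn_ord r; lia.
exists (generic_det w r.+1); split; first exact: generic_det_neq0.
move=> x; rewrite generic_detE => D0 F G H aF aG aH.
have [_ _ F0 G0 H0] := frame_dets D0.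
have [e [ad tr]] := frame_transverse rn D0 (row_flag_ext aF F0) (row_flag_ext aG G0)
  (row_flag_ext aH H0).
by apply: hP ad tr; [case: aF|case: aG|case: aH].
Qed.

Lemma general_flags_meet (P P' : flagseq R n -> flagseq R n -> flagseq R n -> Prop) :
  general_flags P -> general_flags P' ->
  exists F G H, P F G H /\ P' F G H.
Proof.
move=> [Q [Q0 hQ]] [Q' [Q'0 hQ']].
(* This third factor makes the three matrices invertible at the chosen point; otherwise flags with
   these rows might not exist. *)
have D0 := generic_det_neq0 1%g (leq0n n).
have [v] := mpoly_nonzero (mulf_neq0 (mulf_neq0 Q0 Q'0) D0).
pose x (t : T) : C := v (enum_rank t).
have -> : v = (fun k => x (enum_val k)) by apply/funext => k; rewrite /x enum_valK.
rewrite mevalM mulf_eq0 negb_or mevalM mulf_eq0 negb_or => /andP[/andP[h h']].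
rewrite generic_detE => /frame_dets[_ _ F0 G0 H0].
have [F hF] := row_flag_exists F0; have [G hG] := row_flag_exists G0.
have [H hH] := row_flag_exists H0.
by exists F, G, H; split; [exact: hQ h _ _ _ hF hG hH|exact: hQ' h' _ _ _ hF hG hH].
Qed.

Lemma curve_count_inj (u v w : 'S_n) d k k' :
  curve_count R u v w d k -> curve_count R u v w d k' -> k = k'.
Proof.
move=> h h'; have [F [G [H [a b]]]] := general_flags_meet h h'.
by apply/card_eq_II; apply: card_eq_trans b; rewrite card_eq_sym.
Qed.

Lemma GW_count (u v w : 'S_n) d k :
  (len u + len v + len w = 'C(n, 2) + 2 * mdeg d)%N ->
  curve_count R u v w d k -> GW R u v w d = k.
Proof.
move=> e h; rewrite /GW e eqxx; apply: xget_unique => //.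
by move=> k' h'; apply: curve_count_inj h' h.
Qed.

End GenericFlags.

(** * The structure constants *)

Section Chevalley.
Variables (R : realType) (n : nat).
Implicit Types (u w : 'S_n) (r : 'I_n.-1) (k l : 'I_n) (d : 'X_{1..n.-1}).

Lemma len_simple_refl r : len (simple_refl r) = 1%N.
Proof. by rewrite len_tperm /= ?ltnSn //; lia. Qed.

Lemma len_test r w u d :
  (len (simple_refl r) + len w + len (wdual u) == 'C(n, 2) + 2 * mdeg d)%N =
  ((len w).+1 == len u + 2 * mdeg d)%N.
Proof. have := len_w0 u; rewrite len_simple_refl /wdual; lia. Qed.

Lemma mdeg_interval k l : (k < l)%N -> mdeg (interval_deg k l) = (l - k)%N.
Proof.
move=> kl; have ln : (l <= n.-1)%N by have := ltn_ord l; lia.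
rewrite -(card_ord_interval k ln) -sum1dep_card big_mkcond mdegE.
by apply: eq_bigr => m _; rewrite mnmE; case: (k <= m < l)%N.
Qed.

Lemma interval_deg_neq0 r k l : (k <= r < l)%N -> interval_deg k l != 0%MM.
Proof. by move=> krl; rewrite -mdeg_eq0 mdeg_interval; lia. Qed.

Lemma permo_tperm_inj w r (k l k' l' : 'I_n) : (k <= r < l)%N -> (k' <= r < l')%N ->
  permo w (tperm k l) = permo w (tperm k' l') -> (k, l) = (k', l').
Proof.
move=> h h' /(@mulIg _ w) e.
by have [|| -> -> //] := @tperm_ord_inj n k l k' l' _ _ e; lia.
Qed.

Lemma GW_zero w r u d : (forall k l, (k <= r < l)%N -> u <> permo w (tperm k l)) ->
  GW R (simple_refl r) w (wdual u) d = 0%N.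
Proof.
move=> hu; case: (boolP (len (simple_refl r) + len w + len (wdual u) ==
    'C(n, 2) + 2 * mdeg d)%N) => [t|/negPf t]; last by rewrite /GW t.
have := t; rewrite len_test => /eqP lwu.
apply: GW_count; first exact/eqP.
apply: (general_flags_adapted (w := w) (r := r)) => F G H e fF fG fH ad FF.
rewrite II0 card_eq0; apply/eqP.
case: (eqVneq d 0%MM) => [d0|d0].
  subst d; apply: count_zero_empty ad FF _ _ hu => //.
  by move: lwu; rewrite mdeg0; lia.
by apply: count_positive_empty ad FF _ _ d0 lwu _ => // k l krl _; exact: hu.
Qed.

(** At most one curve is counted, so the invariant is a boolean: in degree 0 when t_kl raises the
    length by one, in degree [interval_deg k l] when it lowers the length as far as possible. *)
Lemma GW_tperm w r k l d (u := permo w (tperm k l)) : (k <= r < l)%N ->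
  GW R (simple_refl r) w (wdual u) d =
  ((d == 0%MM) && (len u == (len w).+1)) ||
  ((d == interval_deg k l) && ((len w).+1 == len u + 2 * (l - k))%N) :> nat.
Proof.
move=> krl; have kl : (k < l)%N by lia.
have i0 := interval_deg_neq0 krl.
case: (boolP (len (simple_refl r) + len w + len (wdual u) ==
    'C(n, 2) + 2 * mdeg d)%N) => [t|t]; last first.
  rewrite /GW (negPf t); move: t; rewrite len_test.
  rewrite -/u; case: (eqVneq d 0%MM) => [->|_] /=.
    by rewrite mdeg0 muln0 addn0 [(len w).+1 == _]eq_sym [0%MM == _]eq_sym (negPf i0) => /negPf ->.
  by case: (eqVneq d (interval_deg k l)) => [->|_ _] //=; rewrite mdeg_interval // => /negPf ->.
have := t; rewrite len_test => /eqP lwu.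
apply: GW_count; first exact/eqP.
apply: (general_flags_adapted (w := w) (r := r)) => F G H e fF fG fH ad FF.
case: (eqVneq d 0%MM) => [d0|d0] /=.
  subst d; rewrite mdeg0 in lwu.
  have lu : len u = (len w).+1 by lia.
  by rewrite lu eqxx; apply: count_zero_one ad FF _ _ krl lu.
case: (eqVneq d (interval_deg k l)) => [dE|dE] /=.
  subst d; have := lwu; rewrite mdeg_interval // => <-; rewrite eqxx.
  exact: count_positive_one ad FF _ _ krl lwu.
rewrite II0 card_eq0; apply/eqP; apply: count_positive_empty ad FF _ _ d0 lwu _ => //.
by move=> k' l' krl' dE' /(permo_tperm_inj krl krl')[kk ll]; move: dE; rewrite dE' -kk -ll eqxx.
Qed.

Lemma qconst_single (u v w : 'S_n) d (b : bool) :
  (forall d', GW R u v (wdual w) d' = (d' == d) && b :> nat) ->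
  qconst R u v w = b%:R * 'X_[d].
Proof.
move=> h; rewrite /qconst.
rewrite -(fsbig_widen [set d]%classic) /=; last 2 first.
- by [].
- by move=> d' [_ /eqP/negPf d'd] /=; rewrite h d'd mul0r.
by rewrite fsbig_set1 h eqxx.
Qed.

Lemma qint_interval k l : qint k l = 'X_[interval_deg k l] :> {mpoly int[n.-1]}.
Proof.
rewrite /qint mpolyXE_id big_mkcond; apply: eq_bigr => m _; rewrite mnmE.
by case: ifP => _; rewrite ?expr1 ?expr0.
Qed.

Lemma qconst_zero w r u : (forall k l, (k <= r < l)%N -> u <> permo w (tperm k l)) ->
  qconst R (simple_refl r) w u = 0.
Proof.
move=> hu; rewrite (@qconst_single _ _ _ 0%MM false) ?mul0r // => d.
by rewrite GW_zero // andbF.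
Qed.

Lemma qconst_tperm w r k l (u := permo w (tperm k l)) : (k <= r < l)%N ->
  qconst R (simple_refl r) w u = (len u == (len w).+1)%:R +
    ((len w).+1 == len u + 2 * (l - k))%N%:R * qint k l.
Proof.
move=> krl; rewrite qint_interval.
case: (eqVneq (len u) (len w).+1) => [lu|lu].
  have c2 : ((len w).+1 == len u + 2 * (l - k))%N = false by lia.
  rewrite (@qconst_single _ _ _ 0%MM true) => [|d]; last first.
    by rewrite GW_tperm // -/u c2 andbF orbF lu eqxx.
  by rewrite c2 mul0r addr0 mpolyX0 mulr1.
rewrite add0r; apply: qconst_single => d.
by rewrite GW_tperm // -/u (negPf lu) andbF.
Qed.

End Chevalley.

(** * Collecting the terms of the product *)

Lemma big_single (I : finType) (V : nmodType) (P : pred I) (F : I -> V) i0 :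
  (forall i, P i -> i = i0) -> \sum_(i | P i) F i = if P i0 then F i0 else 0.
Proof.
move=> h; case: ifP => [P0|P0]; last first.
  by rewrite big_pred0 // => i; apply: contraFF P0 => Pi; rewrite -(h _ Pi).
by rewrite (big_pred1 i0) // => i; apply/idP/eqP => [/h|->].
Qed.
Theorem theorem1 (R : realType) (n : nat) (n_gt0 : (0 < n)%N)
    (w : 'S_n) (r : 'I_n.-1) :
  qmul R (sigma (simple_refl r)) (sigma w) =
    \sum_(kl : 'I_n * 'I_n |
            [&& (kl.1 <= r)%N, (r < kl.2)%N &
                len (permo w (tperm kl.1 kl.2)) == (len w + 1)%N])
       sigma (permo w (tperm kl.1 kl.2))
  + \sum_(ij : 'I_n * 'I_n |
            [&& (ij.1 <= r)%N, (r < ij.2)%N,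
                (len (permo w (tperm ij.1 ij.2)))%:Z
                  == (len w)%:Z - (len (tperm ij.1 ij.2))%:Z &
                (len (permo w (tperm ij.1 ij.2)))%:Z
                  == (len w)%:Z - 2 * ((ij.2 : nat)%:Z - (ij.1 : nat)%:Z) + 1])
       qint ij.1 ij.2 *: sigma (permo w (tperm ij.1 ij.2)).
Proof.
rewrite qmul_sigma.
pose f (kl : 'I_n * 'I_n) : 'S_n := permo w (tperm kl.1 kl.2).
(* Both sums are regrouped by the permutation u = w t_kl in order to compare coefficients of
   [sigma u]; a given u comes from at most one pair with k <= r < l. *)
rewrite [X in _ = X + _](partition_big f xpredT) //=.
rewrite [X in _ = _ + X](partition_big f xpredT) //= -big_split /=.
apply: eq_bigr => u _.
case: (pselect (exists kl : 'I_n * 'I_n, (kl.1 <= r < kl.2)%N /\ u = f kl)) => [|no]; last first.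
  rewrite qconst_zero => [|k l krl uE]; last by apply: no; exists (k, l).
  by rewrite scale0r !big_pred0 ?addr0 // => kl; apply/negP => /andP[/and3P[a b _] /eqP uE];
    apply: no; exists kl; rewrite a b uE.
move=> [[k l] /= [krl uE]]; have kl : (k < l)%N by lia.
have only (i : 'I_n * 'I_n) : [&& (i.1 <= r)%N, (r < i.2)%N & f i == u] -> i = (k, l).
  case: i => k' l' /= /and3P[a b /eqP uE'].
  by apply: (@permo_tperm_inj _ w r _ _ _ _ _ krl); [rewrite a b|exact: etrans uE' uE].
rewrite !(@big_single _ _ _ _ (k, l)); last 2 first.
- by move=> i /andP[/and3P[a b _] c]; apply: only; rewrite a b.
- by move=> i /andP[/and3P[a b _] c]; apply: only; rewrite a b.
rewrite /= uE qconst_tperm // /f /= eqxx !andbT.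
have /andP[-> ->] := krl; rewrite /= scalerDl; congr (_ + _).
  by rewrite addn1; case: eqP => _; rewrite ?scale1r ?scale0r.
(* By [len_tperm] the two integer equations agree; moving the subtracted terms across gives the
   equation in natural numbers. *)
have -> : ((len (permo w (tperm k l)))%:Z == (len w)%:Z - (len (tperm k l))%:Z) &&
    ((len (permo w (tperm k l)))%:Z == (len w)%:Z - 2 * ((l : nat)%:Z - (k : nat)%:Z) + 1)
  = ((len w).+1 == len (permo w (tperm k l)) + 2 * (l - k))%N.
  by rewrite len_tperm //; lia.
by case: eqP => _; rewrite ?mul1r ?mul0r ?scale0r.
Qed.
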